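(* Let $H=L^2(0,1)$ and, for $\alpha>0$, let $K_\alpha=\{f\in H: f\ge-\alpha\}$. If $\alpha>0$, then $I_{K_\alpha}\in BV(H,H_1)\cap\mathbf{H}$, where $H_1$ is defined by the weights $c_j=(j\pi)^{\frac12+\varepsilon}$ with $\varepsilon\in(0,\frac32]$.
   Context: Setting: $H=L^2(0,1)$ with inner product $\langle\cdot,\cdot\rangle$. $A=-\frac12\frac{d^2}{dr^2}$ with Dirichlet boundary conditions on $(0,1)$, with eigenbasis $e_j(r)=\sqrt2\sin(j\pi r)$, $j\in\mathbb{N}$. $\mu$ is the Gaussian measure on $H$ with mean $0$ and covariance operator $Q=\frac12A^{-1}$. $D\varphi$ denotes the Fréchet derivative (gradient). $C_b^1(H)$ is the set of bounded differentiable functions $H\to\mathbb{R}$ with continuous bounded derivative. $I_{K_\alpha}$ is the indicator function of $K_\alpha$. $H_1=\{x\in H:\sum_{j}\langle x,e_j\rangle^2c_j^2<\infty\}$ with inner product $\langle x,y\rangle_{H_1}=\sum_jc_j^2\langle x,e_j\rangle\langle y,e_j\rangle$, where $c_j=(j\pi)^{\frac12+\varepsilon}$ for a fixed $\varepsilon\in(0,\frac32]$; then $D(A)\subset H_1\subset H\subset H_1^*$ continuously (identifying $H$ with its dual). $BV(H,H_1)$: $(C_b^1)_{D(A)\cap H_1}$ is the set of maps $G(z)=\sum_{j=1}^m g_j(z)l^j$ with $m\in\mathbb{N}$, $g_j\in C_b^1(H)$, $l^j\in D(A)\cap H_1$. $D^*$ is the adjoint of $D:C_b^1(H)\subset L^2(H,\mu)\to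 L^2(H,\mu;H)$. $L(\log L)^{1/2}(H,\mu)$ is the set of Borel $f:H\to\mathbb{R}$ with $A_{1/2}(|f|)\in L^1(H,\mu)$, $A_{1/2}(x)=\int_0^x(\log(1+s))^{1/2}ds$. $BV(H,H_1)$ is the set of $\rho\in L(\log L)^{1/2}(H,\mu)$ such that $\sup\{\int_HD^*G\,\rho\,d\mu: G\in(C_b^1)_{D(A)\cap H_1},\ \|G(z)\|_{H_1}\le1\ \forall z\in H\}<\infty$. Ray Hamza condition: a nonnegative measurable function $h$ on $\mathbb{R}$ has the Hamza property if $h(s)=0$ for $ds$-a.e. $s\in\mathbb{R}\setminus R(h)$, where $R(h)=\{s\in\mathbb{R}:\int_{s-\varepsilon'}^{s+\varepsilon'}\frac1{h(r)}dr<\infty\text{ for some }\varepsilon'>0\}$. For $l\in H$, $\mathbf{H}_l$ is the set of nonnegative $\rho\in L^1(H,\mu)$ for which there is a nonnegative function $\tilde\rho_l$ with $\tilde\rho_l=\rho$ $\mu$-a.e. and such that $s\mapsto\tilde\rho_l(z+sl)$ has the Hamza property for each $z\in H$. $\mathbf{H}:=\bigcap_k\mathbf{H}_{e_k}$. *)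

(* Defs.v *)
From HB Require Import structures.
From mathcomp Require Import all_boot all_order all_algebra.
From mathcomp Require Import all_classical all_reals all_analysis.
From mathcomp Require Import measurable_realfun.
Set Implicit Arguments.
Unset Strict Implicit.
Unset Printing Implicit Defensive.
Import Order.TTheory GRing.Theory Num.Theory.
Import numFieldNormedType.Exports.
Local Open Scope classical_set_scope.
Local Open Scope ring_scope.
Local Open Scope quotient_scope.

(* [LspaceType2 mu] is the quotient of square-integrable functions by equality
   almost everywhere, without algebraic structure in the library. The alias
   [L2 mu] carries the pointwise operations, the L^2 norm and the Borel
   sigma-algebra of that norm. *)
Definition L2 d (T : measurableType d) (R : realType)
  (mu : {measure set T -> \bar R}) : Type := LspaceType2 mu.

Section L2_structure.
Context d (T : measurableType d) (R : realType).
Variable mu : {measure set T -> \bar R}.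

Let p1 : (1 <= 2%:E :> \bar R)%E := lee1n 2.

Definition L2_repr (x : L2 mu) : {mfun T >-> measurableTypeR R} :=
  repr (LebesgueSpace.sort x).

Definition L2_fun (x : L2 mu) : T -> R := L2_repr x.

Lemma L2_fun_finite (x : L2 mu) : finite_norm mu 2%:E (L2_fun x).
Proof. exact: (@Lebesgue_finite _ _ _ _ _ _ x). Qed.

Lemma L2_funP (x : L2 mu) : L2_fun x \in Lfun mu 2%:E.
Proof.
apply/andP; split; rewrite inE/=; last exact: L2_fun_finite.
exact: (measurable_funPT (L2_repr x)).
Qed.

Definition L2_lfun (x : L2 mu) : LfunType mu p1 := Lfun_Sub p1 (L2_funP x).

Lemma eq_ae_Lnorm2 (f g : T -> R) :
  measurable_fun setT f -> measurable_fun setT g -> f = g %[ae mu] ->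
  ('N[mu]_2%:E[EFin \o f] = 'N[mu]_2%:E[EFin \o g])%E.
Proof.
move=> mf mg fg; rewrite unlock /Lnorm; congr (_ `^ _)%E.
have m_ (h : T -> R) : measurable_fun setT h ->
    measurable_fun setT (fun x => (`|h x| `^ 2)%:E : \bar R).
  move=> mh; apply/measurable_EFinP => /=.
  apply/(@measurableT_comp _ _ _ _ _ _ (fun x : R => x `^ 2)%R) => //.
  exact/measurableT_comp.
apply: ae_eq_integral => //; [exact: m_|exact: m_|].
by apply: filterS fg => x /= fg _; rewrite fg//.
Qed.

Definition to_mfun (f : LfunType mu p1) : {mfun T >-> measurableTypeR R} :=
  HB.pack_for {mfun T >-> measurableTypeR R} (f : T -> measurableTypeR R)
    (@isMeasurableFun.Build _ _ T (measurableTypeR R) f (measurable_funPT f)).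

Definition L2_pi (f : LfunType mu p1) : {mfun_ mu, T >-> measurableTypeR R} :=
  \pi_({mfun_ mu, T >-> measurableTypeR R}) (to_mfun f).

Lemma L2_piE (f : LfunType mu p1) :
  (f : T -> R) = repr (L2_pi f) %[ae mu].
Proof.
have /eqP : \pi_({mfun_ mu, T >-> measurableTypeR R}) (to_mfun f) =
   \pi_({mfun_ mu, T >-> measurableTypeR R}) (repr (L2_pi f)) by rewrite reprK.
by rewrite eqmodE => /asboolP.
Qed.

Lemma L2_pi_finite (f : LfunType mu p1) : finite_norm mu 2%:E (L2_pi f).
Proof.
rewrite /finite_norm -(eq_ae_Lnorm2 _ _ (L2_piE f)).
- exact: Lfunction_finite.
- exact: (measurable_funPT f).
- exact: (measurable_funPT (repr (L2_pi f))).
Qed.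

Definition L2_mk (f : LfunType mu p1) : L2 mu :=
  HB.pack_for (LspaceType mu p1) (L2_pi f)
    (isFinLebesgue.Build _ _ _ _ _ p1 (L2_pi f) (L2_pi_finite f)).

Lemma L2_mkE (f : LfunType mu p1) : L2_fun (L2_mk f) = f %[ae mu].
Proof. by apply: filterS (L2_piE f) => x E _; exact: esym (E I). Qed.

Lemma L2_eq (x y : L2 mu) : L2_fun x = L2_fun y %[ae mu] -> x = y.
Proof.
case: x => x [[xf]]; case: y => y [[yf]] xy.
have E : x = y.
  rewrite -[x]reprK -[y]reprK; apply/eqP; rewrite eqmodE.
  exact/asboolP.
by subst y; rewrite (Prop_irrelevance xf yf).
Qed.

Lemma L2_lfunK (x : L2 mu) : L2_mk (L2_lfun x) = x.
Proof. by apply: L2_eq; exact: L2_mkE. Qed.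

Lemma L2_mk_eq (f g : LfunType mu p1) : (f : T -> R) = g %[ae mu] -> L2_mk f = L2_mk g.
Proof.
move=> fg; apply: L2_eq; apply: filterS3 (L2_mkE f) (L2_mkE g) fg.
by move=> x Ef Eg fgx _; rewrite Ef// Eg// fgx.
Qed.

HB.instance Definition _ := gen_eqMixin (L2 mu).
HB.instance Definition _ := gen_choiceMixin (L2 mu).

Definition L2_zero : L2 mu := L2_mk 0.
Definition L2_opp (x : L2 mu) : L2 mu := L2_mk (- L2_lfun x).
Definition L2_add (x y : L2 mu) : L2 mu := L2_mk (L2_lfun x + L2_lfun y).
Definition L2_scale (a : R) (x : L2 mu) : L2 mu := L2_mk (a *: L2_lfun x).

Lemma L2_zeroE : L2_fun L2_zero = cst 0 %[ae mu].
Proof. exact: L2_mkE. Qed.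

Lemma L2_oppE x : L2_fun (L2_opp x) = (fun t => - L2_fun x t) %[ae mu].
Proof. exact: L2_mkE. Qed.

Lemma L2_addE x y :
  L2_fun (L2_add x y) = (fun t => L2_fun x t + L2_fun y t) %[ae mu].
Proof. exact: L2_mkE. Qed.

Lemma L2_scaleE a x :
  L2_fun (L2_scale a x) = (fun t => a * L2_fun x t) %[ae mu].
Proof. exact: L2_mkE. Qed.

Let addA : associative L2_add.
Proof.
move=> x y z; apply: L2_eq; near=> t => _.
rewrite (near (L2_addE x (L2_add y z)) t)// (near (L2_addE y z) t)//.
by rewrite (near (L2_addE (L2_add x y) z) t)// (near (L2_addE x y) t)// addrA.
Unshelve. all: by end_near. Qed.

Let addC : commutative L2_add.
Proof.
move=> x y; apply: L2_eq; near=> t => _.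
by rewrite (near (L2_addE x y) t)// (near (L2_addE y x) t)// addrC.
Unshelve. all: by end_near. Qed.

Let add0 : left_id L2_zero L2_add.
Proof.
move=> x; apply: L2_eq; near=> t => _.
by rewrite (near (L2_addE L2_zero x) t)// (near L2_zeroE t)// add0r.
Unshelve. all: by end_near. Qed.

Let addN : left_inverse L2_zero L2_opp L2_add.
Proof.
move=> x; apply: L2_eq; near=> t => _.
rewrite (near (L2_addE (L2_opp x) x) t)// (near (L2_oppE x) t)//.
by rewrite (near L2_zeroE t)// addNr.
Unshelve. all: by end_near. Qed.

HB.instance Definition _ :=
  GRing.isZmodule.Build (L2 mu) addA addC add0 addN.

Let scaleA a b x : L2_scale a (L2_scale b x) = L2_scale (a * b) x.
Proof.
apply: L2_eq; near=> t => _.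
rewrite (near (L2_scaleE a (L2_scale b x)) t)// (near (L2_scaleE b x) t)//.
by rewrite (near (L2_scaleE (a * b) x) t)// mulrA.
Unshelve. all: by end_near. Qed.

Let scale1 : left_id 1 L2_scale.
Proof.
move=> x; apply: L2_eq; near=> t => _.
by rewrite (near (L2_scaleE 1 x) t)// mul1r.
Unshelve. all: by end_near. Qed.

Let scaleDr : right_distributive L2_scale +%R.
Proof.
move=> a x y; apply: L2_eq; near=> t => _.
rewrite (near (L2_scaleE a (x + y)) t)// (near (L2_addE x y) t)//.
rewrite (near (L2_addE (L2_scale a x) (L2_scale a y)) t)//.
by rewrite (near (L2_scaleE a x) t)// (near (L2_scaleE a y) t)// mulrDr.
Unshelve. all: by end_near. Qed.

Let scaleDl x : {morph L2_scale^~ x : a b / a + b}.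
Proof.
move=> a b; apply: L2_eq; near=> t => _.
rewrite (near (L2_scaleE (a + b) x) t)//.
rewrite (near (L2_addE (L2_scale a x) (L2_scale b x)) t)//.
by rewrite (near (L2_scaleE a x) t)// (near (L2_scaleE b x) t)// mulrDl.
Unshelve. all: by end_near. Qed.

HB.instance Definition _ :=
  GRing.Zmodule_isLmodule.Build R (L2 mu) scaleA scale1 scaleDr scaleDl.

Definition L2_norm (x : L2 mu) : R := fine ('N[mu]_2%:E[EFin \o L2_fun x])%E.

Lemma L2_norm_mk (f : LfunType mu p1) :
  L2_norm (L2_mk f) = fine ('N[mu]_2%:E[EFin \o f])%E.
Proof.
rewrite /L2_norm; congr fine; apply: eq_ae_Lnorm2; last exact: L2_mkE.
- exact: (measurable_funPT (L2_lfun (L2_mk f))).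
- exact: (measurable_funPT f).
Qed.

Let norm_triangle (x y : L2 mu) : L2_norm (x + y) <= L2_norm x + L2_norm y.
Proof. by rewrite L2_norm_mk; exact: ler_LnormD. Qed.

Let normZ (a : R) (x : L2 mu) : L2_norm (a *: x) = `|a| * L2_norm x.
Proof.
rewrite L2_norm_mk.
have -> : 'N[mu]_2%:E[EFin \o (a *: L2_lfun x)]%E =
    (`|a|%:E * 'N[mu]_2%:E[EFin \o L2_lfun x])%E by exact: LnormZ.
by rewrite -(finite_norm_fine (L2_lfun x)).
Qed.

Let norm_eq0 (x : L2 mu) : L2_norm x = 0 -> x = 0.
Proof.
move=> x0; have /= x0' := @fine_Lnormr_eq0 _ _ _ mu _ p1 (L2_lfun x) x0.
apply: L2_eq; near=> t => _; rewrite (near L2_zeroE t)//.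
exact: (near x0' t).
Unshelve. all: by end_near. Qed.

HB.instance Definition _ :=
  @Lmodule_isNormed.Build R (L2 mu) L2_norm norm_triangle normZ norm_eq0.

(* Borel sigma-algebra of the norm topology *)
HB.instance Definition _ := @isMeasurable.Build (sigma_display (@open (L2 mu)))
  (L2 mu) <<s @open (L2 mu) >> (@sigma_algebra0 _ setT (@open (L2 mu)))
  (@sigma_algebraC _ (@open (L2 mu)))
  (@sigma_algebra_bigcup _ setT (@open (L2 mu))).

Definition L2_dot (x y : L2 mu) : R := \int[mu]_t (L2_fun x t * L2_fun y t).

End L2_structure.
Coercion L2_fun : L2 >-> Funclass.

Section L2_01.
Variable R : realType.

Definition leb01 : {measure set (measurableTypeR R) -> \bar R} :=
  mrestr (@lebesgue_measure R) (measurable_itv `]0%R, 1%R[).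

Local Notation H := (L2 leb01).

Definition sine (j : nat) (r : R) : R :=
  Num.sqrt 2 * sin (j%:R * pi * r).

Lemma sine_Lfun (j : nat) : sine j \in Lfun leb01 2%:E.
Proof.
have mf : measurable_fun setT (sine j).
  apply: measurable_funM => //; apply: measurableT_comp.
    by apply: continuous_measurable_fun; exact: continuous_sin.
  exact: measurable_funM.
apply/andP; split; rewrite inE//= /finite_norm unlock /Lnorm.
rewrite poweR_lty//.
apply: (@le_lt_trans _ _ (\int[leb01]_(x in setT) 2%:E)%E).
  apply: ge0_le_integral => //.
  - by move=> x _; exact: poweR_ge0.
  - apply/measurable_EFinP => /=.
    apply/(@measurableT_comp _ _ _ _ _ _ (fun x : R => x `^ 2)%R) => //.
    exact/measurableT_comp.
  - move=> r _ /=; rewrite lee_fin powR_mulrn// -normrX ger0_norm ?sqr_ge0//.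
    rewrite exprMn sqr_sqrtr// ler_piMr//.
rewrite integral_cst//= /mrestr setTI lebesgue_measure_itv/= lte_fin ltr01.
by rewrite -EFinB -EFinM ltry.
Qed.

(* indexed by j >= 1; [e_ 0] is the zero vector and is never used *)
Definition e_ (j : nat) : H := L2_mk (Lfun_Sub (lee1n 2) (sine_Lfun j)).

(* [dirichlet_d2 x w]: x is in H^2(0,1) with x'' = w and vanishes at 0 and 1;
   u and v are the absolutely continuous versions of x and x'. *)
Definition dirichlet_d2 (x w : H) : Prop :=
  exists u v : R -> R,
    [/\ (x : R -> R) = u %[ae leb01], u 0 = 0, u 1 = 0,
      forall r, 0 <= r <= 1 ->
        u r = u 0 + \int[lebesgue_measure]_(s in `[0, r]) v s &
      forall r, 0 <= r <= 1 ->
        v r = v 0 + \int[lebesgue_measure]_(s in `[0, r]) w s].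

(* graph of the unbounded operator A = - (1/2) d^2/dr^2 *)
Definition A_graph (x y : H) : Prop :=
  exists2 w, dirichlet_d2 x w & y = - 2^-1 *: w.

Definition dom_A : set H := [set x | exists y, A_graph x y].

Definition invA (y : H) : H := xget 0 [set x | A_graph x y].

Definition covQ (y : H) : H := 2^-1 *: invA y.

Definition K_ (alpha : R) : set H :=
  [set f | \forall r \ae leb01, - alpha <= f r].

Section H1.
Variable eps : R.

Definition weight (j : nat) : R := (j%:R * pi) `^ (2^-1 + eps).

Definition H1_space : set H :=
  [set x | (\sum_(1 <= j <oo) ((L2_dot x (e_ j)) ^+ 2 * weight j ^+ 2)%:E
            < +oo)%E].

Definition H1_dot (x y : H) : R :=
  limn (fun n =>
    \sum_(1 <= j < n) weight j ^+ 2 * L2_dot x (e_ j) * L2_dot y (e_ j)).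

Definition H1_norm (x : H) : R := Num.sqrt (H1_dot x x).

End H1.

(* [normal_prob m s] is not the Dirac mass at m when s = 0 *)
Definition gauss_law (m s : R) (B : set R) : \bar R :=
  if s == 0 then \d_m B else normal_prob m s B.

Definition gaussian_measure (mu : probability H R) (m : H) (Q : H -> H) :=
  [/\ forall l, exists a s, forall B : set R, measurable B ->
        mu ((fun z => L2_dot z l) @^-1` B) = gauss_law a s B,
      forall l, \int[mu]_z L2_dot z l = L2_dot m l &
      forall l k, \int[mu]_z (L2_dot (z - m) l * L2_dot (z - m) k) =
        L2_dot (Q l) k].

(* the Riesz representative of the Frechet derivative 'd phi z; a junk value
   where phi is not differentiable *)
Definition gradient (phi : H -> R) (z : H) : H :=
  xget 0 [set g | is_diff z phi (L2_dot g)].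

Definition Cb1 : set (H -> R) :=
  [set phi | [/\ bounded_fun phi,
    forall z, is_diff z phi (L2_dot (gradient phi z)),
    continuous (gradient phi) & bounded_fun (gradient phi)]].

Section BV.
Variables (eps : R) (mu : probability H R).

Definition test_fields : set (H -> H) :=
  [set G | exists m (g : 'I_m -> H -> R) (l : 'I_m -> H),
    [/\ forall j, Cb1 (g j), forall j, (dom_A `&` H1_space eps) (l j) &
      forall z, G z = \sum_(j < m) g j z *: l j]].

(* [Dstar_graph G g]: G in L^2(H, mu; H) is in the domain of D^* and D^* G = g *)
Definition Dstar_graph (G : H -> H) (g : H -> R) : Prop :=
  [/\ measurable_fun setT G,
      mu.-integrable setT (fun z => (`|G z| ^+ 2)%:E),
      g \in Lfun mu 2%:E &
      forall phi, Cb1 phi ->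
        \int[mu]_z L2_dot (gradient phi z) (G z) = \int[mu]_z (phi z * g z)].

(* a representative of D^* G, which is unique mu-a.e.; the default value is not
   reached on [test_fields], which lies in the domain of D^* *)
Definition Dstar (G : H -> H) : H -> R :=
  xget (cst 0) [set g | Dstar_graph G g].

Definition A_half (x : R) : R :=
  \int[lebesgue_measure]_(s in `[0, x]) (ln (1 + s) `^ 2^-1).

Definition LlogL_half : set (H -> R) :=
  [set f : H -> R | measurable_fun setT f /\
    mu.-integrable setT (fun z => (A_half `|f z|)%:E)].

Definition BV : set (H -> R) :=
  [set rho | LlogL_half rho /\
    (ereal_sup [set (\int[mu]_z (Dstar G z * rho z)%:E)%E | G in
      [set G | test_fields G /\ forall z, (H1_norm eps (G z) <= 1)%R]]
     < +oo)%E].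

End BV.

Section Hamza.

(* in \bar R, 0^-1 = +oo *)
Definition regular_set (h : R -> R) : set R :=
  [set s : R | exists2 d : R, 0 < d &
    (\int[lebesgue_measure]_(r in `[(s - d)%R, (s + d)%R]) ((h r)%:E)^-1
      < +oo)%E].

Definition hamza (h : R -> R) : Prop :=
  [/\ forall s, 0 <= h s, measurable_fun setT h &
      \forall s \ae lebesgue_measure, ~ regular_set h s -> h s = 0].

Variable mu : probability H R.

Definition ray_hamza (l : H) : set (H -> R) :=
  [set rho | [/\ mu.-integrable setT (EFin \o rho), forall z, 0 <= rho z &
    exists rho_l : H -> R,
      [/\ forall z, 0 <= rho_l z, rho_l = rho %[ae mu] &
          forall z, hamza (fun s => rho_l (z + s *: l))]]].

Definition ray_hamza_basis : set (H -> R) :=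
  \bigcap_(k in [set k | (1 <= k)%N]) ray_hamza (e_ k).

End Hamza.

End L2_01.

(* Main.v *)
From HB Require Import structures.
Require Import Defs.
From mathcomp Require Import all_boot all_order all_algebra.
From mathcomp Require Import all_classical all_reals all_analysis.
From mathcomp Require Import measurable_realfun.
From mathcomp Require Import lra.
Set Implicit Arguments.
Unset Strict Implicit.
Unset Printing Implicit Defensive.
Import Order.TTheory GRing.Theory Num.Theory.
Import numFieldNormedType.Exports.
Local Open Scope classical_set_scope.
Local Open Scope ring_scope.

(** The constraint set K_alpha is the intersection of the half-spaces
    { z | <z, f_J> >= - alpha }, where <z, f_J> is the average of z over J and J runs
    through the dyadic pieces of the blocks [2^-(k+2), 2^-(k+1)] and of their mirror
    images (K_E, by Lebesgue differentiation). Let K^n be the intersection for the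
    pieces of generation n of the first n blocks on each side; these sets decrease to
    K_alpha.

    Bounded variation. For a test field G with |G(z)|_{H_1} <= 1, bound the integral of
    D^* G over K^n, uniformly in n and G. Replace the indicator of K^n by the smooth
    function phi = exp(- sum_J exp(- kap (<z, f_J> + beta))), so that the integral
    becomes E <D phi, G>. As sum_j c_j^-2 is finite, the unit ball of H_1 is bounded in
    the uniform norm (H1_sup), hence |<f_J, G>| <= C_0 and it suffices to bound the
    flux E sum_J kap exp(- kap (<z, f_J> + beta)) phi. For the pieces J of one block of
    length l, which lies at distance of order l from the boundary,
    <Q 1, f_J> >= l / 4, since Q 1 is the parabola r (1 - r) / 2. So the flux through
    the block is at most 4 / l times the expectation of the derivative of phi_block in
    the direction Q 1, and Gaussian integration by parts (soft_ibp) gives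
    E (phi_block <z, 1>) = - E ((1 - phi_block) <z, 1>) for this expectation. By Young's
    inequality with parameter l^-2 the flux through the block is at most
    2 l^-3 E (1 - phi_block) + 2 l E <z, 1>^2 (flux_bound). When kap tends to infinity,
    E (1 - phi_block) tends to the probability that some piece of the block has an
    average below - alpha. Near the boundary, where the process is pinned at 0, this is
    unlikely: a chaining argument over the generations, based on moments of order 8,
    bounds it by C l^4 uniformly in n (low_bound). The flux is then at most a constant
    times l, and the lengths of the blocks are summable.

    Only one integration by parts formula is needed, for exponentials of sums of
    exponentials of linear functionals. It holds for trigonometric functions, where it
    is the derivative of the characteristic function, and extends to a class closed
    under products, exponentials and bounded limits (trigC).

    Ray Hamza condition. K_alpha is convex, so the indicator of K_alpha along a line is
    the indicator of an interval, which is regular except at its end points. *)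

(** * Integrals of real functions *)

Lemma cvg_sum_seq (K : numFieldType) (V : normedModType K) (T : Type)
  (F : set_system T) {FF : Filter F} (I : Type) (s : seq I) (f : I -> T -> V)
  (l : I -> V) : (forall i, f i x @[x --> F] --> l i) ->
  \sum_(i <- s) f i x @[x --> F] --> \sum_(i <- s) l i.
Proof.
move=> fl; elim: s => [|i s IH].
  by rewrite big_nil; under eq_fun do rewrite big_nil; exact: cvg_cst.
by rewrite big_cons; under eq_fun do rewrite big_cons; exact: cvgD.
Qed.

Section Rint_tools.
Context d (T : measurableType d) (R : realType).
Variable mu : {measure set T -> \bar R}.
Implicit Types f g : T -> R.

Definition Ibl f : Prop := mu.-integrable setT (EFin \o f).

Lemma Ibl_meas f : Ibl f -> measurable_fun setT f.
Proof. by move=> /measurable_int/measurable_EFinP. Qed.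

Lemma Ibl_eq f g : f =1 g -> Ibl f -> Ibl g.
Proof. by move=> /funext ->. Qed.

Lemma Ibl_le g f : measurable_fun setT f -> Ibl g ->
  (forall x, `|f x| <= `|g x|) -> Ibl f.
Proof.
move=> mf ig fg; apply: le_integrable ig => //; first exact/measurable_EFinP.
by move=> x _ /=; rewrite lee_fin.
Qed.

Lemma IblD f g : Ibl f -> Ibl g -> Ibl (fun x => f x + g x).
Proof.
by move=> If Ig; apply: eq_integrable (integrableD measurableT If Ig).
Qed.

Lemma IblZ a f : Ibl f -> Ibl (fun x => a * f x).
Proof.
by move=> If; apply: eq_integrable (integrableZl measurableT a If).
Qed.

Lemma IblN f : Ibl f -> Ibl (fun x => - f x).
Proof. by move=> /(IblZ (-1)); apply: Ibl_eq => x; rewrite mulN1r. Qed.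

Lemma IblB f g : Ibl f -> Ibl g -> Ibl (fun x => f x - g x).
Proof. by move=> If /IblN Ig; exact: IblD If Ig. Qed.

Lemma Ibl_sum (I : Type) (s : seq I) (F : I -> T -> R) :
  (forall i, Ibl (F i)) -> Ibl (fun x => \sum_(i <- s) F i x).
Proof.
move=> IF; elim: s => [|i s IH].
  by apply: Ibl_eq (@integrable0 _ _ _ mu setT) => x; rewrite big_nil.
by apply: Ibl_eq (IblD (IF i) IH) => x; rewrite big_cons.
Qed.

Lemma RintD f g : Ibl f -> Ibl g ->
  \int[mu]_x (f x + g x) = \int[mu]_x f x + \int[mu]_x g x.
Proof. exact: RintegralD. Qed.

Lemma RintB f g : Ibl f -> Ibl g ->
  \int[mu]_x (f x - g x) = \int[mu]_x f x - \int[mu]_x g x.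
Proof. exact: RintegralB. Qed.

Lemma RintZ a f : Ibl f -> \int[mu]_x (a * f x) = a * \int[mu]_x f x.
Proof. exact: RintegralZl. Qed.

Lemma RintN f : Ibl f -> \int[mu]_x (- f x) = - \int[mu]_x f x.
Proof.
move=> If; rewrite -mulN1r -RintZ//.
by apply: eq_Rintegral => x _; rewrite mulN1r.
Qed.

Lemma Rint0 : \int[mu]_x (0 : R) = 0.
Proof. by rewrite /Rintegral integral0. Qed.

Lemma Rint_sum (I : Type) (s : seq I) (F : I -> T -> R) :
  (forall i, Ibl (F i)) ->
  \int[mu]_x (\sum_(i <- s) F i x) = \sum_(i <- s) \int[mu]_x F i x.
Proof.
move=> IF; elim: s => [|i s IH].
  by under eq_Rintegral do rewrite big_nil; rewrite big_nil Rint0.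
under eq_Rintegral do rewrite big_cons.
by rewrite big_cons RintD ?IH//; exact: Ibl_sum.
Qed.

Lemma Rint_le f g : Ibl f -> Ibl g -> (forall x, f x <= g x) ->
  \int[mu]_x f x <= \int[mu]_x g x.
Proof. by move=> If Ig fg; apply: le_Rintegral. Qed.

Lemma Rint_ae f g : measurable_fun setT f -> measurable_fun setT g ->
  f = g %[ae mu] -> \int[mu]_x f x = \int[mu]_x g x.
Proof.
move=> mf mg fg; congr fine; apply: ae_eq_integral => //.
- exact/measurable_EFinP.
- exact/measurable_EFinP.
- by apply: filterS fg => x E _ /=; rewrite E.
Qed.

Lemma Ibl_ae f g : measurable_fun setT g -> f = g %[ae mu] -> Ibl f -> Ibl g.
Proof.
move=> mg fg If; have mf := Ibl_meas If; move/integrableP : If => [_ lf].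
apply/integrableP; split; first exact/measurable_EFinP.
suff <- : (\int[mu]_x `|(EFin \o f) x| = \int[mu]_x `|(EFin \o g) x|)%E by [].
apply: ae_eq_integral => //.
- by apply/measurable_EFinP => /=; exact: measurableT_comp.
- by apply/measurable_EFinP => /=; exact: measurableT_comp.
- by apply: filterS fg => x E _ /=; rewrite E.
Qed.

Lemma Rint_ext f : Ibl f -> (\int[mu]_x (f x)%:E = (\int[mu]_x f x)%:E)%E.
Proof. by move=> If; rewrite fineK//; exact: integrable_fin_num. Qed.

Lemma Rint_dct (f_ : nat -> T -> R) f g :
  (forall n, measurable_fun setT (f_ n)) -> measurable_fun setT f ->
  (forall x, f_ n x @[n --> \oo] --> f x) -> Ibl g ->
  (forall n x, `|f_ n x| <= g x) ->
  Ibl f /\ \int[mu]_x f_ n x @[n --> \oo] --> \int[mu]_x f x.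
Proof.
move=> mf_ mf f_f Ig fg.
have := @dominated_convergence _ _ _ mu setT measurableT
  (fun n => EFin \o f_ n) (EFin \o f) (EFin \o g) _ _ _ Ig _.
case.
- by move=> n; exact/measurable_EFinP.
- exact/measurable_EFinP.
- by apply: aeW => x _; apply: cvg_EFin; [exact: nearW|exact: f_f].
- by apply: aeW => x n _ /=; rewrite lee_fin.
move=> If _ cf; split => //; apply: fine_cvg; rewrite fineK//.
exact: (integrable_fin_num measurableT If).
Qed.

Lemma is_derive_eq_val (V W : normedModType R) (f : V -> W) x v a b :
  is_derive x v f a -> a = b -> is_derive x v f b.
Proof. by move=> + <-. Qed.

Lemma Rint_derive (f f' : R -> T -> R) (G : T -> R) (a : R) :
  (forall t, Ibl (f t)) ->
  (forall (t : R) x, is_derive t 1 (f^~ x) (f' t x)) ->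
  Ibl G -> (forall t x, `|f' t x| <= G x) ->
  is_derive a 1 (fun t => \int[mu]_x f t x) (\int[mu]_x f' a x).
Proof.
move=> If df IG fG.
have E t x : partial1of2 f t x = f' t x.
  by rewrite /partial1of2 derive1E; have dd := df t x; rewrite derive_val.
have Ia : `](a - 1), (a + 1)[%classic a by rewrite /= in_itv/=; lra.
have G0 x : 0 <= G x by exact: le_trans (normr_ge0 _) (fG a x).
have d1 (x : R) (y : T) : `](a - 1), (a + 1)[%classic x -> setT y -> derivable (f^~ y) x 1.
  by move=> _ _; have [] := df x y.
have d2 (x : R) (y : T) : `](a - 1), (a + 1)[%classic x -> setT y -> `|partial1of2 f x y| <= G y.
  by move=> _ _; rewrite E.
apply: DeriveDef.
  exact: (derivable_under_integral measurableT Ia (fun x _ => If x) d1 G0 IG d2).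
rewrite -derive1E.
rewrite (differentiation_under_integral measurableT Ia (fun x _ => If x) d1 G0 IG d2).
by apply: eq_Rintegral => x _; rewrite E.
Qed.

End Rint_tools.

Section Rint_finite.
Context d (T : measurableType d) (R : realType).
Variable mu : probability T R.
Implicit Types f g : T -> R.

Lemma Ibl_bounded (M : R) f : measurable_fun setT f ->
  (forall x, `|f x| <= M) -> Ibl mu f.
Proof.
move=> mf fM; apply: measurable_bounded_integrable => //.
  by rewrite /= probability_setT ltry.
exists M; split; first exact: num_real.
by move=> y My x _ /=; exact: le_trans (fM x) (ltW My).
Qed.

Lemma Ibl_cst (c : R) : Ibl mu (cst c).
Proof. by apply: (@Ibl_bounded `|c|). Qed.

Lemma Rint_cst (c : R) : \int[mu]_x c = c.
Proof. by rewrite Rintegral_cst//= probability_setT mulr1. Qed.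

Lemma Ibl_indic (A : set T) : measurable A -> Ibl mu (\1_A : T -> R).
Proof.
move=> mA; apply: (@Ibl_bounded 1); first exact: measurable_indic.
by move=> x; rewrite indicE; case: (_ \in _); rewrite ?normr1 ?normr0.
Qed.

Lemma Rint_indic (A : set T) : measurable A ->
  \int[mu]_x (\1_A x : R) = fine (mu A).
Proof. by move=> mA; rewrite /Rintegral integral_indic// setIT. Qed.

End Rint_finite.

(** * One-dimensional Gaussian laws *)

Section gaussian_line.
Variable R : realType.
Implicit Types (s x t b : R).
Local Notation lam := (@lebesgue_measure R).
Local Notation pdf s := (normal_pdf (0 : R) s).

(** By the fundamental theorem of calculus on [- n, n]. Applied to products with a
    Gaussian density, this is integration by parts on the whole line. *)
Lemma Rint_derivative0 (F f : R -> R) :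
  (forall x, is_derive x 1 F (f x)) -> continuous f -> Ibl lam f ->
  F n%:R @[n --> \oo] --> (0 : R) -> F (- n%:R) @[n --> \oo] --> (0 : R) ->
  \int[lam]_x f x = 0.
Proof.
move=> dF cf If Fp Fm.
have cF x : {for x, continuous F}.
  by apply/differentiable_continuous/derivable1_diffP; have [] := dF x.
pose D n := [set` `[- n%:R, n%:R : R]].
have mf := Ibl_meas If.
have [_ cv] : Ibl lam f /\
    \int[lam]_x (f x * \1_(D n) x) @[n --> \oo] --> \int[lam]_x f x.
  apply: (@Rint_dct _ _ _ lam _ f (fun x => `|f x|)) => //.
  - move=> n; apply: measurable_funM => //; apply: measurable_indic.
    exact: measurable_itv.
  - move=> x; apply/cvgrPdist_le => e e0; near=> n.
    rewrite indicE mem_set ?mulr1 ?subrr ?normr0 1?ltW//.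
    rewrite /D/= in_itv/= -ler_norml; near: n.
    exact: nbhs_infty_ger.
  - exact: integrable_norm If.
  - move=> n x; rewrite normrM ler_piMr// indicE; case: (_ \in _) => /=.
      by rewrite normr1.
    by rewrite normr0.
suff cv0 : \int[lam]_x (f x * \1_(D n) x) @[n --> \oo] --> (0 : R).
  exact: cvg_unique cv cv0.
have E n : F n.+1%:R - F (- n.+1%:R) = \int[lam]_x (f x * \1_(D n.+1) x).
  have lt0 : - n.+1%:R < n.+1%:R :> R by rewrite gtrN.
  have h := @continuous_FTC2 R f F (- n.+1%:R) n.+1%:R lt0.
  have {}h : (\int[lam]_(x in D n.+1) (f x)%:E
      = (F n.+1%:R)%:E - (F (- n.+1%:R))%:E)%E.
    apply: h.
    - exact: continuous_subspaceT.
    - split.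
      + by move=> x _; have [] := dF x.
      + exact/cvg_at_right_filter/cF.
      + exact/cvg_at_left_filter/cF.
    - by move=> x _; rewrite derive1E; exact: derive_val.
  transitivity (fine (\int[lam]_(x in D n.+1) (f x)%:E)); first by rewrite h.
  rewrite -/(Rintegral lam (D n.+1) f) Rintegral_mkcond.
  by apply: eq_Rintegral => x _; rewrite patchE indicE; case: ifP => _;
    rewrite ?mulr1 ?mulr0.
rewrite -(cvg_shiftS (fun n => \int[lam]_x (f x * \1_(D n) x))).
under eq_fun do rewrite -E.
suff : F n.+1%:R - F (- n.+1%:R) @[n --> \oo] --> 0 - (0 : R).
  by rewrite subr0.
apply: cvgB; first by rewrite (cvg_shiftS (fun n => F n%:R)).
by rewrite (cvg_shiftS (fun n => F (- n%:R))).
Unshelve. all: by end_near. Qed.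

Section pdf.
Variables (m s : R).
Hypothesis s0 : s != 0.
Local Notation p := (normal_pdf m s).

Lemma pdfE x : p x = normal_peak s * expR (- (s ^+ 2 *+ 2)^-1 * (x - m) ^+ 2).
Proof. by rewrite normal_pdfE// /normal_fun; congr (_ * expR _); rewrite !mulNr mulrC. Qed.

Lemma is_derive_pdf x : is_derive x 1 p (- (s ^+ 2)^-1 * ((x - m) * p x)).
Proof.
have -> : p = fun x => normal_peak s * expR (- (s ^+ 2 *+ 2)^-1 * (x - m) ^+ 2).
  by apply/funext => y; exact: pdfE.
apply: is_derive_eq_val.
rewrite -mulr_natr invfM.
rewrite /GRing.scale/=.
set e := expR _.
lra.
Qed.

Definition pdf8_cst : R := 2 * ((8 / 3) ^+ 4 * 24).

(** A Gaussian density absorbs the eighth power at the price of doubling the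
    standard deviation; all moment and tail bounds come from this. *)
Lemma pdf8 x : (x - m) ^+ 8 * p x <= pdf8_cst * s ^+ 8 * normal_pdf m (2 * s) x.
Proof.
have s20 : 2 * s != 0 by rewrite mulf_neq0.
rewrite pdfE (normal_pdfE _ s20) /normal_fun.
have -> : normal_peak (2 * s) = 2^-1 * normal_peak s.
  rewrite /normal_peak.
  have -> : (2 * s) ^+ 2 * pi *+ 2 = 2 ^+ 2 * (s ^+ 2 * pi *+ 2) by lra.
  by rewrite sqrtrM ?exprn_ge0// sqrtr_sqr ger0_norm// invfM.
pose y := (x - m) / s.
have -> : x - m = y * s by rewrite /y divfK.
clearbody y.
have -> : - (s ^+ 2 *+ 2)^-1 * (y * s) ^+ 2 = - (y ^+ 2 / 2).
  rewrite exprMn -mulr_natr invfM; move: (s ^+ 2) (expf_neq0 2 s0) => v v0.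
  transitivity (- (y ^+ 2 / 2 * (v * v^-1))); last by rewrite divff// mulr1.
  by lra.
have -> : - (y * s) ^+ 2 / ((2 * s) ^+ 2 *+ 2) = - (y ^+ 2 / 8).
  have -> : (2 * s) ^+ 2 *+ 2 = 8 * s ^+ 2 by lra.
  rewrite exprMn invfM; move: (s ^+ 2) (expf_neq0 2 s0) => v v0.
  transitivity (- (y ^+ 2 / 8 * (v * v^-1))); last by rewrite divff// mulr1.
  by lra.
have -> : - (y ^+ 2 / 2) = - (3 / 8 * y ^+ 2) + - (y ^+ 2 / 8) by lra.
rewrite expRD (expRN (3 / 8 * y ^+ 2)).
have e0 := expR_gt0 (3 / 8 * y ^+ 2).
have : (8 / 3 * (3 / 8 * y ^+ 2)) ^+ 4 <= (8 / 3) ^+ 4 * 24 * expR (3 / 8 * y ^+ 2).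
  have u0 : 0 <= 3 / 8 * y ^+ 2 by rewrite mulr_ge0// sqr_ge0.
  have := expR_ge1Dxn 3 u0.
  have -> : (3.+1)`!%:R = 24 :> R by [].
  set u := 3 / 8 * y ^+ 2; move: (expR u) => E; lra.
move: (expR (3 / 8 * _)) e0 => E E0 h.
have {}h : y ^+ 8 * E^-1 <= (8 / 3) ^+ 4 * 24.
  by rewrite ler_pdivrMr//; apply: le_trans h; rewrite le_eqVlt; apply/orP; left;
    apply/eqP; lra.
have k0 : 0 <= normal_peak s * expR (- (y ^+ 2 / 8)) * s ^+ 8.
  by apply: mulr_ge0; rewrite ?exprn_even_ge0// mulr_ge0 ?normal_peak_ge0 ?expR_ge0.
have := ler_wpM2r k0 h; rewrite /pdf8_cst.
move: (normal_peak s) (expR _) E^-1 => a b c; lra.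
Qed.

Lemma pow8_bound (y : R) : `|y| <= 1 + y ^+ 8 /\ y ^+ 2 <= 1 + y ^+ 8.
Proof.
have h0 (z : R) : 0 <= z -> z <= 1 + z ^+ 8 /\ z ^+ 2 <= 1 + z ^+ 8.
  move=> z0; have [z1|z1] := leP z 1.
    have h8 : 0 <= z ^+ 8 by rewrite exprn_ge0.
    have h2 : z ^+ 2 <= 1 by rewrite exprn_ile1.
    by split; lra.
  have z1' := ltW z1.
  have h1 : z <= z ^+ 8 by rewrite -{1}[z]expr1 ler_weXn2l.
  have h2 : z ^+ 2 <= z ^+ 8 by rewrite ler_weXn2l.
  by split; lra.
have [] := h0 `|y| (normr_ge0 y).
have -> : `|y| ^+ 8 = y ^+ 8 by rewrite -normrX ger0_norm// exprn_even_ge0.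
by rewrite real_normK ?num_real.
Qed.

Lemma Ibl_pdf : Ibl lam p. Proof. exact: integrable_normal_pdf. Qed.

Lemma Ibl_pdf8 : Ibl lam (fun x => (x - m) ^+ 8 * p x).
Proof.
apply: (@Ibl_le _ _ _ lam (fun x => pdf8_cst * s ^+ 8 * normal_pdf m (2 * s) x)).
- apply: measurable_funM; last exact: measurable_normal_pdf.
  by apply: measurable_funX; exact: measurable_funB.
- by apply: IblZ; exact: integrable_normal_pdf.
- move=> x; have h8 : 0 <= (x - m) ^+ 8 by rewrite exprn_even_ge0.
  have l0 : 0 <= (x - m) ^+ 8 * p x by rewrite mulr_ge0 ?normal_pdf_ge0.
  by rewrite ger0_norm// (ger0_norm (le_trans l0 (pdf8 x))) pdf8.
Qed.

Lemma Ibl_pdf_le (f : R -> R) : measurable_fun setT f ->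
  (forall x, `|f x| <= (1 + `|x - m| + (x - m) ^+ 2) * p x) -> Ibl lam f.
Proof.
move=> mf h; apply: (@Ibl_le _ _ _ lam (fun x => 3 * p x + 2 * ((x - m) ^+ 8 * p x)))=>//.
  by apply: IblD; apply: IblZ; [exact: Ibl_pdf|exact: Ibl_pdf8].
move=> x; have p0 := normal_pdf_ge0 m s x.
have [h1 h2] := pow8_bound (x - m).
have h8 : 0 <= (x - m) ^+ 8 by rewrite exprn_even_ge0.
have l0 : 0 <= 3 * p x + 2 * ((x - m) ^+ 8 * p x).
  by have := mulr_ge0 h8 p0; lra.
rewrite (ger0_norm l0).
apply: le_trans (h x) _; rewrite [leRHS](_ : _ = (3 + 2 * (x - m) ^+ 8) * p x).
  by apply: ler_wpM2r => //; lra.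
by lra.
Qed.

(** The bound on F and the eighth power absorbed by the density make |x - m| |F x|
    bounded, so F decays like 1 / |x|. *)
Lemma pdf_decay (F : R -> R) :
  (forall x, `|F x| <= (1 + `|x - m|) * p x) ->
  F n%:R @[n --> \oo] --> (0 : R) /\ F (- n%:R) @[n --> \oo] --> (0 : R).
Proof.
move=> hF.
have s20 : 2 * s != 0 by rewrite mulf_neq0.
pose M := 3 * normal_peak s + 2 * (pdf8_cst * s ^+ 8 * normal_peak (2 * s)).
have hM x : `|x - m| * `|F x| <= M.
  have p0 := normal_pdf_ge0 m s x.
  have p1 := normal_pdf_ub m x s0.
  have p2 := normal_pdf_ub m x s20.
  have [h1 h2] := pow8_bound (x - m).
  have h8 : 0 <= (x - m) ^+ 8 by rewrite exprn_even_ge0.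
  have y0 := normr_ge0 (x - m).
  apply: (@le_trans _ _ ((3 + 2 * (x - m) ^+ 8) * p x)).
    apply: le_trans (ler_wpM2l y0 (hF x)) _.
    rewrite mulrA; apply: ler_wpM2r => //.
    by have := real_normK (num_real (x - m)); lra.
  have hc : 0 <= pdf8_cst * s ^+ 8.
    by rewrite mulr_ge0 ?exprn_even_ge0// /pdf8_cst; lra.
  have h9 := le_trans (pdf8 x) (ler_wpM2l hc p2).
  by rewrite /M mulrDl; lra.
have main (u : nat -> R) : (\forall n \near \oo, n%:R <= 2 * `|u n - m|) ->
    F (u n) @[n --> \oo] --> (0 : R).
  move=> hu; apply: norm_cvg0.
  have M0 : 0 <= M by exact: le_trans (hM 0); rewrite mulr_ge0.
  apply: (@squeeze_cvgr _ _ _ _ (cst 0) (fun n => 2 * M * n%:R^-1)).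
  - near=> n; rewrite /= normr_ge0/=.
    have n0 : (0 < n)%N by near: n; exact: nbhs_infty_gt.
    have n0' : (0 : R) < n%:R by rewrite ltr0n.
    rewrite ler_pdivlMr//.
    have h1 : n%:R <= 2 * `|u n - m| by near: n.
    have h2 := hM (u n).
    have h3 := ler_wpM2l (normr_ge0 (F (u n))) h1.
    by lra.
  - exact: cvg_cst.
  - have : 2 * M * n%:R^-1 @[n --> \oo] --> 2 * M * 0.
      apply: cvgMr; apply/(gtr0_cvgV0 _).2; last exact: cvgr_idn.
      by near=> n; rewrite ltr0n; near: n; exact: nbhs_infty_gt.
    by rewrite mulr0.
split; apply: main; near=> n.
- have h : 2 * `|m| <= n%:R by near: n; exact: nbhs_infty_ger.
  have := ler_norm (n%:R - m); have := ler_norm m; have := normr_ge0 m; lra.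
- have h : 2 * `|m| <= n%:R by near: n; exact: nbhs_infty_ger.
  have := ler_norm (- (- n%:R - m)); have := ler_norm (- m); rewrite !normrN.
  have := normr_ge0 m; lra.
Unshelve. all: by end_near. Qed.

End pdf.

Lemma normal_mean m s : s != 0 ->
  Ibl lam (fun x => x * normal_pdf m s x) /\
  \int[lam]_x (x * normal_pdf m s x) = m.
Proof.
move=> s0; have p0 := normal_pdf_ge0 m s.
have I0 := Ibl_pdf m s.
have mp := @measurable_normal_pdf R m s.
have I1 : Ibl lam (fun x => (x - m) * normal_pdf m s x).
  apply: (Ibl_pdf_le (m := m) s0); first by apply: measurable_funM => //; exact: measurable_funB.
  move=> x; rewrite normrM (ger0_norm (p0 x)) ler_wpM2r//.
  by have := sqr_ge0 (x - m); lra.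
have cp : continuous (normal_pdf m s) by exact: continuous_normal_pdf.
have E0 : \int[lam]_x (- (s ^+ 2)^-1 * ((x - m) * normal_pdf m s x)) = 0.
  have hF x : `|normal_pdf m s x| <= (1 + `|x - m|) * normal_pdf m s x.
    rewrite (ger0_norm (p0 x)); have := mulr_ge0 (normr_ge0 (x - m)) (p0 x); lra.
  have [Fp Fm] := pdf_decay s0 hF.
  apply: (Rint_derivative0 (F := normal_pdf m s)) => //.
  - by move=> x; exact: is_derive_pdf.
  - move=> x; apply: cvgMr; apply: cvgM; last exact: cp.
    by apply: cvgB; [exact: cvg_id|exact: cvg_cst].
  - exact: IblZ.
have {}E0 : \int[lam]_x ((x - m) * normal_pdf m s x) = 0.
  move: E0; rewrite RintZ// => /eqP; rewrite mulf_eq0 oppr_eq0 invr_eq0.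
  by rewrite expf_eq0 (negbTE s0) andbF => /eqP.
have Ex x : x * normal_pdf m s x
    = (x - m) * normal_pdf m s x + m * normal_pdf m s x by lra.
split.
  by apply: Ibl_eq (IblD I1 (IblZ m I0)) => x; rewrite Ex.
under eq_Rintegral do rewrite Ex.
rewrite RintD//; last exact: IblZ.
by rewrite E0 add0r RintZ// /Rintegral integral_normal_pdf /= mulr1.
Qed.

Lemma normal_var s : s != 0 -> Ibl lam (fun x => x ^+ 2 * pdf s x) /\
  \int[lam]_x (x ^+ 2 * pdf s x) = s ^+ 2.
Proof.
move=> s0; have p0 := normal_pdf_ge0 0 s.
have I0 := Ibl_pdf 0 s.
have mp := @measurable_normal_pdf R 0 s.
have I2 : Ibl lam (fun x => x ^+ 2 * pdf s x).
  apply: (Ibl_pdf_le (m := 0) s0).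
    by apply: measurable_funM => //; exact: measurable_funX.
  move=> x; rewrite subr0 normrM (ger0_norm (p0 x)) ler_wpM2r//.
  by rewrite ger0_norm ?sqr_ge0//; have := normr_ge0 x; lra.
split => //.
have cp : continuous (pdf s) by exact: continuous_normal_pdf.
have E0 : \int[lam]_x (pdf s x - (s ^+ 2)^-1 * (x ^+ 2 * pdf s x)) = 0.
  have hF x : `|x * pdf s x| <= (1 + `|x - 0|) * pdf s x.
    by rewrite subr0 normrM (ger0_norm (p0 x)) ler_wpM2r//; lra.
  have [Fp Fm] := pdf_decay s0 hF.
  apply: (Rint_derivative0 (F := fun x => x * pdf s x)); [| | |exact: Fp|exact: Fm].
  - move=> x; have dp := is_derive_pdf 0 s0 x.
    apply: is_derive_eq_val; rewrite /GRing.scale/= subr0; lra.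
  - move=> x; apply: cvgB; first exact: cp.
    apply: cvgMr; apply: cvgM; last exact: cp.
    exact: exprn_continuous.
  - by apply: IblB => //; exact: IblZ.
move: E0; rewrite RintB//; last exact: IblZ.
rewrite RintZ// /Rintegral integral_normal_pdf => /eqP; rewrite subr_eq0 => /eqP /= E.
by rewrite -[LHS](mulVKf (expf_neq0 2 s0)) -E mulr1.
Qed.

(** The Radon-Nikodym derivative of the law is its density, because both have the
    same integral over every measurable set. *)
Lemma normal_prob_int m s (f : R -> R) : measurable_fun setT f ->
  Ibl lam (fun x => f x * normal_pdf m s x) ->
  Ibl (normal_prob m s) f /\
  \int[normal_prob m s]_x f x = \int[lam]_x (f x * normal_pdf m s x).
Proof.
move=> mf If; have dom := @normal_prob_dominates R m s.
have mp := @measurable_normal_pdf R m s.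
have p0 := normal_pdf_ge0 m s.
have ae1 : ae_eq lam setT (Radon_Nikodym_SigmaFinite.f (normal_prob m s) lam)
    (fun x => (normal_pdf m s x)%:E).
  apply: integral_ae_eq => //.
  - exact: Radon_Nikodym_SigmaFinite.f_integrable.
  - exact/measurable_EFinP.
  - by move=> E _ mE; rewrite -Radon_Nikodym_SigmaFinite.f_integral.
have I : Ibl (normal_prob m s) f.
  apply/integrableP; split; first exact/measurable_EFinP.
  rewrite -(@Radon_Nikodym_SigmaFinite.change_of_variables _ _ _ (normal_prob m s) lam
    dom (fun x => `|(f x)%:E|%E))//; last first.
    by apply: measurableT_comp => //; exact/measurable_EFinP.
  move/integrableP : If => [_]; apply: le_lt_trans.
  rewrite le_eqVlt; apply/orP; left; apply/eqP.
  apply: ae_eq_integral => //.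
  - apply: emeasurable_funM.
      by apply: measurableT_comp => //; exact/measurable_EFinP.
    exact: (measurable_int lam (Radon_Nikodym_SigmaFinite.f_integrable dom)).
  - apply/measurable_EFinP; apply: measurableT_comp => //.
    exact: measurable_funM.
  - apply: filterS ae1 => x E _; rewrite E//=.
    by rewrite -EFinM normrM (ger0_norm (p0 x)).
split => //.
rewrite /Rintegral; congr fine.
rewrite -(@Radon_Nikodym_change_of_variables _ _ _ (normal_prob m s) lam dom)//.
apply: ae_eq_integral => //.
- apply: emeasurable_funM; first exact/measurable_EFinP.
  apply: (measurable_int lam); apply: Radon_Nikodym_integrable; exact: dom.
- by apply/measurable_EFinP; exact: measurable_funM.
- apply: filterS2 ae1 (ae_eq_Radon_Nikodym_SigmaFinite dom measurableT).
  by move=> x E1 E2 _; rewrite -E2// E1.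
Qed.

Lemma normal_moment8 s : s != 0 -> Ibl lam (fun x => x ^+ 8 * pdf s x) /\
  \int[lam]_x (x ^+ 8 * pdf s x) <= pdf8_cst * s ^+ 8.
Proof.
move=> s0.
have I8 : Ibl lam (fun x => x ^+ 8 * pdf s x).
  by apply: Ibl_eq (Ibl_pdf8 0 s0) => x; rewrite subr0.
split => //.
have -> : pdf8_cst * s ^+ 8
    = \int[lam]_x (pdf8_cst * s ^+ 8 * pdf (2 * s) x).
  rewrite RintZ; last exact: integrable_normal_pdf.
  by rewrite /Rintegral integral_normal_pdf /= mulr1.
apply: Rint_le => //; first by apply: IblZ; exact: integrable_normal_pdf.
by move=> x; have := pdf8 0 s0 x; rewrite subr0.
Qed.

Section char_fun.
Variables (s b : R).
Hypothesis s0 : s != 0.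
Let p := pdf s.
Let p0 x : 0 <= p x := normal_pdf_ge0 0 s x.
Let mp : measurable_fun setT p := @measurable_normal_pdf R 0 s.
Let cp : continuous p := @continuous_normal_pdf R 0 s s0.
Let A t := \int[lam]_x (cos (t * x + b) * p x).

Let msin t : measurable_fun setT (fun x : R => sin (t * x + b)).
Proof.
apply: continuous_measurable_fun => x.
apply: (cvg_comp (fun x => t * x + b) sin); last exact: continuous_sin.
by apply: cvgD; [apply: cvgMr; exact: cvg_id|exact: cvg_cst].
Qed.

Let mcos t : measurable_fun setT (fun x : R => cos (t * x + b)).
Proof.
apply: continuous_measurable_fun => x.
apply: (cvg_comp (fun x => t * x + b) cos); last exact: continuous_cos.
by apply: cvgD; [apply: cvgMr; exact: cvg_id|exact: cvg_cst].
Qed.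

Let le_sin (y : R) : `|sin y| <= 1.
Proof. by rewrite ler_norml sin_geN1 sin_le1. Qed.

Let le_cos (y : R) : `|cos y| <= 1.
Proof. by rewrite ler_norml cos_geN1 cos_le1. Qed.

Let Icos t : Ibl lam (fun x => cos (t * x + b) * p x).
Proof.
apply: (Ibl_le _ (Ibl_pdf 0 s)); first exact: (measurable_funM (mcos t) mp).
by move=> x; rewrite normrM ler_piMl.
Qed.

Let Ixsin t : Ibl lam (fun x => x * (sin (t * x + b) * p x)).
Proof.
apply: (@Ibl_pdf_le 0 s s0).
  exact: (measurable_funM (@measurable_id _ _ _) (measurable_funM (msin t) mp)).
move=> x; rewrite subr0 mulrA normrM (ger0_norm (p0 x)) ler_wpM2r//.
rewrite normrM; have := sqr_ge0 x; have := ler_wpM2l (normr_ge0 x) (le_sin (t * x + b)); lra.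
Qed.

(** The integral of the derivative of sin(t x + b) p(x), p being the density,
    vanishes. *)
Let stein t : \int[lam]_x (x * (sin (t * x + b) * p x)) = s ^+ 2 * (t * A t).
Proof.
have E0 : \int[lam]_x (t * (cos (t * x + b) * p x)
    - (s ^+ 2)^-1 * (x * (sin (t * x + b) * p x))) = 0.
  have hF x : `|sin (t * x + b) * p x| <= (1 + `|x - 0|) * p x.
    rewrite normrM (ger0_norm (p0 x)) ler_wpM2r//.
    by have := le_sin (t * x + b); have := normr_ge0 (x - 0); lra.
  have [Fp Fm] := pdf_decay s0 hF.
  apply: (Rint_derivative0 (F := fun x => sin (t * x + b) * p x)); [| | |exact: Fp|exact: Fm].
  - move=> x; have dp := is_derive_pdf 0 s0 x.
    apply: is_derive_eq_val.
    rewrite /GRing.scale/= /p subr0; lra.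
  - move=> x; apply: cvgB.
      apply: cvgMr; apply: cvgM; last exact: cp.
      apply: (cvg_comp (fun x => t * x + b) cos); last exact: continuous_cos.
      by apply: cvgD; [apply: cvgMr; exact: cvg_id|exact: cvg_cst].
    apply: cvgMr; apply: cvgM; first exact: cvg_id.
    apply: cvgM; last exact: cp.
    apply: (cvg_comp (fun x => t * x + b) sin); last exact: continuous_sin.
    by apply: cvgD; [apply: cvgMr; exact: cvg_id|exact: cvg_cst].
  - by apply: IblB; apply: IblZ; [exact: Icos|exact: Ixsin].
move: E0; rewrite RintB; [|by apply: IblZ; exact: Icos|by apply: IblZ; exact: Ixsin].
rewrite !RintZ//.
rewrite -/(A t) => /eqP; rewrite subr_eq0 => /eqP ->.
by rewrite mulVKf// expf_neq0.
Qed.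

Let dA t : is_derive t 1 A (- (s ^+ 2) * t * A t).
Proof.
have -> : - (s ^+ 2) * t * A t = \int[lam]_x (- (x * (sin (t * x + b) * p x))).
  by rewrite RintN ?stein; [lra|exact: Ixsin].
apply: (@Rint_derive _ _ _ lam (fun t x => cos (t * x + b) * p x)
  (fun t x => - (x * (sin (t * x + b) * p x))) (fun x => `|x| * p x)).
- exact: Icos.
- move=> u x; apply: is_derive_eq_val.
  by rewrite /GRing.scale/=; lra.
- apply: (@Ibl_pdf_le 0 s s0); first by apply: measurable_funM => //; exact: measurableT_comp.
  move=> x; rewrite subr0 normrM normr_id (ger0_norm (p0 x)) ler_wpM2r//.
  by have := sqr_ge0 x; lra.
- move=> u x; rewrite normrN normrM normrM (ger0_norm (p0 x)).
  by rewrite ler_wpM2l// ler_piMl.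
Qed.

(** The characteristic function A satisfies A'(t) = - s^2 t A(t), so that its
    product with exp(s^2 t^2 / 2) is constant. *)
Lemma normal_char t :
  \int[lam]_x (cos (t * x + b) * p x) = cos b * expR (- (s ^+ 2 * t ^+ 2 / 2)).
Proof.
rewrite -/(A t).
pose B u := A u * expR (s ^+ 2 / 2 * u ^+ 2).
have BE : B t = B 0.
  apply: is_derive_0_is_cst => u; have dAu := dA u.
  apply: is_derive_eq_val.
  by rewrite /GRing.scale/=; lra.
have A0 : A 0 = cos b.
  rewrite /A; under eq_Rintegral do rewrite mul0r add0r.
  rewrite RintZ; last exact: integrable_normal_pdf.
  by rewrite /Rintegral integral_normal_pdf /= mulr1.
move: BE; rewrite /B A0 expr0n mulr0 expR0 mulr1 => <-.
have -> : s ^+ 2 * t ^+ 2 / 2 = s ^+ 2 / 2 * t ^+ 2 by lra.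
by rewrite expRN mulfK// gt_eqF// expR_gt0.
Qed.

End char_fun.

End gaussian_line.

(** * The Hilbert space of square-integrable functions *)

Section L2_theory.
Context d (T : measurableType d) (R : realType).
Variable mu : {measure set T -> \bar R}.
Local Notation H := (L2 mu).
Local Notation "<< x , y >>" := (L2_dot x y).
Implicit Types (x y z l : H) (f g : T -> R).

Lemma L2_meas x : measurable_fun setT (x : T -> R).
Proof. exact: (measurable_funPT (L2_lfun x)). Qed.

Lemma Ibl_Lfun2M f g : f \in Lfun mu 2%:E -> g \in Lfun mu 2%:E ->
  Ibl mu (fun t => f t * g t).
Proof. by move=> Lf Lg; apply/Lfun1_integrable/Lfun2_mul_Lfun1. Qed.

Lemma Ibl_L2M x y : Ibl mu (fun t => x t * y t).
Proof. exact: Ibl_Lfun2M (L2_funP x) (L2_funP y). Qed.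

Lemma L2_dotC x y : <<x, y>> = <<y, x>>.
Proof. by apply: eq_Rintegral => t _; rewrite mulrC. Qed.

Lemma L2_dot_ae x f y : measurable_fun setT f -> (x : T -> R) = f %[ae mu] ->
  <<x, y>> = \int[mu]_t (f t * y t).
Proof.
move=> mf xf; apply: Rint_ae.
- by apply: measurable_funM; exact: L2_meas.
- by apply: measurable_funM => //; exact: L2_meas.
- by apply: filterS xf => t E _; rewrite E.
Qed.

Lemma L2_dotDl x y z : <<x + y, z>> = <<x, z>> + <<y, z>>.
Proof.
rewrite (L2_dot_ae _ _ (L2_addE x y)).
  by rewrite -RintD; [apply: eq_Rintegral => t _; rewrite mulrDl
    |exact: Ibl_L2M|exact: Ibl_L2M].
by apply: measurable_funD; exact: L2_meas.
Qed.

Lemma L2_dotZl a x z : <<a *: x, z>> = a * <<x, z>>.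
Proof.
rewrite (L2_dot_ae _ _ (L2_scaleE a x)).
  by rewrite -RintZ; [apply: eq_Rintegral => t _; rewrite mulrA|exact: Ibl_L2M].
by apply: measurable_funM => //; exact: L2_meas.
Qed.

Lemma L2_dotDr x y z : <<z, x + y>> = <<z, x>> + <<z, y>>.
Proof. by rewrite L2_dotC L2_dotDl !(L2_dotC z). Qed.

Lemma L2_dotZr a x z : <<z, a *: x>> = a * <<z, x>>.
Proof. by rewrite L2_dotC L2_dotZl (L2_dotC z). Qed.

Lemma L2_dot0l x : <<0, x>> = 0.
Proof. by rewrite -(scale0r 0) L2_dotZl mul0r. Qed.

Lemma L2_dot0r x : <<x, 0>> = 0.
Proof. by rewrite L2_dotC L2_dot0l. Qed.

Lemma L2_dotNl x z : <<- x, z>> = - <<x, z>>.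
Proof. by rewrite -scaleN1r L2_dotZl mulN1r. Qed.

Lemma L2_dotNr x z : <<z, - x>> = - <<z, x>>.
Proof. by rewrite L2_dotC L2_dotNl (L2_dotC z). Qed.

Lemma L2_dotBl x y z : <<x - y, z>> = <<x, z>> - <<y, z>>.
Proof. by rewrite L2_dotDl L2_dotNl. Qed.

Lemma L2_dotBr x y z : <<z, x - y>> = <<z, x>> - <<z, y>>.
Proof. by rewrite L2_dotDr L2_dotNr. Qed.

Lemma L2_dot_suml (I : Type) (s : seq I) (F : I -> H) z :
  <<\sum_(i <- s) F i, z>> = \sum_(i <- s) <<F i, z>>.
Proof.
elim: s => [|i s IH]; first by rewrite !big_nil L2_dot0l.
by rewrite !big_cons L2_dotDl IH.
Qed.

Lemma L2_dot_ge0 x : 0 <= <<x, x>>.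
Proof. by apply: Rintegral_ge0 => t _; rewrite -expr2 sqr_ge0. Qed.

Lemma L2_normE x : `|x| ^+ 2 = <<x, x>>.
Proof.
have n0 : (0 <= 'N[mu]_2%:E[EFin \o x])%E by exact: Lnorm_ge0.
have nf : 'N[mu]_2%:E[EFin \o x]%E \is a fin_num.
  by rewrite ge0_fin_numE//; exact: (L2_fun_finite x).
have -> : `|x| = fine ('N[mu]_2%:E[EFin \o x])%E by [].
have h : (2 : R) != 0 by [].
have := powR_Lnorm mu (EFin \o x) h.
rewrite -{1}(fineK nf) poweR_EFin powR_mulrn ?fine_ge0// => E.
transitivity (fine ((fine 'N[mu]_2%:E[EFin \o x]) ^+ 2)%:E)%E => //.
rewrite E; congr fine; apply: eq_integral => t _ /=.
by rewrite powR_mulrn// -normrX ger0_norm ?sqr_ge0// expr2.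
Qed.

Lemma L2_cauchy_schwarz x y : `|<<x, y>>| <= `|x| * `|y|.
Proof.
have h0 (t : R) : 0 <= `|x| ^+ 2 - 2 * t * <<x, y>> + t ^+ 2 * `|y| ^+ 2.
  have := L2_dot_ge0 (x - t *: y).
  rewrite L2_dotBl !L2_dotBr !L2_dotZl !L2_dotZr -!L2_normE (L2_dotC y x); lra.
have [y0|y0] := eqVneq `|y| 0.
  have -> : y = 0 by apply/eqP; rewrite -normr_eq0 y0.
  by rewrite L2_dot0r normr0 mulr_ge0.
rewrite -[leRHS]ger0_norm ?mulr_ge0// -ler_sqr ?nnegrE// !real_normK ?num_real// exprMn.
have y2 : 0 < `|y| ^+ 2 by rewrite exprn_even_gt0.
have := h0 (<<x, y>> / `|y| ^+ 2).
move: (<<x, y>>) => c h.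
have := ler_wpM2r (ltW y2) h; rewrite mul0r.
set Y := `|y| ^+ 2 in y2 *; set X := `|x| ^+ 2.
have Y1 : Y * Y^-1 = 1 by rewrite divff// gt_eqF.
have -> : (X - 2 * (c / Y) * c + (c / Y) ^+ 2 * Y) * Y
  = X * Y - 2 * c ^+ 2 * (Y * Y^-1) + c ^+ 2 * (Y * Y^-1) ^+ 2 by lra.
by rewrite Y1; lra.
Qed.

Lemma L2_dot_inj x y : (forall z, <<x, z>> = <<y, z>>) -> x = y.
Proof.
move=> h; apply/eqP; rewrite -subr_eq0 -normr_eq0 -sqrf_eq0 L2_normE.
by rewrite L2_dotBl h subrr.
Qed.

Section dot_linear.
Variable l : H.
Let dl : H -> R := L2_dot l.
Let dl_lin : linear dl.
Proof. by move=> a x y; rewrite /dl L2_dotDr L2_dotZr. Qed.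
HB.instance Definition _ := @GRing.isLinear.Build R H R _ dl dl_lin.

Let dl_cont : continuous dl.
Proof.
apply: (@bounded_linear_continuous R H R dl).
apply/linear_boundedP; exists (`|l| + 1); split; first exact: num_real.
move=> r lr x; apply: le_trans (L2_cauchy_schwarz l x) _.
by apply: ler_wpM2r => //; apply: ltW; apply: lt_trans lr; rewrite ltrDl.
Qed.

Lemma continuous_L2_dot : continuous (L2_dot l).
Proof. exact: dl_cont. Qed.

Lemma is_diff_L2_dot z : is_diff z (L2_dot l) (L2_dot l).
Proof.
apply: DiffDef; first exact: (linear_differentiable z dl_cont).
by rewrite (diff_lin z dl_cont).
Qed.

End dot_linear.

(** The sigma-algebra on H is generated by the open sets. *)
Lemma continuous_L2_meas (f : H -> R) : continuous f -> measurable_fun setT f.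
Proof.
move=> cf; apply: (measurability _ (RGenOInfty.measurableE R)).
move=> /= _ [_ [a ->] <-]; rewrite setTI; apply: sub_sigma_algebra => /=.
by move/continuousP : cf; apply; exact: interval_open.
Qed.

Lemma measurable_L2_dot l : measurable_fun setT (L2_dot l).
Proof. by apply: continuous_L2_meas => z; exact: continuous_L2_dot. Qed.

Lemma measurable_L2_dotr l : measurable_fun setT (fun z => <<z, l>>).
Proof.
rewrite (_ : (fun z => _) = L2_dot l); first exact: measurable_L2_dot.
by apply/funext => z; exact: L2_dotC.
Qed.

(** The class of a square-integrable function, extended by 0. *)
Definition mkL2 f : H :=
  if pselect (f \in Lfun mu 2%:E) is left Lf then L2_mk (Lfun_Sub (lee1n 2) Lf)
  else 0.

Lemma mkL2E f : f \in Lfun mu 2%:E -> mkL2 f = f %[ae mu].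
Proof.
rewrite /mkL2; case: pselect => // Lf _.
by apply: filterS (L2_mkE (Lfun_Sub (lee1n 2) Lf)) => t E _; rewrite E.
Qed.

Lemma Lfun2_meas f : f \in Lfun mu 2%:E -> measurable_fun setT f.
Proof. by move=> /andP[]; rewrite inE. Qed.

Lemma Rint_mkL2M f g : f \in Lfun mu 2%:E -> measurable_fun setT g ->
  \int[mu]_t (g t * mkL2 f t) = \int[mu]_t (g t * f t).
Proof.
move=> Lf mg; apply: Rint_ae.
- by apply: measurable_funM => //; exact: L2_meas.
- by apply: measurable_funM => //; exact: Lfun2_meas.
- by apply: filterS (mkL2E Lf) => t E _; rewrite E.
Qed.

Lemma dot_mkL2 f x : f \in Lfun mu 2%:E -> <<mkL2 f, x>> = \int[mu]_t (f t * x t).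
Proof. by move=> Lf; apply: L2_dot_ae; [exact: Lfun2_meas|exact: mkL2E]. Qed.

Lemma dot_mkL2_2 f g : f \in Lfun mu 2%:E -> g \in Lfun mu 2%:E ->
  <<mkL2 f, mkL2 g>> = \int[mu]_t (f t * g t).
Proof.
move=> Lf Lg; rewrite dot_mkL2//; apply: Rint_ae.
- by apply: measurable_funM; [exact: Lfun2_meas|exact: L2_meas].
- by apply: measurable_funM; exact: Lfun2_meas.
- by apply: filterS (mkL2E Lg) => t E _; rewrite E.
Qed.

Lemma Lfun2_sqr f : measurable_fun setT f -> Ibl mu (fun t => f t ^+ 2) ->
  f \in Lfun mu 2%:E.
Proof.
move=> mf /integrableP[_ lf]; apply/andP; split; rewrite inE//=.
rewrite /finite_norm unlock /Lnorm poweR_lty//.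
apply: le_lt_trans lf; rewrite le_eqVlt; apply/orP; left; apply/eqP.
by apply: eq_integral => t _ /=; rewrite powR_mulrn// normrX.
Qed.

Lemma Lfun2_bounded (M : R) f : (mu setT < +oo)%E -> measurable_fun setT f ->
  (forall t, `|f t| <= M) -> f \in Lfun mu 2%:E.
Proof.
move=> mufin mf fM; apply: Lfun2_sqr => //.
apply: measurable_bounded_integrable => //; first exact: measurable_funX.
exists (M ^+ 2); split; first exact: num_real.
move=> y My t _ /=; rewrite normrX (le_trans _ (ltW My))//.
by rewrite lerXn2r// nnegrE// (le_trans _ (fM t)).
Qed.

End L2_theory.

(** * Gaussian measures: laws of linear functionals and integration by parts *)

Section gaussian_law.
Variables (R : realType) (mu : probability (L2 (leb01 R)) R).
Hypothesis gm : gaussian_measure mu 0 (@covQ R).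
Local Notation H := (L2 (leb01 R)).
Local Notation lam := (@lebesgue_measure R).
Local Notation "<< x , y >>" := (L2_dot x y).
Implicit Types (l k m z : H).

(** The variance of z |-> <z, l>. *)
Definition Qvar l : R := <<covQ l, l>>.

Let X l (z : H) : measurableTypeR R := <<z, l>>.

Let mX l : measurable_fun setT (X l). Proof. exact: measurable_L2_dotr. Qed.

Let law_transfer l (nu : probability (measurableTypeR R) R) (f : R -> R) :
  (forall B, measurable B -> mu (X l @^-1` B) = nu B) ->
  measurable_fun setT f -> Ibl nu f ->
  Ibl mu (fun z => f <<z, l>>) /\ \int[mu]_z f <<z, l>> = \int[nu]_x f x.
Proof.
move=> E mf If.
have mf' : measurable_fun setT (EFin \o f) by exact/measurable_EFinP.
have EE B : measurable B -> B `<=` setT -> pushforward mu (X l) B = nu B.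
  by move=> mB _; rewrite -E.
have I : Ibl mu (fun z => f <<z, l>>).
  apply/integrableP; split.
    apply/measurable_EFinP; exact: (measurableT_comp mf (mX l)).
  move/integrableP : If => [_]; apply: le_lt_trans.
  rewrite -(eq_measure_integral _ EE) ge0_integral_pushforward ?preimage_setT//.
  by apply: measurableT_comp.
split => //.
rewrite /Rintegral; congr fine.
rewrite -(eq_measure_integral _ EE) (integral_pushforward (mX l))//.
Qed.

Let law_dirac l a (f : R -> R) :
  (forall B, measurable B -> mu (X l @^-1` B) = \d_a B) ->
  measurable_fun setT f ->
  Ibl mu (fun z => f <<z, l>>) /\ \int[mu]_z f <<z, l>> = f a.
Proof.
move=> E mf.
have Id (g : R -> \bar R) : measurable_fun setT g ->
    (\int[\d_a]_(x in setT) g x = g a :> \bar R)%E.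
  by move=> mg; rewrite integral_dirac// diracT mul1e.
have If : Ibl (\d_a : probability (measurableTypeR R) R) f.
  apply/integrableP; split; first exact/measurable_EFinP.
  by rewrite Id ?ltry//; apply: measurableT_comp => //; exact/measurable_EFinP.
have [I ->] := law_transfer E mf If; split => //.
by rewrite /Rintegral Id//; exact/measurable_EFinP.
Qed.

Let law_normal l a s (f : R -> R) :
  (forall B, measurable B -> mu (X l @^-1` B) = normal_prob a s B) ->
  measurable_fun setT f -> Ibl lam (fun x => f x * normal_pdf a s x) ->
  Ibl mu (fun z => f <<z, l>>) /\
  \int[mu]_z f <<z, l>> = \int[lam]_x (f x * normal_pdf a s x).
Proof.
move=> E mf If; have [Ip Ep] := normal_prob_int mf If.
by have [I ->] := law_transfer E mf Ip.
Qed.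

Let meanX l : \int[mu]_z <<z, l>> = 0.
Proof. by case: gm => _ -> _; rewrite L2_dot0l. Qed.

Lemma cov_gauss l k : \int[mu]_z (<<z, l>> * <<z, k>>) = <<covQ l, k>>.
Proof.
by case: gm => _ _ <-; apply: eq_Rintegral => z _; rewrite subr0.
Qed.

(** The mean of the law of <z, l>, which the definition of a Gaussian measure leaves
    free, is 0 because the measure is centred. *)
Let law0 l : exists s, forall B : set R, measurable B ->
  mu (X l @^-1` B) = gauss_law 0 s B.
Proof.
have [law _ _] := gm; have [a [s E]] := law l; exists s.
suff -> : 0 = a by [].
rewrite -(meanX l); move: E; rewrite /gauss_law.
have [s0|s0] := eqVneq s 0 => E.
  by have [_ ->] := law_dirac E (@measurable_id _ _ setT).
have [Ip Em] := normal_mean a s0.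
by have [_ ->] := law_normal E (@measurable_id _ _ setT) Ip.
Qed.

Lemma integrable_sqr_gauss l : Ibl mu (fun z => <<z, l>> ^+ 2).
Proof.
have [s E] := law0 l; move: E; rewrite /gauss_law.
have mf : measurable_fun setT (fun x : R => x ^+ 2) by exact: measurable_funX.
have [s0|s0] := eqVneq s 0 => E.
  by have [] := law_dirac E mf.
have [Ip Em] := normal_var s0.
by have [] := law_normal E mf Ip.
Qed.

(** One interface for the degenerate functionals, which vanish almost surely, and
    for those that have a normal density. *)
Lemma gauss_lawP l : exists s, Qvar l = s ^+ 2 /\
  forall f : R -> R, measurable_fun setT f ->
  (s != 0 -> Ibl lam (fun x => f x * normal_pdf 0 s x)) ->
  Ibl mu (fun z => f <<z, l>>) /\
  \int[mu]_z f <<z, l>> = if s == 0 then f 0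
    else \int[lam]_x (f x * normal_pdf 0 s x).
Proof.
have [s E] := law0 l; exists s.
have mf : measurable_fun setT (fun x : R => x ^+ 2) by exact: measurable_funX.
move: E; rewrite /gauss_law; have [s0|s0] := eqVneq s 0 => E; split.
- have [_] := law_dirac E mf; rewrite s0 /Qvar -cov_gauss => <-.
  by apply: eq_Rintegral => z _; rewrite expr2.
- by move=> f mf' _; exact: law_dirac.
- have [Ip Em] := normal_var s0.
  have [_] := law_normal E mf Ip; rewrite Em /Qvar -cov_gauss => <-.
  by apply: eq_Rintegral => z _; rewrite expr2.
- by move=> f mf' If; apply: law_normal => //; exact: If.
Qed.

Lemma Qvar_ge0 l : 0 <= Qvar l.
Proof. by have [s [-> _]] := gauss_lawP l; exact: sqr_ge0. Qed.

Lemma integrable_gaussM l k : Ibl mu (fun z => <<z, l>> * <<z, k>>).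
Proof.
apply: (@Ibl_le _ _ _ mu (fun z => <<z, l>> ^+ 2 + <<z, k>> ^+ 2)).
- by apply: measurable_funM; exact: measurable_L2_dotr.
- by apply: IblD; exact: integrable_sqr_gauss.
- move=> z; rewrite [leRHS]ger0_norm ?addr_ge0 ?sqr_ge0// ler_norml.
  move: (<<z, l>>) (<<z, k>>) => a b.
  by have := sqr_ge0 (a + b); have := sqr_ge0 (a - b);
     have := sqr_ge0 a; have := sqr_ge0 b => *; apply/andP; split; lra.
Qed.

Lemma integrable_gauss l : Ibl mu (fun z => <<z, l>>).
Proof.
apply: (@Ibl_le _ _ _ mu (fun z => 1 + <<z, l>> ^+ 2)).
- exact: measurable_L2_dotr.
- by apply: IblD; [exact: Ibl_cst|exact: integrable_sqr_gauss].
- move=> z; rewrite [leRHS]ger0_norm ?addr_ge0 ?sqr_ge0// ler_norml.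
  move: (<<z, l>>) => a.
  by have := sqr_ge0 (a - 1); have := sqr_ge0 (a + 1); have := sqr_ge0 a => *;
     apply/andP; split; lra.
Qed.

Lemma mean_gauss l : \int[mu]_z <<z, l>> = 0. Proof. exact: meanX. Qed.

Lemma Qvar_line l k t :
  Qvar (l + t *: k) = Qvar l + 2 * t * <<covQ k, l>> + t ^+ 2 * Qvar k.
Proof.
have I1 := integrable_gaussM l l; have I2 := integrable_gaussM k l.
have I3 := integrable_gaussM k k.
have E z : <<z, l + t *: k>> * <<z, l + t *: k>> = <<z, l>> * <<z, l>>
    + (2 * t * (<<z, k>> * <<z, l>>) + t ^+ 2 * (<<z, k>> * <<z, k>>)).
  rewrite (L2_dotDr l (t *: k) z) (L2_dotZr t k z).
  by move: (L2_dot z l) (L2_dot z k) => a b; lra.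
rewrite /Qvar -!cov_gauss; under eq_Rintegral do rewrite E.
have J2 := IblZ (2 * t) I2; have J3 := IblZ (t ^+ 2) I3.
by rewrite (RintD I1 (IblD J2 J3)) (RintD J2 J3) (RintZ _ I2) (RintZ _ I3) addrA.
Qed.

Lemma char_gauss l b : \int[mu]_z cos (<<z, l>> + b) = cos b * expR (- (Qvar l / 2)).
Proof.
have [s [-> P]] := gauss_lawP l.
have mc : measurable_fun setT (fun x : R => cos (1 * x + b)).
  apply: measurableT_comp; first exact: continuous_measurable_fun (@continuous_cos _).
  by apply: measurable_funD => //; exact: measurable_funM.
have [] := P _ mc.
  move=> s0; apply: (Ibl_le _ (Ibl_pdf 0 s)).
    exact: (measurable_funM mc (@measurable_normal_pdf R 0 s)).
  by move=> x; rewrite normrM ler_piMl// ler_norml cos_geN1 cos_le1.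
move=> _; under eq_Rintegral do rewrite mul1r.
move=> ->; have [->|s0] := eqVneq s 0.
  by rewrite expr0n/= mul0r oppr0 expR0 mulr0 add0r mulr1.
by rewrite normal_char// expr1n mulr1.
Qed.

Lemma moment8_gauss l : Ibl mu (fun z => <<z, l>> ^+ 8) /\
  \int[mu]_z <<z, l>> ^+ 8 <= pdf8_cst R * Qvar l ^+ 4.
Proof.
have [s [-> P]] := gauss_lawP l.
have mf : measurable_fun setT (fun x : R => x ^+ 8) by exact: measurable_funX.
have [|I ->] := P _ mf; first by move=> s0; have [] := normal_moment8 s0.
split => //; rewrite -exprM; have [->|s0] := eqVneq s 0.
  by rewrite !expr0n/= mulr0.
by have [] := normal_moment8 s0.
Qed.

(** Markov's inequality at order 8. The chaining argument sums 2^n tails at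
    thresholds of order q^n with variances of order 2^-n, and needs the exponent 4
    of the variance both to beat 2^n and to leave a factor len^4 for the sum over
    blocks. *)
Lemma tail_gauss l x : 0 < x ->
  fine (mu [set z | x < `|<<z, l>>|]) <= pdf8_cst R * Qvar l ^+ 4 / x ^+ 8.
Proof.
move=> x0; have [I8 h8] := moment8_gauss l.
set A := [set z | _].
have mA : measurable A.
  have mn : measurable_fun setT (fun z => `|<<z, l>>|).
    by apply: measurableT_comp => //; exact: measurable_L2_dotr.
  have := mn measurableT _ (measurable_itv `]x, +oo[%R); rewrite setTI.
  by congr (measurable _); apply/seteqP; split => z /=; rewrite in_itv/= andbT.
have x8 : 0 < x ^+ 8 by rewrite exprn_gt0.
rewrite ler_pdivlMr//; apply: le_trans h8.
have <- : \int[mu]_z (\1_A z * x ^+ 8) = fine (mu A) * x ^+ 8.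
  by rewrite RintegralZr ?Rint_indic//; exact: Ibl_indic.
apply: Rint_le => //.
  by apply: (Ibl_eq _ (IblZ (x ^+ 8) (Ibl_indic mu mA))) => z; rewrite mulrC.
move=> z; rewrite indicE; case: (boolP (z \in A)) => [|_]; last first.
  by rewrite mul0r exprn_even_ge0.
rewrite inE /A/= mul1r => /ltW xz.
have -> : <<z, l>> ^+ 8 = `|<<z, l>>| ^+ 8.
  by rewrite -normrX ger0_norm// exprn_even_ge0.
by rewrite lerXn2r// nnegrE ltW.
Qed.

End gaussian_law.

Section gaussian_ibp.
Variables (R : realType) (mu : probability (L2 (leb01 R)) R).
Hypothesis gm : gaussian_measure mu 0 (@covQ R).
Local Notation H := (L2 (leb01 R)).
Local Notation "<< x , y >>" := (L2_dot x y).
Variable m : H.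
Implicit Types (k z : H) (f g : H -> R).
Let c k : R := <<covQ m, k>>.

(** Pairs formed by a function and its derivative in the direction Q m. The class
    is generated by trigonometric functions, for which integration by parts only
    involves characteristic functions, and is closed under bounded pointwise
    limits of both components, which preserve the formula. *)
Inductive trigC : (H -> R) -> (H -> R) -> Prop :=
| trigC_cos k a : trigC (fun z => cos (<<z, k>> + a))
    (fun z => - sin (<<z, k>> + a) * c k)
| trigC_add f f' g g' : trigC f f' -> trigC g g' ->
    trigC (fun z => f z + g z) (fun z => f' z + g' z)
| trigC_scale (r : R) f f' : trigC f f' ->
    trigC (fun z => r * f z) (fun z => r * f' z)
| trigC_lim (u u' : nat -> H -> R) f f' (M : R) :
    (forall n, trigC (u n) (u' n)) ->
    (forall n z, `|u n z| <= M) -> (forall n z, `|u' n z| <= M) ->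
    (forall z, u n z @[n --> \oo] --> f z) ->
    (forall z, u' n z @[n --> \oo] --> f' z) -> trigC f f'.

Lemma trigC_ext f f' g g' : trigC f f' -> f =1 g -> f' =1 g' -> trigC g g'.
Proof. by move=> + /funext <- /funext <-. Qed.

Let le_sin (y : R) : `|sin y| <= 1.
Proof. by rewrite ler_norml sin_geN1 sin_le1. Qed.

Let le_cos (y : R) : `|cos y| <= 1.
Proof. by rewrite ler_norml cos_geN1 cos_le1. Qed.

Let lim_norm_le (u : nat -> R) (l M : R) :
  (forall n, `|u n| <= M) -> u n @[n --> \oo] --> l -> `|l| <= M.
Proof.
move=> uM ul; have cn : `|u n| @[n --> \oo] --> `|l| by exact: cvg_norm.
rewrite -(cvg_lim _ cn)//; apply: limr_le; first by apply: cvgP cn.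
exact: nearW.
Qed.

Lemma trigC_bdd f f' : trigC f f' ->
  exists M : R, (forall z, `|f z| <= M) /\ (forall z, `|f' z| <= M).
Proof.
elim=> [k a|{}f {}f' g g' _ [M [M1 M2]] _ [N [N1 N2]]|r {}f {}f' _ [M [M1 M2]]
  |u u' {}f {}f' M _ _ M1 M2 c1 c2].
- exists (1 + `|c k|); split => z.
    by have := le_cos (<<z, k>> + a); have := normr_ge0 (c k); lra.
  rewrite normrM normrN; have := ler_wpM2r (normr_ge0 (c k)) (le_sin (<<z, k>> + a)).
  lra.
- exists (M + N); split => z; rewrite (le_trans (ler_normD _ _))// lerD//.
- by exists (`|r| * M); split => z; rewrite normrM ler_wpM2l.
- by exists M; split => z; [exact: lim_norm_le (M1^~ z) (c1 z)
    |exact: lim_norm_le (M2^~ z) (c2 z)].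
Qed.

Let mcosk k a : measurable_fun setT (fun z => cos (<<z, k>> + a)).
Proof.
apply: measurableT_comp; first exact: continuous_measurable_fun (@continuous_cos _).
by apply: measurable_funD => //; exact: measurable_L2_dotr.
Qed.

Let msink k a : measurable_fun setT (fun z => sin (<<z, k>> + a)).
Proof.
apply: measurableT_comp; first exact: continuous_measurable_fun (@continuous_sin _).
by apply: measurable_funD => //; exact: measurable_L2_dotr.
Qed.

Lemma trigC_meas f f' : trigC f f' ->
  measurable_fun setT f /\ measurable_fun setT f'.
Proof.
elim=> [k a|{}f {}f' g g' _ [M1 M2] _ [N1 N2]|r {}f {}f' _ [M1 M2]
  |u u' {}f {}f' M _ IH M1 M2 c1 c2].
- split; first exact: mcosk.
  by apply: measurable_funM => //; apply: measurable_funN; exact: msink.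
- by split; exact: measurable_funD.
- by split; exact: measurable_funM.
- split.
    by apply: (measurable_fun_cvg (h := u)) => [n|z _]; [case: (IH n)|exact: c1].
  by apply: (measurable_fun_cvg (h := u')) => [n|z _]; [case: (IH n)|exact: c2].
Qed.

(** Differentiating t |-> E sin (<z, k + t m> + a), which is known in closed form,
    at t = 0. *)
Let ibp_cos k a : \int[mu]_z (- sin (<<z, k>> + a) * c k)
  = \int[mu]_z (cos (<<z, k>> + a) * <<z, m>>).
Proof.
pose G t := \int[mu]_z sin (<<z, k>> + t * <<z, m>> + a).
have GE t : G t = sin a * expR (- (Qvar (k + t *: m) / 2)).
  rewrite -(cosBpihalf a) -(char_gauss gm); apply: eq_Rintegral => z _.
  by rewrite (L2_dotDr k (t *: m) z) (L2_dotZr t m z) addrA cosBpihalf.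
have mK (t : R) : measurable_fun setT (fun z : H => <<z, k>> + t * <<z, m>> + a).
  apply: measurable_funD => //; apply: measurable_funD; first exact: measurable_L2_dotr.
  by apply: measurable_funM => //; exact: measurable_L2_dotr.
have dG : is_derive (0 : R) 1 G (\int[mu]_z (<<z, m>> * cos (<<z, k>> + 0 * <<z, m>> + a))).
  apply: (@Rint_derive _ _ _ mu (fun t z => sin (<<z, k>> + t * <<z, m>> + a))
    (fun t z => <<z, m>> * cos (<<z, k>> + t * <<z, m>> + a))
    (fun z => `|<<z, m>>|)).
  - move=> t; apply: (@Ibl_bounded _ _ _ _ 1); last by move=> z; exact: le_sin.
    apply: measurableT_comp; last exact: mK.
    exact: continuous_measurable_fun (@continuous_sin _).
  - move=> t z; move: (<<z, m>>) (<<z, k>>) => y x.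
    by apply: is_derive_eq_val; rewrite /GRing.scale/=; lra.
  - exact/integrable_norm/(integrable_gauss gm).
  - by move=> t z; rewrite normrM ler_piMr.
have dG2 : is_derive (0 : R) 1 G (sin a * (expR (- (Qvar k / 2)) * - c k)).
  have -> : G = fun t => sin a * expR (- (Qvar k / 2) - t * c k - t ^+ 2 * (Qvar m / 2)).
    by apply/funext => t; rewrite GE (Qvar_line gm); congr (_ * expR _); rewrite /c; lra.
  move: (Qvar k) (Qvar m) (c k) => v w u.
  apply: is_derive_eq_val.
  rewrite mul0r expr0n/= mul0r !subr0 /GRing.scale/=; lra.
have E : \int[mu]_z (<<z, m>> * cos (<<z, k>> + 0 * <<z, m>> + a))
    = sin a * (expR (- (Qvar k / 2)) * - c k).
  transitivity ('D_1 G (0 : R)); first exact/esym/(@derive_val _ _ _ _ _ _ _ dG).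
  exact: (@derive_val _ _ _ _ _ _ _ dG2).
transitivity (- c k * \int[mu]_z cos (<<z, k>> + (a - pi / 2))).
  rewrite -RintZ; last by apply: (@Ibl_bounded _ _ _ _ 1); [exact: mcosk|move=> z; exact: le_cos].
  by apply: eq_Rintegral => z _; rewrite addrA cosBpihalf mulNr mulrC mulNr.
rewrite (char_gauss gm) cosBpihalf.
transitivity (sin a * (expR (- (Qvar k / 2)) * - c k)); first by rewrite mulrC -mulrA.
by rewrite -E; apply: eq_Rintegral => z _; rewrite mul0r addr0 mulrC.
Qed.

(** Gaussian integration by parts, E (D_(Q m) f) = E (f <z, m>), by induction on the
    class. *)
Lemma trigC_ibp f f' : trigC f f' -> \int[mu]_z f' z = \int[mu]_z (f z * <<z, m>>).
Proof.
have mm : measurable_fun setT (fun z : H => <<z, m>>) by exact: measurable_L2_dotr.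
have Im := integrable_gauss gm m.
have IM f0 f0' : trigC f0 f0' -> Ibl mu f0' /\ Ibl mu (fun z => f0 z * <<z, m>>).
  move=> tf; have [M [M1 M2]] := trigC_bdd tf; have [m1 m2] := trigC_meas tf.
  split; first exact: Ibl_bounded M2.
  apply: (Ibl_le _ (IblZ M Im)); first exact: measurable_funM.
  move=> z; rewrite !normrM ler_wpM2r// (le_trans (M1 z))//; exact: ler_norm.
elim=> [k a|{}f {}f' g g' tf IHf tg IHg|r {}f {}f' tf IH
  |u u' {}f {}f' M tu IH M1 M2 c1 c2].
- exact: ibp_cos.
- have [I1 I2] := IM _ _ tf; have [I3 I4] := IM _ _ tg.
  by rewrite RintD// IHf IHg -RintD//; apply: eq_Rintegral => z _; rewrite mulrDl.
- have [I1 I2] := IM _ _ tf.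
  by rewrite RintZ// IH -RintZ//; apply: eq_Rintegral => z _; rewrite mulrA.
- have tf : trigC f f' by exact: trigC_lim c1 c2.
  have [m1 m2] := trigC_meas tf.
  have [_ L1] := @Rint_dct _ _ _ mu u' f' (cst M) (fun n => (trigC_meas (tu n)).2)
    m2 c2 (Ibl_cst mu M) M2.
  have [_ L2] : Ibl mu (fun z => f z * <<z, m>>) /\
      \int[mu]_z (u n z * <<z, m>>) @[n --> \oo] --> \int[mu]_z (f z * <<z, m>>).
    apply: (Rint_dct (g := fun z => M * `|<<z, m>>|)).
    + by move=> n; apply: measurable_funM => //; have [] := trigC_meas (tu n).
    + exact: measurable_funM.
    + by move=> z; apply: cvgMl; exact: c1.
    + by apply: IblZ; exact: integrable_norm.
    + by move=> n z; rewrite normrM ler_wpM2r.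
  apply: cvg_unique L1 _ => //.
  by rewrite (_ : (fun n => _) = fun n => \int[mu]_z (u n z * <<z, m>>))//;
    apply/funext => n; exact: IH.
Qed.

(** The product-to-sum formulas make the generators stable under multiplication; the
    other cases follow by linearity and passage to the limit. *)
Let trigC_mul_cos k a g g' : trigC g g' ->
  trigC (fun z => cos (<<z, k>> + a) * g z)
    (fun z => - sin (<<z, k>> + a) * c k * g z + cos (<<z, k>> + a) * g' z).
Proof.
elim=> [l b|{}g {}g' h h' _ IHg _ IHh|r {}g {}g' _ IH|u u' {}g {}g' M tu IH M1 M2 c1 c2].
- have h1 := trigC_scale 2^-1 (trigC_add (trigC_cos (k + l) (a + b))
     (trigC_cos (k - l) (a - b))).
  have ck1 : c (k + l) = c k + c l by exact: L2_dotDr.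
  have ck2 : c (k - l) = c k - c l by exact: L2_dotBr.
  have Ez1 z : <<z, k + l>> + (a + b) = (<<z, k>> + a) + (<<z, l>> + b).
    by rewrite (L2_dotDr k l z) addrACA.
  have Ez2 z : <<z, k - l>> + (a - b) = (<<z, k>> + a) - (<<z, l>> + b).
    by rewrite (L2_dotBr k l z) opprD addrACA.
  apply: (trigC_ext h1) => z; rewrite Ez1 Ez2 ?ck1 ?ck2; move: (<<z, k>> + a) (<<z, l>> + b) => x y.
    rewrite cosD cosB; lra.
  rewrite sinD sinB; lra.
- by apply: (trigC_ext (trigC_add IHg IHh)) => z; lra.
- by apply: (trigC_ext (trigC_scale r IH)) => z; lra.
- apply: (trigC_lim (M := M * (1 + `|c k|)) IH).
  + move=> n z; rewrite normrM; have := M1 n z; have := normr_ge0 (u n z).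
    have := ler_wpM2r (normr_ge0 (u n z)) (le_cos (<<z, k>> + a)).
    have := normr_ge0 (c k); nra.
  + move=> n z; apply: le_trans (ler_normD _ _) _; rewrite !normrM normrN.
    have h1 := ler_wpM2r (normr_ge0 (u' n z)) (le_cos (<<z, k>> + a)).
    have h2 := ler_wpM2r (normr_ge0 (u n z))
      (ler_wpM2r (normr_ge0 (c k)) (le_sin (<<z, k>> + a))).
    have := ler_wpM2l (normr_ge0 (c k)) (M1 n z).
    have := M2 n z; lra.
  + by move=> z; apply: cvgMr; exact: c1.
  + by move=> z; apply: cvgD; apply: cvgMr; [exact: c1|exact: c2].
Qed.

Lemma trigC_mul f f' g g' : trigC f f' -> trigC g g' ->
  trigC (fun z => f z * g z) (fun z => f' z * g z + f z * g' z).
Proof.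
move=> tf tg; elim: tf => [k a|{}f {}f' h h' _ IHf _ IHh|r {}f {}f' _ IH
  |u u' {}f {}f' M tu IH M1 M2 c1 c2].
- exact: trigC_mul_cos.
- by apply: (trigC_ext (trigC_add IHf IHh)) => z; lra.
- by apply: (trigC_ext (trigC_scale r IH)) => z; lra.
- have [N [N1 N2]] := trigC_bdd tg.
  have M0 : 0 <= M by exact: le_trans (M1 0%N 0).
  have N0 : 0 <= N by exact: le_trans (N1 0).
  apply: (trigC_lim (M := 2 * (M * N)) IH).
  + move=> n z; rewrite normrM.
    have := ler_pM (normr_ge0 _) (normr_ge0 _) (M1 n z) (N1 z).
    have := mulr_ge0 M0 N0; lra.
  + move=> n z; apply: le_trans (ler_normD _ _) _; rewrite !normrM.
    have := ler_pM (normr_ge0 _) (normr_ge0 _) (M1 n z) (N2 z).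
    have := ler_pM (normr_ge0 _) (normr_ge0 _) (M2 n z) (N1 z); lra.
  + by move=> z; apply: cvgMl; exact: c1.
  + by move=> z; apply: cvgD; apply: cvgMl; [exact: c2|exact: c1].
Qed.

Lemma trigC_cst (r : R) : trigC (fun=> r) (fun=> 0).
Proof.
apply: (trigC_ext (trigC_scale r (trigC_cos 0 0))) => z.
  by rewrite L2_dot0r addr0 cos0 mulr1.
by rewrite /c (L2_dot0r (covQ m)) !mulr0.
Qed.

Let S (n : nat) (x : R) := series (exp_coeff x) n.

Let S_bound n (x M : R) : `|x| <= M -> `|S n x| <= expR M.
Proof.
move=> xM; have M0 : 0 <= M by exact: le_trans xM.
apply: (@le_trans _ _ (S n M)).
  rewrite /S /series/=; apply: le_trans (ler_norm_sum _ _ _) _.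
  apply: ler_sum => i _; rewrite /exp_coeff/= normrM normrX.
  rewrite (ger0_norm (_ : 0 <= (i`!%:R)^-1 :> R)) ?invr_ge0//.
  by rewrite ler_wpM2r ?invr_ge0// lerXn2r// nnegrE.
apply: nondecreasing_cvgn_le; last exact: is_cvg_series_exp_coeff.
apply/nondecreasing_seqP => k; rewrite /S /series/= big_nat_recr//= lerDl.
by rewrite /exp_coeff/= mulr_ge0 ?exprn_ge0 ?invr_ge0.
Qed.

(** Closure under the exponential, through the partial sums of its series. *)
Lemma trigC_exp f f' : trigC f f' ->
  trigC (fun z => expR (f z)) (fun z => expR (f z) * f' z).
Proof.
move=> tf; have [M [M1 M2]] := trigC_bdd tf.
have tX n : trigC (fun z => f z ^+ n.+1) (fun z => n.+1%:R * f z ^+ n * f' z).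
  elim: n => [|n IH]; first by apply: (trigC_ext tf) => z; rewrite ?expr1// expr0 mulr1 mul1r.
  apply: (trigC_ext (trigC_mul tf IH)) => z; first by rewrite [RHS]exprS.
  rewrite -[n.+2%:R]natr1 exprS.
  by move: (n.+1%:R) (f z ^+ n) (f z) (f' z) => q x y y'; lra.
have tS n : trigC (fun z => S n.+1 (f z)) (fun z => S n (f z) * f' z).
  elim: n => [|n IH].
    apply: (trigC_ext (trigC_cst 1)) => z; rewrite /S /series/=.
      by rewrite big_nat1 /exp_coeff/= expr0 fact0 divr1.
    by rewrite big_geq// mul0r.
  apply: (trigC_ext (trigC_add IH (trigC_scale (n.+1)`!%:R^-1 (tX n)))) => z.
    by rewrite [in RHS]/S /series/= big_nat_recr//= /exp_coeff/= [in RHS]mulrC.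
  rewrite [in RHS]/S /series/= big_nat_recr//= /exp_coeff/= -/(series _ _).
  rewrite mulrDl; congr (_ + _).
  rewrite factS natrM invfM.
  have n1 : n.+1%:R * n.+1%:R^-1 = 1 :> R by rewrite divff.
  move: (n.+1%:R) n1 => q; move: (q^-1) => p qp; move: (n`!%:R^-1) (f z ^+ n) => e x.
  rewrite (_ : p * e * _ = (q * p) * (x * e * f' z)); last lra.
  by rewrite qp mul1r.
have M0 : 0 <= M by exact: le_trans (M1 0).
apply: (trigC_lim (M := expR M * (1 + M)) tS).
- move=> n z; have := S_bound n.+1 (M1 z); have := expR_ge0 M; nra.
- move=> n z; rewrite normrM.
  have := ler_pM (normr_ge0 _) (normr_ge0 _) (S_bound n (M1 z)) (M2 z).
  by have := expR_ge0 M; lra.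
- move=> z; rewrite (cvg_shiftS (fun n => S n (f z))).
  exact: is_cvg_series_exp_coeff.
- move=> z; apply: cvgMl; exact: is_cvg_series_exp_coeff.
Qed.

End gaussian_ibp.

(** * Smooth approximations of intersections of half-spaces *)

Section exp_sum.
Variables (R : realType) (I : Type).
Implicit Types (s : seq I) (Y a : I -> R).

Lemma mul_expRN_le1 (y : R) : y * expR (- y) <= 1.
Proof.
rewrite expRN ler_pdivrMr ?expR_gt0// mul1r.
by have := expR_ge1Dx y; lra.
Qed.

Lemma expR_sumN_le1 s Y : (forall i, 0 <= Y i) -> expR (- \sum_(i <- s) Y i) <= 1.
Proof. by move=> Y0; rewrite -expR0 ler_expR oppr_le0 sumr_ge0. Qed.

(** Each factor Y i exp(- Y i) is at most 1. This makes the derivative of exp(- sum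
    of weights) bounded although the weights are not. *)
Lemma expR_sumN_bound s Y a : (forall i, 0 <= Y i) -> (forall i, 0 <= a i) ->
  expR (- \sum_(i <- s) Y i) * \sum_(i <- s) Y i * a i <= \sum_(i <- s) a i.
Proof.
move=> Y0 a0; elim: s => [|i s IH]; first by rewrite !big_nil mulr0.
rewrite !big_cons opprD expRD.
have h1 := expR_sumN_le1 s Y0.
have h2 := mul_expRN_le1 (Y i).
have h3 : expR (- Y i) <= 1 by rewrite -expR0 ler_expR oppr_le0.
have S0 : 0 <= \sum_(i <- s) a i by apply: sumr_ge0.
have e0 := expR_ge0 (- Y i); have E0 := expR_ge0 (- \sum_(i <- s) Y i).
move: (expR (- Y i)) (expR (- \sum_(i <- s) Y i)) h1 h2 h3 IH e0 E0 => e E h1 h2 h3 IH e0 E0.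
rewrite mulrDr; apply: lerD.
  rewrite (_ : e * E * (Y i * a i) = (Y i * e) * E * a i); last lra.
  by rewrite ler_piMl// mulr_ile1// mulr_ge0.
rewrite -mulrA; apply: le_trans (ler_wpM2l e0 IH) _.
by rewrite ler_piMl.
Qed.

End exp_sum.

Section sin_limit.
Variable R : realType.

Lemma cvg_mulr_sin_div (x : R) : n.+1%:R * sin (x / n.+1%:R) @[n --> \oo] --> x.
Proof.
have dsin : is_derive (0 : R) 1 (fun t : R => sin (t * x)) x.
  apply: is_derive_eq_val; rewrite mul0r cos0 /GRing.scale/=; lra.
have [dx vx] := dsin; move: dx; rewrite /derivable => /cvg_ex[l hl].
have El : l = x.
  by rewrite -vx; apply/esym/cvg_lim => //; exact: hl.
rewrite {}El in hl.
have := (cvgr_dnbhsP _ _ _).1 hl (fun n => n.+1%:R^-1).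
have h0 : (forall n, n.+1%:R^-1 != 0 :> R) /\ n.+1%:R^-1 @[n --> \oo] --> (0 : R).
  by split => [n|]; [rewrite invr_eq0|exact: cvg_harmonic].
move=> /(_ h0); apply: cvg_trans; apply: near_eq_cvg; apply: nearW => n /=.
by rewrite invrK /GRing.scale/= mulr1 addr0 mul0r sin0 subr0 [_^-1 * x]mulrC.
Qed.

End sin_limit.

Section soft_indicator.
Variables (R : realType) (mu : probability (L2 (leb01 R)) R).
Hypothesis gm : gaussian_measure mu 0 (@covQ R).
Local Notation H := (L2 (leb01 R)).
Local Notation "<< x , y >>" := (L2_dot x y).
Implicit Types (k z : H) (s : seq H).
Variables (kap beta : R).
Hypothesis kap0 : 0 <= kap.

(** The Gumbel weight exp(- kap (x + beta)) turns sums into products: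
    exp(- sum of weights) is a smooth version of the indicator of the set where
    all the functionals are at least - beta. *)
Definition wgt (x : R) : R := expR (- (kap * (x + beta))).

Definition soft s (z : H) : R := expR (- \sum_(k <- s) wgt <<z, k>>).

Lemma wgt_ge0 x : 0 <= wgt x. Proof. exact: expR_ge0. Qed.

Lemma soft_ge0 s z : 0 <= soft s z. Proof. exact: expR_ge0. Qed.

Lemma soft_le1 s z : soft s z <= 1.
Proof. by apply: expR_sumN_le1 => k; exact: wgt_ge0. Qed.

Variable m : H.
Local Notation c k := (<<covQ m, k>>).

Lemma trigC_sum s (F F' : H -> H -> R) : (forall k, trigC m (F k) (F' k)) ->
  trigC m (fun z => \sum_(k <- s) F k z) (fun z => \sum_(k <- s) F' k z).
Proof.
move=> tF; elim: s => [|k s IH].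
  by apply: (trigC_ext (trigC_cst m 0)) => z; rewrite big_nil.
by apply: (trigC_ext (trigC_add (tF k) IH)) => z; rewrite big_cons.
Qed.

(** The functional <z, k> is the limit of the bounded functions n sin(<z, k> / n),
    which belong to the class, and so do exponentials of exponentials of their
    combinations. The bound on the derivatives is expR_sumN_bound. *)
Lemma trigC_soft s : trigC m (soft s)
  (fun z => soft s z * \sum_(k <- s) wgt <<z, k>> * (kap * c k)).
Proof.
pose u n k z := n.+1%:R * sin (<<z, k>> / n.+1%:R).
pose u' n k z := cos (<<z, k>> / n.+1%:R) * c k.
have tu n k : trigC m (u n k) (u' n k).
  apply: (trigC_ext (trigC_scale n.+1%:R
    (trigC_cos m (n.+1%:R^-1 *: k) (- (pi / 2))))) => z.
    by rewrite (L2_dotZr _ k z) cosBpihalf [_^-1 * _]mulrC.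
  rewrite (L2_dotZr _ k z) (L2_dotZr _ k (covQ m)) sinBpihalf opprK [_^-1 * _]mulrC.
  have n1 : n.+1%:R * n.+1%:R^-1 = 1 :> R by rewrite divff.
  rewrite /u'; move: (cos _) (c k) => a b.
  transitivity ((n.+1%:R * n.+1%:R^-1) * (a * b)); last by rewrite n1 mul1r.
  by move: n.+1%:R^-1 => q; lra.
pose f n z := expR (- \sum_(k <- s) wgt (u n k z)).
pose f' n z := f n z * \sum_(k <- s) wgt (u n k z) * (kap * u' n k z).
have tf n : trigC m (f n) (f' n).
  have tw k : trigC m (fun z => wgt (u n k z))
      (fun z => wgt (u n k z) * (- kap * u' n k z)).
    apply: (trigC_ext (trigC_exp (trigC_scale (- kap)
      (trigC_add (tu n k) (trigC_cst m beta))))) => z.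
      by rewrite /wgt mulNr.
    by rewrite /wgt mulNr addr0.
  apply: (trigC_ext (trigC_exp (trigC_scale (-1) (trigC_sum s tw)))) => z.
    by rewrite mulN1r.
  rewrite !mulN1r /f' /f; congr (_ * _); rewrite -sumrN; apply: eq_bigr => k _.
  by rewrite mulNr mulrN opprK.
have M0 : 0 <= \sum_(k <- s) kap * `|c k| by apply: sumr_ge0 => k _; rewrite mulr_ge0.
apply: (trigC_lim (M := 1 + \sum_(k <- s) kap * `|c k|) tf).
- move=> n z; rewrite ger0_norm ?expR_ge0//.
  have : f n z <= 1 by apply: expR_sumN_le1 => k; exact: wgt_ge0.
  by move: M0; move: (\sum_(_ <- _) _) => r; lra.
- move=> n z; rewrite normrM (ger0_norm (expR_ge0 _)).
  apply: (@le_trans _ _ (\sum_(k <- s) kap * `|c k|)); last by rewrite lerDr.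
  apply: le_trans (expR_sumN_bound s (fun k => wgt_ge0 (u n k z))
    (fun k => mulr_ge0 kap0 (normr_ge0 (c k)))).
  apply: ler_wpM2l; first exact: expR_ge0.
  apply: le_trans (ler_norm_sum _ _ _) _; apply: ler_sum => k _.
  rewrite normrM (ger0_norm (wgt_ge0 _)); apply: ler_wpM2l; first exact: wgt_ge0.
  rewrite normrM (ger0_norm kap0) ler_wpM2l// /u' normrM ler_piMl//.
  by rewrite ler_norml cos_geN1 cos_le1.
- move=> z.
  have cw k : wgt (u n k z) @[n --> \oo] --> wgt <<z, k>>.
    apply: (cvg_comp (fun n => - (kap * (u n k z + beta))) expR); last exact: continuous_expR.
    apply: cvgN; apply: cvgMr; apply: cvgD; last exact: cvg_cst.
    exact: cvg_mulr_sin_div.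
  apply: (cvg_comp (fun n => - \sum_(k <- s) wgt (u n k z)) expR); last exact: continuous_expR.
  by apply: cvgN; apply: cvg_sum_seq => k; exact: cw.
- move=> z.
  have cw k : wgt (u n k z) @[n --> \oo] --> wgt <<z, k>>.
    apply: (cvg_comp (fun n => - (kap * (u n k z + beta))) expR); last exact: continuous_expR.
    apply: cvgN; apply: cvgMr; apply: cvgD; last exact: cvg_cst.
    exact: cvg_mulr_sin_div.
  apply: cvgM.
    apply: (cvg_comp (fun n => - \sum_(k <- s) wgt (u n k z)) expR); last exact: continuous_expR.
    by apply: cvgN; apply: cvg_sum_seq => k; exact: cw.
  apply: cvg_sum_seq => k; apply: cvgM; first exact: cw.
  apply: cvgMr.
  have h : <<z, k>> * n.+1%:R^-1 @[n --> \oo] --> <<z, k>> * 0.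
    by apply: cvgMr; exact: cvg_harmonic.
  rewrite mulr0 in h.
  have h2 : cos (<<z, k>> / n.+1%:R) @[n --> \oo] --> cos (0 : R).
    by apply: (cvg_comp (fun n => <<z, k>> / n.+1%:R) cos h); exact: continuous_cos.
  have : u' n k z @[n --> \oo] --> cos (0 : R) * c k by apply: cvgMl.
  by rewrite cos0 mul1r.
Qed.

(** Integration by parts for the soft indicator in the direction Q m: the left-hand
    side is the expectation of its derivative. *)
Lemma soft_ibp s :
  \int[mu]_z (soft s z * \sum_(k <- s) wgt <<z, k>> * (kap * c k))
  = \int[mu]_z (soft s z * <<z, m>>).
Proof. exact: (trigC_ibp gm (trigC_soft s)). Qed.

End soft_indicator.

(** * Integration on the unit interval *)

Section leb01_theory.
Variable R : realType.
Local Notation lam := (@lebesgue_measure R).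
Local Notation nu := (leb01 R).
Local Notation D := (`]0%R, 1%R[%classic : set R).
Implicit Types f g : R -> R.

Let mD : measurable D. Proof. exact: measurable_itv. Qed.

Lemma leb01_setT : nu setT = 1%E.
Proof.
by rewrite /leb01/= /mrestr setTI lebesgue_measure_itv/= lte_fin ltr01 oppr0 adde0.
Qed.

Lemma Ibl01_bounded (M : R) f : measurable_fun setT f ->
  (forall x, `|f x| <= M) -> Ibl nu f.
Proof.
move=> mf fM; apply: measurable_bounded_integrable => //.
  by rewrite leb01_setT ltry.
exists M; split; first exact: num_real.
by move=> y My x _ /=; exact: le_trans (fM x) (ltW My).
Qed.

Lemma Rint01_cst (c : R) : \int[nu]_x c = c.
Proof. by rewrite Rintegral_cst// leb01_setT mulr1. Qed.

(** Lebesgue measure is the sum of its restrictions to the interval and to the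
    complement. *)
Lemma ge0_integral01 (f : R -> \bar R) : (forall x, (0 <= f x)%E) ->
  measurable_fun setT f ->
  (\int[nu]_x f x = \int[lam]_(x in D) f x)%E.
Proof.
move=> f0 mf; pose m2 : {measure set (measurableTypeR R) -> \bar R} := mrestr lam (measurableC mD).
have mfD : measurable_fun setT (f \_ D).
  by apply/measurable_restrict => //; rewrite setTI; exact: measurable_funTS.
have fD0 x : setT x -> (0 <= (f \_ D) x)%E by rewrite patchE; case: ifP.
rewrite [RHS]integral_mkcond.
have E A : measurable A -> A `<=` setT -> lam A = measure_add nu m2 A.
  move=> mA _; rewrite measure_addE /leb01/= /mrestr -measureU.
  - by rewrite -setIUr setUv setIT.
  - exact: measurableI.
  - by apply: measurableI => //; exact: measurableC.
  - by rewrite setIACA setICr setI0.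
rewrite (eq_measure_integral _ E) ge0_integral_measure_add//.
have -> : (\int[m2]_x (f \_ D) x = 0)%E.
  rewrite (@ge0_negligible_integral _ _ _ m2 setT D)//; last first.
    by change (lam (D `&` ~` D) = 0%E); rewrite setICr measure0.
  by apply: integral0_eq => x [_ xD]; rewrite patchE memNset.
rewrite adde0.
have m0 : nu (~` D) = 0%E by change (lam (~` D `&` D) = 0%E); rewrite setICl measure0.
rewrite (@ge0_negligible_integral _ _ _ nu setT (~` D))//; last exact: measurableC.
rewrite [RHS](@ge0_negligible_integral _ _ _ nu setT (~` D))//; last exact: measurableC.
apply: eq_integral => x; rewrite setTD setCK => xD.
by rewrite patchE xD.
Qed.

Let ind_norm f x : `|f x * \1_D x| = `|f x| * \1_D x.
Proof. by rewrite normrM; congr (_ * _); rewrite ger0_norm// indicE ler0n. Qed.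

Lemma Ibl01P f : measurable_fun setT f ->
  Ibl nu f <-> Ibl lam (fun x => f x * \1_D x).
Proof.
move=> mf.
have mfD : measurable_fun setT (fun x => f x * \1_D x).
  by apply: measurable_funM => //; exact: measurable_indic.
have E : (\int[nu]_x `|(f x)%:E| = \int[lam]_x `|(f x * \1_D x)%:E|)%E.
  rewrite ge0_integral01//; last first.
    by apply: measurableT_comp => //; exact/measurable_EFinP.
  rewrite integral_mkcond; apply: eq_integral => x _.
  rewrite patchE indicE; case: ifP => xD; first by rewrite mulr1.
  by rewrite mulr0 abse0.
split => /integrableP[_ lf]; apply/integrableP; split.
- exact/measurable_EFinP.
- by rewrite /= -E.
- exact/measurable_EFinP.
- by rewrite /= E.
Qed.

Lemma Rint01 f : measurable_fun setT f ->
  \int[nu]_x f x = \int[lam]_x (f x * \1_D x).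
Proof.
move=> mf.
have mfE : measurable_fun setT (EFin \o f) by exact/measurable_EFinP.
rewrite /Rintegral; congr fine; rewrite integralE [RHS]integralE.
have h (g : R -> \bar R) : (forall x, (0 <= g x)%E) -> measurable_fun setT g ->
    (\int[nu]_x g x = \int[lam]_x (g \_ D) x)%E.
  by move=> g0 mg; rewrite ge0_integral01// integral_mkcond.
rewrite (h _ (funepos_ge0 _) (measurable_funepos mfE)).
rewrite (h _ (funeneg_ge0 _) (measurable_funeneg mfE)).
congr (_ - _)%E; apply: eq_integral => x _.
  rewrite patchE !funeposE indicE; case: ifP => _; first by rewrite mulr1.
  by rewrite mulr0 maxxx.
rewrite patchE !funenegE indicE; case: ifP => _; first by rewrite mulr1.
by rewrite mulr0 /= oppr0 maxxx.
Qed.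

Lemma Rint01_itv f (a b : R) : 0 <= a -> b <= 1 -> measurable_fun setT f ->
  \int[lam]_(x in `[a, b]) f x = \int[nu]_x (f x * \1_(`[a, b]%classic : set R) x).
Proof.
move=> a0 b1 mf.
have mI : measurable (`[a, b]%classic : set R) by exact: measurable_itv.
have mfI : measurable_fun setT (fun x => f x * \1_(`[a, b]%classic : set R) x).
  by apply: measurable_funM => //; exact: measurable_indic.
rewrite Rint01// Rintegral_mkcond; apply: Rint_ae.
- by apply/measurable_restrict => //; rewrite setTI; exact: measurable_funTS.
- by apply: measurable_funM => //; exact: measurable_indic.
- have neq (c : R) : {ae lam, forall x : measurableTypeR R, (x : R) != c}.
    exists [set c]; split; [exact: measurable_set1|exact: lebesgue_measure_set1|].
    by move=> x /= /negP; rewrite negbK => /eqP.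
  apply: filterS2 (neq 0) (neq 1) => x x0 x1 _.
  rewrite patchE !indicE; case: ifP => xI; last by rewrite mulr0 mul0r.
  rewrite mulr1 mem_set ?mulr1//= in_itv/=.
  move: xI; rewrite inE/= in_itv/= => /andP[ax xb].
  by rewrite !lt_neqAle eq_sym x0 x1/= (le_trans a0 ax) (le_trans xb b1).
Qed.

Lemma Rint01_closed f : measurable_fun setT f ->
  \int[lam]_(x in `[0, 1]) f x = \int[nu]_x f x.
Proof.
move=> mf; rewrite Rint01_itv// !Rint01//.
  apply: eq_Rintegral => x _; rewrite !indicE -mulrA; congr (_ * _).
  case: (boolP (x \in D)) => xD; last by rewrite mulr0.
  rewrite mem_set ?mulr1//=; move: xD; rewrite inE/= !in_itv/=.
  by move=> /andP[/ltW-> /ltW->].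
by apply: measurable_funM => //; apply: measurable_indic; exact: measurable_itv.
Qed.

End leb01_theory.

Lemma ae01_imp (R : realType) (f g f' g' : R -> R) :
  (forall x, f x = g x -> f' x = g' x) ->
  f = g %[ae leb01 R] -> f' = g' %[ae leb01 R].
Proof.
move=> h [N [mN N0 sub]]; exists N; split => //.
by apply: subset_trans sub => x /= h1 h2; apply: h1 => _; apply: h; exact: h2.
Qed.

Section primitives.
Variable R : realType.
Local Notation lam := (@lebesgue_measure R).
Local Notation nu := (leb01 R).
Local Notation TR := (measurableTypeR R).
Implicit Types a b f g l v : R -> R.

Let mle : measurable_fun setT (fun p : TR * TR => ((p.2 : R) <= p.1)%R%:R : R).
Proof.
pose A : set (TR * TR) := [set p | (p.2 : R) <= p.1].
have mA : measurable A.
  have mb : measurable_fun setT (fun p : TR * TR => (p.1 : R) - p.2).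
    by apply: measurable_funB; [exact: measurable_fst|exact: measurable_snd].
  have := mb measurableT _ (measurable_itv `[0, +oo[%R); rewrite setTI.
  by congr (measurable _); apply/seteqP; split => z /=; rewrite in_itv/= andbT subr_ge0.
have -> : (fun p : TR * TR => ((p.2 : R) <= p.1)%R%:R : R) = \1_A.
  apply/funext => p; rewrite indicE; congr ((nat_of_bool _)%:R).
  by apply/idP/idP; rewrite inE.
exact: measurable_indic.
Qed.

Let le01 (r s : R) : `|(s <= r)%R%:R : R| <= 1.
Proof. by case: (s <= r); rewrite ?normr1 ?normr0. Qed.

Let mles r : measurable_fun setT (fun s : TR => (s <= r)%R%:R : R).
Proof.
have mp : measurable_fun setT (fun s : TR => (r : TR, s)).
  by apply/measurable_fun_pairP; split; [exact: measurable_cst|exact: measurable_id].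
exact: (measurableT_comp mle mp).
Qed.

Let mler s : measurable_fun setT (fun r : TR => (s <= r)%R%:R : R).
Proof.
have mp : measurable_fun setT (fun r : TR => (r, s : TR)).
  by apply/measurable_fun_pairP; split; [exact: measurable_id|exact: measurable_cst].
exact: (measurableT_comp mle mp).
Qed.

Let Ile a r : Ibl lam a -> Ibl lam (fun s => a s * (s <= r)%R%:R).
Proof.
move=> Ia; apply: (Ibl_le _ Ia).
  by apply: measurable_funM; [exact: Ibl_meas Ia|exact: mles].
by move=> s; rewrite normrM ler_piMr.
Qed.

Let Ige a r : Ibl lam a -> Ibl lam (fun s => a s * (r <= s)%R%:R).
Proof.
move=> Ia; apply: (Ibl_le _ Ia).
  by apply: measurable_funM; [exact: Ibl_meas Ia|exact: mler].
by move=> s; rewrite normrM ler_piMr.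
Qed.

Let Iprod a b : Ibl lam a -> Ibl lam b ->
  (lam \x lam)%E.-integrable setT
    (fun p : TR * TR => (a p.1 * (b p.2 * ((p.2 : R) <= p.1)%R%:R))%:E).
Proof.
move=> Ia Ib.
have mK : measurable_fun setT
    (fun p : TR * TR => (a p.1 * (b p.2 * ((p.2 : R) <= p.1)%R%:R))%:E).
  apply/measurable_EFinP; apply: measurable_funM.
    exact: (measurableT_comp (Ibl_meas Ia) measurable_fst).
  apply: measurable_funM => //.
  exact: (measurableT_comp (Ibl_meas Ib) measurable_snd).
apply/integrable12ltyP => //.
apply: (@le_lt_trans _ _ (\int[lam]_x (`|a x| * \int[lam]_y `|b y|)%:E)%E).
  apply: ge0_le_integral => //.
  - by move=> x _; exact: integral_ge0.
  - apply: (@measurable_fun_fubini_tonelli_F _ _ _ _ _ lam (fun p : TR * TR =>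
      `|(a p.1 * (b p.2 * ((p.2 : R) <= p.1)%R%:R))%:E|%E)) => //.
    exact: measurableT_comp.
  - apply/measurable_EFinP; apply: measurable_funM => //.
    by apply: measurableT_comp => //; exact: Ibl_meas Ia.
  - move=> x _; have Inb := integrable_norm Ib.
    rewrite -RintZ// -Rint_ext; last exact: IblZ.
    apply: ge0_le_integral => //.
    + apply/measurable_EFinP; apply: measurableT_comp => //.
      exact: (measurable_funM (measurable_cst (a x)) (Ibl_meas (Ile x Ib))).
    + apply/measurable_EFinP; apply: measurable_funM => //.
      by apply: measurableT_comp => //; exact: Ibl_meas Ib.
    + by move=> y _ /=; rewrite lee_fin !normrM ler_wpM2l// ler_piMr.
have I : Ibl lam (fun x => `|a x| * \int[lam]_y `|b y|).
  apply: (Ibl_eq _ (IblZ (\int[lam]_y `|b y|) (integrable_norm Ia))) => x.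
  by rewrite mulrC.
by rewrite Rint_ext// ltry.
Qed.

Let prim_meas_lam a b : Ibl lam a -> Ibl lam b ->
  Ibl lam (fun r => a r * \int[lam]_s (b s * (s <= r)%R%:R)).
Proof.
move=> Ia Ib; have := integrable_fubini_F (Iprod Ia Ib).
apply: eq_integrable => // r _; rewrite /fubini_F.
transitivity ((\int[lam]_s (a r * (b s * (s <= r)%R%:R)))%:E).
  exact: (Rint_ext (IblZ (a r) (Ile r Ib))).
by rewrite (RintZ (a r) (Ile r Ib)).
Qed.

(** Integration by parts for absolutely continuous functions: exchange the order
    of integration over the two triangles of a square. *)
Let ibp_lam a b : Ibl lam a -> Ibl lam b ->
  \int[lam]_r (a r * \int[lam]_s (b s * (s <= r)%R%:R))
  + \int[lam]_s (b s * \int[lam]_r (a r * (r <= s)%R%:R))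
  = (\int[lam]_r a r) * (\int[lam]_s b s).
Proof.
move=> Ia Ib.
have -> : \int[lam]_s (b s * \int[lam]_r (a r * (r <= s)%R%:R))
    = \int[lam]_r (a r * \int[lam]_s (b s * (r <= s)%R%:R)).
  apply: (congr1 (@fine R)).
  transitivity (\int[lam]_s \int[lam]_r (b s * (a r * (r <= s)%R%:R))%:E)%E.
    apply: eq_integral => s _.
    rewrite -(RintZ (b s) (Ile s Ia)); apply/esym.
    exact: (Rint_ext (IblZ (b s) (Ile s Ia))).
  rewrite (Fubini (Iprod Ib Ia)); apply: eq_integral => r _ /=.
  rewrite -(RintZ (a r) (Ige r Ib)) -(Rint_ext (IblZ (a r) (Ige r Ib))).
  by apply: eq_integral => s _; rewrite mulrCA.
have If : Ibl lam (fun r => a r * \int[lam]_s b s).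
  by apply: (Ibl_eq _ (IblZ (\int[lam]_s b s) Ia)) => r; rewrite mulrC.
have h r : a r * \int[lam]_s (b s * (r <= s)%R%:R)
    = a r * \int[lam]_s b s - a r * \int[lam]_s (b s * (s <= r)%R%:R).
  rewrite -mulrBr -RintB//; last exact: Ile.
  congr (_ * _); apply: Rint_ae.
  - exact: Ibl_meas (Ige _ Ib).
  - exact: Ibl_meas (IblB Ib (Ile _ Ib)).
  - have : {ae lam, forall s : TR, (s : R) != r}.
      exists [set r]; split; [exact: measurable_set1|exact: lebesgue_measure_set1|].
      by move=> x /= /negP; rewrite negbK => /eqP.
    apply: filterS => s sr _; case: (ltgtP r s) => [rs|rs|E].
    + by rewrite mulr1 mulr0 subr0.
    + by rewrite mulr0 mulr1 subrr.
    + by move: sr; rewrite E eqxx.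
have -> : \int[lam]_r (a r * \int[lam]_s (b s * (r <= s)%R%:R))
    = \int[lam]_r (a r * \int[lam]_s b s
      - a r * \int[lam]_s (b s * (s <= r)%R%:R)).
  by apply: eq_Rintegral => r _; exact: h.
rewrite (RintB If (prim_meas_lam Ia Ib)).
by rewrite addrC subrK RintegralZr.
Qed.

(** The indicator of s <= r, rather than a domain of integration depending on r,
    lets Fubini's theorem apply to iterated primitives. *)
Definition prim f (r : R) : R := \int[nu]_s (f s * (s <= r)%R%:R).

Local Notation D := (`]0%R, 1%R[%classic : set R).

Let primE f r : measurable_fun setT f ->
  prim f r = \int[lam]_s (f s * \1_D s * (s <= r)%R%:R).
Proof.
move=> mf; rewrite /prim Rint01; last by apply: measurable_funM => //; exact: mles.
by apply: eq_Rintegral => s _; rewrite mulrAC.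
Qed.

Lemma Ibl_primM f g : Ibl nu f -> Ibl nu g -> Ibl nu (fun r => g r * prim f r).
Proof.
move=> If Ig; have mf := Ibl_meas If; have mg := Ibl_meas Ig.
have I1 := (Ibl01P mf).1 If; have I2 := (Ibl01P mg).1 Ig.
have I3 := prim_meas_lam I2 I1.
apply/Ibl01P; last first.
  by apply: (Ibl_eq _ I3) => r; rewrite primE// mulrAC.
(* Fubini's theorem gives the measurability of the primitives of the positive and
   negative parts of f. *)
apply: measurable_funM => //.
have -> : prim f = fun r => \int[lam]_s (f s * \1_D s * (s <= r)%R%:R).
  by apply/funext => r; rewrite primE.
have mp : measurable_fun setT (fubini_F lam
    (fun p : TR * TR => ((f p.2 * \1_D p.2) * ((p.2 : R) <= p.1)%R%:R)%:E)^\+%E).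
  apply: measurable_fun_fubini_tonelli_F => //.
  apply: measurable_funepos; apply/measurable_EFinP; apply: measurable_funM => //.
  exact: (measurableT_comp (Ibl_meas I1) measurable_snd).
have mn : measurable_fun setT (fubini_F lam
    (fun p : TR * TR => ((f p.2 * \1_D p.2) * ((p.2 : R) <= p.1)%R%:R)%:E)^\-%E).
  apply: measurable_fun_fubini_tonelli_F => //.
  apply: measurable_funeneg; apply/measurable_EFinP; apply: measurable_funM => //.
  exact: (measurableT_comp (Ibl_meas I1) measurable_snd).
rewrite /Rintegral; apply: measurableT_comp => //.
rewrite (_ : (fun r => _) = (fun r => fubini_F lam
    (fun p : TR * TR => ((f p.2 * \1_D p.2) * ((p.2 : R) <= p.1)%R%:R)%:E)^\+%E r -
    fubini_F lam
    (fun p : TR * TR => ((f p.2 * \1_D p.2) * ((p.2 : R) <= p.1)%R%:R)%:E)^\-%E r)%E); last first.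
  apply/funext => r; rewrite integralE /fubini_F.
  by congr (_ - _)%E; apply: eq_integral => s _; rewrite ?funeposE ?funenegE.
exact: emeasurable_funB.
Qed.

Lemma prim_meas f : Ibl nu f -> measurable_fun setT (prim f).
Proof.
move=> If; have I1 : Ibl nu (cst 1).
  by apply: (@Ibl01_bounded _ 1) => // x; rewrite normr1.
have := Ibl_meas (Ibl_primM If I1).
by under eq_fun do rewrite mul1r.
Qed.

Lemma prim_ibp f g : Ibl nu f -> Ibl nu g ->
  \int[nu]_r (g r * prim f r) + \int[nu]_r (f r * prim g r)
  = (\int[nu]_r g r) * (\int[nu]_r f r).
Proof.
move=> If Ig; have mf := Ibl_meas If; have mg := Ibl_meas Ig.
have I1 := (Ibl01P mf).1 If; have I2 := (Ibl01P mg).1 Ig.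
have m1 := Ibl_meas (Ibl_primM If Ig); have m2 := Ibl_meas (Ibl_primM Ig If).
rewrite !Rint01// -ibp_lam//; congr (_ + _); apply: eq_Rintegral => r _.
  by rewrite primE// mulrAC.
by rewrite primE// mulrAC.
Qed.

Lemma prim_itv f (r : R) : 0 <= r <= 1 -> measurable_fun setT f ->
  \int[lam]_(s in `[0, r]) f s = prim f r.
Proof.
move=> /andP[r0 r1] mf; rewrite Rint01_itv//.
have mI : measurable (`[0, r]%classic : set R) by exact: measurable_itv.
rewrite Rint01; last by apply: measurable_funM => //; exact: measurable_indic.
rewrite primE//; apply: eq_Rintegral => s _; rewrite !indicE.
case: (boolP (s \in D)) => sD; last by rewrite !mulr0 mul0r.
rewrite !mulr1; congr (_ * (nat_of_bool _)%:R); move: sD; rewrite inE/= in_itv/= => /andP[s0 s1].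
by apply/idP/idP; rewrite inE/= in_itv/= (ltW s0).
Qed.

Lemma prim_ae f g r : measurable_fun setT f -> measurable_fun setT g ->
  f = g %[ae nu] -> prim f r = prim g r.
Proof.
move=> mf mg fg; apply: Rint_ae.
- by apply: measurable_funM => //; exact: mles.
- by apply: measurable_funM => //; exact: mles.
- by apply: ae01_imp fg => s ->.
Qed.

Lemma prim1 f : Ibl nu f -> prim f 1 = \int[nu]_s f s.
Proof.
move=> If; have mf := Ibl_meas If.
rewrite primE// Rint01//; apply: eq_Rintegral => s _; rewrite indicE.
case: (boolP (s \in D)) => sD; last by rewrite !mulr0 mul0r.
by move: sD; rewrite inE/= in_itv/= => /andP[_ /ltW ->]; rewrite !mulr1.
Qed.

Lemma Ibl_prim f r : Ibl nu f -> Ibl nu (fun s => f s * (s <= r)%R%:R).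
Proof.
move=> If; apply: (Ibl_le _ If).
  by apply: measurable_funM; [exact: Ibl_meas If|exact: mles].
by move=> s; rewrite normrM ler_piMr.
Qed.

Lemma primD f g r : Ibl nu f -> Ibl nu g ->
  prim (fun s => f s + g s) r = prim f r + prim g r.
Proof.
move=> If Ig; rewrite /prim -RintD; [|exact: Ibl_prim|exact: Ibl_prim].
by apply: eq_Rintegral => s _; rewrite mulrDl.
Qed.

Lemma primZ c f r : Ibl nu f -> prim (fun s => c * f s) r = c * prim f r.
Proof.
move=> If; rewrite /prim -RintZ; last exact: Ibl_prim.
by apply: eq_Rintegral => s _; rewrite mulrA.
Qed.

Lemma prim_cst (c r : R) : 0 <= r <= 1 -> prim (cst c) r = c * r.
Proof.
move=> r01; rewrite -prim_itv// Rintegral_cst; last exact: measurable_itv.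
have /andP[r0 _] := r01.
have e : lebesgue_measure (`[0, r]%classic : set R) = r%:E.
  rewrite lebesgue_measure_itv/= lte_fin; case: ltP => rr; first by rewrite oppr0 adde0.
  by congr EFin; lra.
by transitivity (c * fine (lebesgue_measure (`[0, r]%classic : set R))); [|rewrite e].
Qed.

Lemma prim_id (r : R) : 0 <= r <= 1 -> prim (fun s => s) r = r ^+ 2 / 2.
Proof.
move=> r01; rewrite -prim_itv//; have /andP[r0 r1] := r01.
move: r0; rewrite le_eqVlt => /predU1P[<-|r0].
  by rewrite set_itv1 Rintegral_set1 expr0n/= mul0r.
rewrite /Rintegral (@continuous_FTC2 R (fun s => s) (fun s => s ^+ 2 / 2))//.
- by rewrite /= expr0n/= mul0r subr0.
- by apply: continuous_subspaceT => x; exact: cvg_id.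
- have cF (x : R) : {for x, continuous (fun s : R => s ^+ 2 / 2)}.
    by apply: cvgMl; exact: exprn_continuous.
  split; [|exact/cvg_at_right_filter/cF|exact/cvg_at_left_filter/cF].
  by move=> x _; apply: derivableM => //; exact: derivableX.
- move=> x _; rewrite derive1E.
  have d : is_derive x 1 (fun s : R => s ^+ 2 / 2) x.
    by apply: is_derive_eq_val; rewrite /GRing.scale/=; lra.
  exact: (@derive_val _ _ _ _ _ _ _ d).
Qed.

End primitives.

(** * The covariance operator *)

Section covariance.
Variable R : realType.
Local Notation lam := (@lebesgue_measure R).
Local Notation nu := (leb01 R).
Local Notation H := (L2 (leb01 R)).
Local Notation "<< x , y >>" := (L2_dot x y).
Implicit Types (x y z l : H).

Lemma Ibl01_cst (c : R) : Ibl nu (cst c).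
Proof. by apply: (@Ibl01_bounded _ `|c|). Qed.

Lemma Ibl_L2 x : Ibl nu x.
Proof.
apply: (@Ibl_le _ _ _ nu (fun t => 1 + x t * x t)).
- exact: L2_meas.
- by apply: IblD; [exact: Ibl01_cst|exact: Ibl_L2M].
- move=> t; rewrite [leRHS]ger0_norm; last by rewrite addr_ge0// -expr2 sqr_ge0.
  move: (L2_fun x t) => a; rewrite ler_norml; have := sqr_ge0 (a - 1).
  by have := sqr_ge0 (a + 1); have := sqr_ge0 a => *; apply/andP; split; lra.
Qed.

Lemma Ibl_primL2 l : Ibl nu (prim l).
Proof.
by apply: (Ibl_eq _ (Ibl_primM (Ibl_L2 l) (Ibl01_cst 1))) => t; rewrite mul1r.
Qed.

Lemma Ibl_slope (b : R) l : Ibl nu (fun t => b - 2 * prim l t).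
Proof. by apply: IblB; [exact: Ibl01_cst|apply: IblZ; exact: Ibl_primL2]. Qed.

Lemma ae01_itv (f g : R -> R) : (forall r, 0 <= r <= 1 -> f r = g r) ->
  f = g %[ae nu].
Proof.
move=> fg; exists (~` `]0%R, 1%R[%classic); split.
- by apply: measurableC; exact: measurable_itv.
- by change (lam (~` `]0%R, 1%R[%classic `&` `]0%R, 1%R[%classic) = 0%E);
    rewrite setICl measure0.
- move=> x /= h; apply: contra_not h => + _; rewrite /= in_itv/= => /andP[a b].
  by apply: fg; rewrite !ltW.
Qed.

(** As l = - x'' / 2, the derivative of x is b - 2 prim l, and the boundary value
    x(1) = 0 makes its integral vanish. *)
Lemma A_graphE x l : A_graph x l ->
  exists2 b, \int[nu]_t (b - 2 * prim l t) = 0 &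
    (x : R -> R) = prim (fun t => b - 2 * prim l t) %[ae nu].
Proof.
move=> [w [u [v [xu u0 u1 uE vE]]] lw].
have El : (w : R -> R) = (fun t => - 2 * l t) %[ae nu].
  have -> : w = - 2 *: l.
    by rewrite lw scalerA mulrNN divff// scale1r.
  exact: L2_scaleE.
have ml := L2_meas l; have mw := L2_meas w.
have ml2 : measurable_fun setT (fun t => - 2 * l t) by exact: measurable_funM.
have vE' r : 0 <= r <= 1 -> v r = v 0 - 2 * prim l r.
  move=> r01; rewrite vE// prim_itv// (prim_ae r mw ml2 El).
  by rewrite primZ ?mulNr//; exact: Ibl_L2.
have Iv := Ibl_slope (v 0) l.
have uE' r : 0 <= r <= 1 -> u r = prim (fun t => v 0 - 2 * prim l t) r.
  move=> r01; rewrite uE// u0 add0r -prim_itv//; last exact: Ibl_meas Iv.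
  apply: eq_Rintegral => s; rewrite inE/= in_itv/= => /andP[s0 sr]; apply: vE'.
  by have /andP[_ r1] := r01; rewrite s0 (le_trans sr).
exists (v 0).
  by rewrite -prim1// -uE' ?u1// ler01 lexx.
have [N [mN N0 sub]] := xu; have [N' [mN' N0' sub']] := ae01_itv uE'.
exists (N `|` N'); split; [exact: measurableU| |].
  by apply: null_set_setU.
move=> t /= h; apply: contrapT => /not_orP[tN tN'].
apply: h => _.
have -> : x t = u t by apply: contrapT => h; apply: tN; apply: sub => /= /(_ Logic.I).
by apply: contrapT => h; apply: tN'; apply: sub' => /= /(_ Logic.I).
Qed.

(** For the solution u of - u'' = l with Dirichlet conditions, <u, l> is the integral
    of (u')^2, and u' is - L up to the constant that makes its mean 0. So the left-hand
    side is the variance of L under the uniform law, which its second moment bounds. *)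
Lemma Qvar_le l (L0 : R) (L : R -> R) : Ibl nu (fun t => L t ^+ 2) ->
  measurable_fun setT L ->
  (forall r, 0 <= r <= 1 -> L r = L0 + prim l r) ->
  Qvar l <= \int[nu]_t (L t ^+ 2).
Proof.
move=> IL2 mL LE.
have I0 : 0 <= \int[nu]_t (L t ^+ 2) by apply: Rintegral_ge0 => t _; exact: sqr_ge0.
rewrite /Qvar /covQ L2_dotZl /invA; case: xgetP => [x _|_]; last first.
  by rewrite L2_dot0l mulr0.
move=> /A_graphE[b b0 xE].
have Ib := Ibl_slope b l; have Il := Ibl_L2 l.
pose p := prim l.
have Ip : Ibl nu p := Ibl_primL2 l.
have mp := Ibl_meas Ip.
have Lp : L = (fun t => L0 + p t) %[ae nu] by exact: ae01_itv.
have Ip2 : Ibl nu (fun t => p t ^+ 2).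
  apply: (@Ibl_le _ _ _ nu (fun t => 2 * (L0 + p t) ^+ 2 + 2 * L0 ^+ 2)).
  - exact: measurable_funX.
  - apply: IblD; last exact: Ibl01_cst.
    apply: IblZ; apply: (Ibl_ae _ _ IL2); last by apply: ae01_imp Lp => t ->.
    by apply: measurable_funX; exact: measurable_funD.
  - move=> t; rewrite !ger0_norm ?sqr_ge0//; last first.
      by move: (p t) => q; have := sqr_ge0 (L0 + q); have := sqr_ge0 L0; lra.
    by move: (p t) => q; have := sqr_ge0 (2 * L0 + q); lra.
have -> : \int[nu]_t (L t ^+ 2) = \int[nu]_t ((L0 + p t) ^+ 2).
  apply: Rint_ae; [exact: measurable_funX|by apply: measurable_funX; exact: measurable_funD|].
  by apply: ae01_imp Lp => t ->.
have -> : <<x, l>> = - \int[nu]_t ((b - 2 * p t) * p t).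
  rewrite (L2_dot_ae _ _ xE); last exact: prim_meas.
  have := prim_ibp Ib Il; rewrite b0 mulr0 => /eqP; rewrite addr_eq0 => /eqP <-.
  by apply: eq_Rintegral => t _; rewrite mulrC.
set m := \int[nu]_t p t.
have Eb : b = 2 * m.
  move: b0; rewrite RintB; [|exact: Ibl01_cst|exact: IblZ].
  by rewrite RintZ// Rint01_cst -/m; lra.
have -> : \int[nu]_t ((b - 2 * p t) * p t) = b * m - 2 * \int[nu]_t (p t ^+ 2).
  rewrite /m -!RintZ// -RintB; [|exact: IblZ|exact: IblZ].
  by apply: eq_Rintegral => t _; move: (p t) => q; lra.
have -> : \int[nu]_t ((L0 + p t) ^+ 2)
    = L0 ^+ 2 + (2 * L0 * m + \int[nu]_t (p t ^+ 2)).
  rewrite /m -RintZ// -RintD; [|exact: IblZ|by []].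
  rewrite -[X in X + _](Rint01_cst (L0 ^+ 2)) -RintD; [|exact: Ibl01_cst|].
    by apply: eq_Rintegral => t _; move: (p t) => q; lra.
  by apply: IblD => //; exact: IblZ.
by rewrite Eb; have := sqr_ge0 (L0 + m); move: (Rintegral _ _ _) => q; lra.
Qed.

(** The constant function 1. Integration by parts in the direction Q 1 drives the
    whole estimate, because Q 1 is positive inside the interval. *)
Definition oneH : H := mkL2 nu (cst 1).

Lemma cst_Lfun (c : R) : cst c \in Lfun nu 2%:E.
Proof. by apply: (@Lfun2_bounded _ _ _ _ `|c|) => //; rewrite leb01_setT ltry. Qed.

Lemma oneHE : (oneH : R -> R) = cst 1 %[ae nu].
Proof. exact: mkL2E (cst_Lfun 1). Qed.

Definition parab (r : R) : R := if 0 <= r <= 1 then r * (1 - r) else 0.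

Lemma parab_meas : measurable_fun setT parab.
Proof.
rewrite (_ : parab = fun r => (r * (1 - r)) * \1_(`[0%R, 1%R]%classic : set R) r).
  apply: measurable_funM.
    by apply: measurable_funM => //; exact: measurable_funB.
  by apply: measurable_indic; exact: measurable_itv.
apply/funext => r; rewrite /parab indicE; case: ifP => h.
  by rewrite mem_set ?mulr1//= in_itv.
by rewrite memNset ?mulr0//= in_itv/= h.
Qed.

Lemma parab_bounds r : 0 <= parab r <= 1.
Proof.
rewrite /parab; case: ifP => [/andP[r0 r1]|]; last by rewrite lexx ler01.
by apply/andP; split; nra.
Qed.

Lemma parab_Lfun : parab \in Lfun nu 2%:E.
Proof.
apply: (@Lfun2_bounded _ _ _ _ 1); [by rewrite leb01_setT ltry|exact: parab_meas|].
by move=> r; have /andP[a b] := parab_bounds r; rewrite ger0_norm.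
Qed.

Let prim_oneH (r : R) : 0 <= r <= 1 -> prim oneH r = r.
Proof.
move=> r01; rewrite (prim_ae r (L2_meas oneH) (measurable_cst (1 : R)) oneHE).
by rewrite prim_cst// mul1r.
Qed.

Let slope_prim (b r : R) : 0 <= r <= 1 ->
  prim (fun t => b - 2 * prim oneH t) r = b * r - r ^+ 2.
Proof.
move=> r01.
have Iid : Ibl nu (fun s : R => s).
  by apply: (Ibl_ae _ (ae01_itv prim_oneH) (Ibl_primL2 oneH)).
rewrite (@prim_ae _ _ (fun t => b + - 2 * t) r).
- rewrite primD; [|exact: Ibl01_cst|exact: IblZ].
  by rewrite primZ// prim_cst// prim_id//; lra.
- exact: Ibl_meas (Ibl_slope b oneH).
- by apply: measurable_funD => //; exact: measurable_funM.
- by apply: ae01_itv => s s01; rewrite prim_oneH// mulNr.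
Qed.

(** The parabola r (1 - r) solves the Dirichlet problem with right-hand side 1. *)
Lemma invA_one : (invA oneH : R -> R) = parab %[ae nu].
Proof.
have ex : exists x, A_graph x oneH.
  exists (mkL2 nu parab); exists (- 2 *: oneH); last first.
    by rewrite scalerA mulrNN mulVf// scale1r.
  exists parab, (fun r => 1 - 2 * r); split.
  - exact: mkL2E parab_Lfun.
  - by rewrite /parab lexx ler01 mul0r.
  - by rewrite /parab lexx ler01 subrr mulr0.
  - move=> r r01; have r01' := r01; rewrite /parab r01' lexx ler01 mul0r add0r.
    rewrite -[LHS](_ : 1 * r - r ^+ 2 = _); last lra.
    rewrite -slope_prim// -prim_itv//; last exact: Ibl_meas (Ibl_slope 1 oneH).
    apply: eq_Rintegral => s; rewrite inE/= in_itv/= => /andP[s0 sr].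
    by rewrite prim_oneH// s0 (le_trans sr)//; case/andP : r01.
  - move=> r r01; rewrite prim_itv//; last exact: (L2_meas (- 2 *: oneH)).
    rewrite (prim_ae r (L2_meas (- 2 *: oneH)) _ (L2_scaleE (- 2) oneH)); last first.
      exact: (measurable_funM (measurable_cst (- 2 : R)) (L2_meas oneH)).
    by rewrite primZ ?prim_oneH//; [lra|exact: Ibl_L2].
have /A_graphE[b b0 xE] := xgetPex 0 ex.
have Eb : b = 1.
  move: b0; rewrite -prim1; last exact: Ibl_slope.
  by rewrite slope_prim ?ler01 ?lexx//; lra.
have h : prim (fun t => b - 2 * prim oneH t) = parab %[ae nu].
  by apply: ae01_itv => r r01; rewrite slope_prim// /parab r01 Eb; lra.
have [N [mN N0 sub]] := xE; have [N' [mN' N0' sub']] := h.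
exists (N `|` N'); split; [exact: measurableU|exact: null_set_setU|].
move=> t /= hh; apply: contrapT => /not_orP[tN tN']; apply: hh => _.
transitivity (prim (fun t => b - 2 * prim oneH t) t).
  by apply: contrapT => hh; apply: tN; apply: sub => /= /(_ Logic.I).
by apply: contrapT => hh; apply: tN'; apply: sub' => /= /(_ Logic.I).
Qed.

Lemma covQ_one y : <<covQ oneH, y>> = 2^-1 * \int[nu]_r (parab r * y r).
Proof.
by rewrite /covQ L2_dotZl (L2_dot_ae (x := invA oneH) y parab_meas invA_one).
Qed.

End covariance.

(** * Averages over intervals *)

Section averages.
Variable R : realType.
Local Notation lam := (@lebesgue_measure R).
Local Notation nu := (leb01 R).
Local Notation H := (L2 (leb01 R)).
Local Notation "<< x , y >>" := (L2_dot x y).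
Implicit Types (x y z l : H) (a b c r : R).

Definition itv_ind a b : R -> R := \1_(`[a, b]%classic : set R).

Lemma itv_indE a b r : itv_ind a b r = (a <= r <= b)%R%:R.
Proof.
rewrite /itv_ind indicE; congr ((nat_of_bool _)%:R).
by apply/idP/idP; rewrite inE/= in_itv/=.
Qed.

Lemma itv_ind_meas a b : measurable_fun setT (itv_ind a b).
Proof. by apply: measurable_indic; exact: measurable_itv. Qed.

Lemma itv_ind_le1 a b r : `|itv_ind a b r| <= 1.
Proof. by rewrite itv_indE; case: (_ <= _ <= _); rewrite ?normr1 ?normr0. Qed.

Lemma itv_ind_ge0 a b r : 0 <= itv_ind a b r.
Proof. by rewrite itv_indE; case: (_ <= _ <= _). Qed.

Lemma itv_ind_Lfun a b : itv_ind a b \in Lfun nu 2%:E.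
Proof.
apply: (@Lfun2_bounded _ _ _ _ 1); [by rewrite leb01_setT ltry|exact: itv_ind_meas|].
exact: itv_ind_le1.
Qed.

(** The vector whose inner product with z is the average of z over [a, b]. *)
Definition avg a b : H := (b - a)^-1 *: mkL2 nu (itv_ind a b).

Lemma dot_avg z a b : <<z, avg a b>> = (b - a)^-1 * \int[nu]_r (itv_ind a b r * z r).
Proof. by rewrite /avg L2_dotZr L2_dotC dot_mkL2//; exact: itv_ind_Lfun. Qed.

Lemma Ibl_itv z a b : Ibl nu (fun r => itv_ind a b r * z r).
Proof.
apply: (Ibl_le _ (Ibl_L2 z)).
  by apply: measurable_funM; [exact: itv_ind_meas|exact: L2_meas].
by move=> r; rewrite normrM ler_piMl// itv_ind_le1.
Qed.

Lemma Rint_itv_len a b : 0 <= a -> b <= 1 -> a <= b ->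
  \int[nu]_r itv_ind a b r = b - a.
Proof.
move=> a0 b1 ab; rewrite (_ : (fun r => _) = (fun r => 1 * itv_ind a b r)); last first.
  by apply/funext => r; rewrite mul1r.
rewrite -Rint01_itv// Rintegral_cst; last exact: measurable_itv.
have e : lam (`[a, b]%classic : set R) = (b - a)%:E.
  rewrite lebesgue_measure_itv/= lte_fin; case: ltP => rr; first by rewrite -EFinB.
  by congr EFin; lra.
by transitivity (1 * fine (lam (`[a, b]%classic : set R))); [|rewrite e mul1r].
Qed.

Lemma itv_ind_split a b c r : a < c -> c < b -> r != c ->
  itv_ind a b r = itv_ind a c r + itv_ind c b r.
Proof.
move=> ac cb rc; rewrite !itv_indE.
by case: (ltgtP r c) rc => // rc _; rewrite ?(ltW rc)/= ?(lt_le_trans ac (ltW rc))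
  ?andbF ?andbT ?addr0 ?add0r//; [rewrite (le_trans (ltW rc) (ltW cb)) andbT|
  rewrite (le_trans (ltW ac) (ltW rc))].
Qed.

Lemma avg_split z a b c : 0 <= a -> b <= 1 -> a < b -> c = (a + b) / 2 ->
  <<z, avg a b>> = 2^-1 * (<<z, avg a c>> + <<z, avg c b>>).
Proof.
move=> a0 b1 ab cE; rewrite !dot_avg.
have ac : a < c by lra.
have cb : c < b by lra.
have -> : \int[nu]_r (itv_ind a b r * z r)
    = \int[nu]_r (itv_ind a c r * z r) + \int[nu]_r (itv_ind c b r * z r).
  rewrite -RintD; [|exact: Ibl_itv|exact: Ibl_itv].
  apply: Rint_ae.
  - exact: Ibl_meas (Ibl_itv z a b).
  - exact: Ibl_meas (IblD (Ibl_itv z a c) (Ibl_itv z c b)).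
  - exists ([set c] : set R); split; first exact: measurable_set1.
      apply: (@subset_measure0 _ _ _ lam _ [set c]); first exact: measurableI.
        exact: measurable_set1.
        by move=> x [].
      exact: lebesgue_measure_set1.
    move=> x /= h; apply: contrapT => xc; apply: h => _.
    by rewrite (itv_ind_split ac cb) ?mulrDl//; apply/eqP.
have -> : c - a = (b - a) / 2 by lra.
have -> : b - c = (b - a) / 2 by lra.
have ba : (b - a) != 0 by rewrite gt_eqF// subr_gt0.
rewrite invfM invrK -mulrDr mulrA; congr (_ * _).
by rewrite [_ * 2]mulrC mulrA mulVf// mul1r.
Qed.

Lemma avg_ge (c a b : R) (g : R -> R) : 0 <= a -> b <= 1 -> a < b ->
  measurable_fun setT g -> (forall r, `|g r| <= 1) ->
  (forall r, a <= r <= b -> c <= g r) ->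
  c <= (b - a)^-1 * \int[nu]_r (g r * itv_ind a b r).
Proof.
move=> a0 b1 ab mg g1 cg; have ba : 0 < b - a by rewrite subr_gt0.
rewrite mulrC ler_pdivlMr//.
rewrite -(Rint_itv_len a0 b1 (ltW ab)) -RintZ; last first.
  by apply: (@Ibl01_bounded _ 1); [exact: itv_ind_meas|exact: itv_ind_le1].
apply: Rint_le.
- apply: IblZ; apply: (@Ibl01_bounded _ 1); [exact: itv_ind_meas|exact: itv_ind_le1].
- apply: (@Ibl01_bounded _ 1); first by apply: measurable_funM => //; exact: itv_ind_meas.
  by move=> r; rewrite normrM mulr_ile1// itv_ind_le1.
- move=> r; rewrite itv_indE; case: (boolP (a <= r <= b)) => h; rewrite ?mulr0//.
  by rewrite !mulr1; exact: cg.
Qed.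

Definition ramp a b r : R := Num.max 0 (Num.min b r - a) / (b - a).

Lemma ramp01 a b r : a < b -> 0 <= ramp a b r <= 1.
Proof.
move=> ab; have ba : 0 < b - a by rewrite subr_gt0.
rewrite /ramp divr_ge0 ?le_max ?lexx//= ?(ltW ba)//.
rewrite ler_pdivrMr// mul1r ge_max (ltW ba)/= lerD2r.
by rewrite ge_min lexx.
Qed.

Lemma ramp_left a b r : a < b -> r <= a -> ramp a b r = 0.
Proof.
move=> ab ra; rewrite /ramp (_ : Num.max _ _ = 0) ?mul0r//.
by apply/max_idPl; rewrite subr_le0 ge_min ra orbT.
Qed.

Lemma ramp_right a b r : a < b -> b <= r -> ramp a b r = 1.
Proof.
move=> ab br; have ba : 0 < b - a by rewrite subr_gt0.
rewrite /ramp (_ : Num.min b r = b); last exact/min_idPl.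
by rewrite (_ : Num.max 0 (b - a) = b - a) ?divff ?gt_eqF//; apply/max_idPr; exact: ltW.
Qed.

Lemma ramp_meas a b : measurable_fun setT (ramp a b).
Proof.
apply: measurable_funM => //; apply: measurable_maxr => //.
by apply: measurable_funB => //; exact: measurable_minr.
Qed.

Lemma prim_avg a b r : 0 <= a -> a < b -> b <= 1 -> 0 <= r <= 1 ->
  prim (avg a b) r = ramp a b r.
Proof.
move=> a0 ab b1 r01; have /andP[r0 r1] := r01.
have mI := itv_ind_meas a b.
have E : (avg a b : R -> R) = (fun t => (b - a)^-1 * itv_ind a b t) %[ae nu].
  have [N [mN N0 sub]] := L2_scaleE (b - a)^-1 (mkL2 nu (itv_ind a b)).
  have [N' [mN' N0' sub']] := mkL2E (itv_ind_Lfun a b).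
  exists (N `|` N'); split; [exact: measurableU|exact: null_set_setU|].
  move=> t /= h; apply: contrapT => /not_orP[tN tN']; apply: h => _.
  have -> : avg a b t = (b - a)^-1 * mkL2 nu (itv_ind a b) t.
    by apply: contrapT => h; apply: tN; apply: sub => /= /(_ Logic.I).
  congr (_ * _).
  by apply: contrapT => h; apply: tN'; apply: sub' => /= /(_ Logic.I).
rewrite (prim_ae r (L2_meas (avg a b)) _ E); last exact: measurable_funM.
have II : Ibl nu (itv_ind a b).
  by apply: (@Ibl01_bounded _ 1) => //; exact: itv_ind_le1.
rewrite primZ// /ramp mulrC; congr (_ / _).
have Es s : itv_ind a b s * (s <= r)%R%:R = itv_ind a (Num.min b r) s.
  rewrite !itv_indE le_min andbA; case: (s <= r); first by rewrite mulr1 andbT.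
  by rewrite mulr0 andbF.
rewrite /prim; under eq_Rintegral do rewrite Es.
have [h|h] := leP a (Num.min b r).
  rewrite Rint_itv_len//; last by rewrite ge_min b1.
  by apply/esym/max_idPr; rewrite subr_ge0.
transitivity (\int[nu]_s (0 : R)).
  apply: eq_Rintegral => s _; rewrite itv_indE.
  by case: (boolP (a <= s <= _)) => // /andP[h1 h2]; have := le_trans h1 h2; rewrite leNgt h.
by rewrite Rint0; apply/esym/max_idPl; rewrite subr_le0 ltW.
Qed.

Lemma prim_subE x y r : prim (x - y) r = prim x r - prim y r.
Proof.
have E : (x - y : R -> R) = (fun t => x t + -1 * y t) %[ae nu].
  have [N [mN N0 sub]] := L2_addE x (- y).
  have [N' [mN' N0' sub']] := L2_oppE y.
  exists (N `|` N'); split; [exact: measurableU|exact: null_set_setU|].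
  move=> t /= h; apply: contrapT => /not_orP[tN tN']; apply: h => _.
  have -> : (x - y) t = x t + (- y) t.
    by apply: contrapT => h; apply: tN; apply: sub => /= /(_ Logic.I).
  congr (_ + _); rewrite mulN1r.
  by apply: contrapT => h; apply: tN'; apply: sub' => /= /(_ Logic.I).
have Iy := IblZ (- 1) (Ibl_L2 y).
rewrite (prim_ae r (L2_meas (x - y)) _ E); last exact: Ibl_meas (IblD (Ibl_L2 x) Iy).
by rewrite primD//; [rewrite primZ ?mulN1r//; exact: Ibl_L2|exact: Ibl_L2].
Qed.

(** The square of such a primitive L is at most the indicator of [a, b]. *)
Lemma Qvar_supp l (L0 a b : R) (L : R -> R) : 0 <= a -> b <= 1 -> a <= b ->
  measurable_fun setT L -> (forall r, 0 <= r <= 1 -> L r = L0 + prim l r) ->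
  (forall r, `|L r| <= 1) -> (forall r, ~~ (a <= r <= b) -> L r = 0) ->
  Qvar l <= b - a.
Proof.
move=> a0 b1 ab mL LE L1 L0'.
have I2 : Ibl nu (fun t => L t ^+ 2).
  apply: (@Ibl01_bounded _ 1); first exact: measurable_funX.
  by move=> t; rewrite normrX exprn_ile1.
apply: le_trans (Qvar_le I2 mL LE) _.
rewrite -(Rint_itv_len a0 b1 ab); apply: Rint_le => //.
  by apply: (@Ibl01_bounded _ 1); [exact: itv_ind_meas|exact: itv_ind_le1].
move=> r; rewrite itv_indE; case: (boolP (a <= r <= b)) => h.
  by rewrite -[L r ^+ 2]ger0_norm ?sqr_ge0// normrX exprn_ile1.
by rewrite L0'// expr0n.
Qed.

(** The primitive is the tent with basis [a, b]. Averages over the two halves of an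
    interval thus differ by about the square root of its length, as for a Brownian
    path. *)
Lemma Qvar_avg_diff a b c : 0 <= a -> b <= 1 -> a < b -> c = (a + b) / 2 ->
  Qvar (avg a c - avg c b) <= b - a.
Proof.
move=> a0 b1 ab cE; have ac : a < c by lra.
have cb : c < b by lra.
apply: (@Qvar_supp _ 0 a b (fun r => ramp a c r - ramp c b r)) => //; first exact: ltW.
- by apply: measurable_funB; exact: ramp_meas.
- by move=> r r01; rewrite add0r prim_subE !prim_avg//; lra.
- move=> r; rewrite ler_norml.
  have /andP[h1 h2] := ramp01 r ac; have /andP[h3 h4] := ramp01 r cb.
  by apply/andP; split; lra.
- move=> r; rewrite negb_and -!ltNge => /orP[h|h].
    by rewrite !ramp_left ?subrr//; lra.
  by rewrite !ramp_right ?subrr//; lra.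
Qed.

(** Shifted by - 1, the primitive vanishes to the right of b; the bound reflects the
    Dirichlet condition at 0. *)
Lemma Qvar_avg_left a b : 0 <= a -> a < b -> b <= 1 -> Qvar (avg a b) <= b.
Proof.
move=> a0 ab b1; rewrite -[leRHS]subr0.
apply: (@Qvar_supp _ (-1) 0 b (fun r => if 0 <= r then -1 + ramp a b r else 0)) => //.
- exact: le_trans (ltW ab).
- apply: measurable_fun_ifT => //.
    by apply: measurable_fun_ler => //; exact: measurable_cst.
  by apply: measurable_funD => //; exact: ramp_meas.
- by move=> r r01; have /andP[-> _] := r01; rewrite prim_avg.
- move=> r; case: ifP => _; last by rewrite normr0.
  rewrite ler_norml; have /andP[h1 h2] := ramp01 r ab.
  by apply/andP; split; lra.
- move=> r; rewrite negb_and -!ltNge => /orP[h|h].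
    by rewrite leNgt h.
  by rewrite ramp_right ?addNr ?if_same// ltW.
Qed.

(** The primitive vanishes to the left of a; the bound reflects the Dirichlet
    condition at 1. *)
Lemma Qvar_avg_right a b : 0 <= a -> a < b -> b <= 1 -> Qvar (avg a b) <= 1 - a.
Proof.
move=> a0 ab b1.
apply: (@Qvar_supp _ 0 a 1 (fun r => if r <= 1 then ramp a b r else 0)) => //.
- exact: le_trans (ltW ab) b1.
- apply: measurable_fun_ifT => //; last exact: ramp_meas.
  by apply: measurable_fun_ler => //; exact: measurable_cst.
- by move=> r r01; have /andP[_ ->] := r01; rewrite add0r prim_avg.
- move=> r; case: ifP => _; last by rewrite normr0.
  by have /andP[h1 h2] := ramp01 r ab; rewrite ger0_norm.
- move=> r; rewrite negb_and -!ltNge => /orP[h|h].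
    by rewrite ramp_left ?if_same// ltW.
  by rewrite leNgt h.
Qed.

Lemma covQ_one_avg (c a b : R) : 0 <= a -> b <= 1 -> a < b ->
  (forall r, a <= r <= b -> c <= parab r) ->
  c / 2 <= <<covQ (oneH R), avg a b>>.
Proof.
move=> a0 b1 ab hc.
have ba : (b - a) != 0 by rewrite gt_eqF// subr_gt0.
rewrite covQ_one [c / 2]mulrC ler_pM2l ?invr_gt0//.
have -> : \int[nu]_r (parab r * avg a b r) = <<mkL2 nu (@parab R), avg a b>>.
  by rewrite dot_mkL2//; exact: parab_Lfun.
rewrite /avg L2_dotZr dot_mkL2_2; [|exact: parab_Lfun|exact: itv_ind_Lfun].
apply: avg_ge => //; first exact: parab_meas.
by move=> r; have /andP[h1 h2] := parab_bounds r; rewrite ger0_norm.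
Qed.

End averages.

(** * Dyadic chaining for the averages *)

Section union_bound.
Context d (T : measurableType d) (R : realType) (mu : probability T R).

Lemma union_bound (I : Type) (s : seq I) (A : set T) (B : I -> set T) :
  measurable A -> (forall i, measurable (B i)) ->
  (forall z, A z -> 1 <= \sum_(i <- s) (\1_(B i) z : R)) ->
  fine (mu A) <= \sum_(i <- s) fine (mu (B i)).
Proof.
move=> mA mB AB; rewrite -Rint_indic//.
have -> : \sum_(i <- s) fine (mu (B i)) = \int[mu]_z (\sum_(i <- s) (\1_(B i) z : R)).
  rewrite Rint_sum; last by move=> i; exact: Ibl_indic.
  by apply: eq_bigr => i _; rewrite Rint_indic.
apply: Rint_le; first exact: Ibl_indic.
  by apply: Ibl_sum => i; exact: Ibl_indic.
move=> z; rewrite indicE; case: (boolP (z \in A)) => zA.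
  by apply: AB; exact: set_mem.
by apply: sumr_ge0 => i _; rewrite indicE.
Qed.

End union_bound.

Section algebra.
Variable R : realFieldType.
Implicit Types x y w c e t : R.

Lemma half_diff x y w : x = 2^-1 * (y + w) ->
  y = x + 2^-1 * (y - w) /\ w = x - 2^-1 * (y - w).
Proof. by move=> ->; split; lra. Qed.

Lemma lt_incrl c e t d : c + d < - (t + e) -> - t <= c -> e < - d.
Proof. lra. Qed.

Lemma lt_incrr c e t d : c - d < - (t + e) -> - t <= c -> e < d.
Proof. lra. Qed.

Lemma sqr_half x : 2^-1 * x * (2^-1 * x) = 4^-1 * (x * x).
Proof. lra. Qed.

Lemma lt_half x t : x < - (t * (1 - 1 / 2)) -> t / 2 < - x.
Proof. lra. Qed.

Lemma tail_algebra (C l X Y A P : R) : X ^+ 4 = X * Y ->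
  C * (l / X / 4) ^+ 4 / (A ^+ 4 * P / 10 ^+ 8)
  = C * (25 / A) ^+ 4 * l ^+ 4 * (1 / X * (1 / (Y * P))).
Proof.
move=> XY.
have -> : (l / X / 4) ^+ 4 = l ^+ 4 * X^-1 ^+ 4 * 4^-1 ^+ 4.
  by move: X^-1 => x; lra.
rewrite invf_div (invfM (A ^+ 4) P) -(exprVn A 4) (exprVn X 4) XY (invfM X Y) (invfM Y P).
by move: X^-1 Y^-1 A^-1 P^-1 => x y u v; lra.
Qed.

Lemma exp2_4 : 2 ^+ 4 = 2 * 8 :> R. Proof. lra. Qed.

Lemma tail_mono (C v w x : R) : 0 <= C -> 0 <= v -> v <= w -> 0 < x ->
  C * v ^+ 4 / x ^+ 8 <= C * w ^+ 4 / x ^+ 8.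
Proof.
move=> C0 v0 vw x0; rewrite ler_pM2r ?invr_gt0 ?exprn_gt0// ler_wpM2l//.
by rewrite lerXn2r// nnegrE// (le_trans v0 vw).
Qed.

Lemma base_algebra (C l b : R) :
  C * (2 * l) ^+ 4 / b ^+ 8 = C * (2 / b ^+ 2) ^+ 4 * l ^+ 4.
Proof.
by rewrite (exprM b 2 4) -(exprVn (b ^+ 2) 4); move: (b ^+ 2)^-1 => x; lra.
Qed.

End algebra.

Section chaining.
Variables (R : realType) (mu : probability (L2 (leb01 R)) R).
Hypothesis gm : gaussian_measure mu 0 (@covQ R).
Local Notation H := (L2 (leb01 R)).
Local Notation "<< x , y >>" := (L2_dot x y).
Implicit Types (z l : H).

(** Subdivision points of the block [a, a + len] into 2^n equal pieces. *)
Definition pt (a len : R) (n i : nat) : R := a + len * (i%:R / 2 ^+ n).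

Definition piece (a len : R) n i : H := avg (pt a len n i) (pt a len n i.+1).

Lemma pt_double a len n i : pt a len n.+1 i.*2 = pt a len n i.
Proof.
rewrite /pt -mul2n natrM exprS invfM; congr (_ + _ * _).
have h : 2 * 2^-1 = 1 :> R by rewrite divff.
move: (2^-1) h => t h; move: (_^-1) (i%:R) => u v.
by rewrite (_ : 2 * v * (t * u) = (2 * t) * (v * u)); [rewrite h mul1r|lra].
Qed.

Lemma pt_step a len n i : pt a len n i.+1 - pt a len n i = len / 2 ^+ n.
Proof. by rewrite /pt -natr1; move: (_^-1) (i%:R) => u v; lra. Qed.

Lemma pt_in a len n i : 0 <= len -> (i <= 2 ^ n)%N ->
  a <= pt a len n i <= a + len.
Proof.
move=> len0 hi; rewrite /pt lerDl lerD2l.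
have n0 : 0 < 2 ^+ n :> R by rewrite exprn_gt0.
rewrite mulr_ge0 ?divr_ge0 ?(ltW n0)//= ler_piMr// ler_pdivrMr// mul1r.
by rewrite -natrX ler_nat.
Qed.

Lemma pt_lt a len n i : 0 < len -> pt a len n i < pt a len n i.+1.
Proof. by move=> len0; rewrite -subr_gt0 pt_step divr_gt0// exprn_gt0. Qed.

Section block.
Variables (a len : R).
Hypotheses (a0 : 0 <= a) (len0 : 0 < len) (al1 : a + len <= 1).
Local Notation J n i := (piece a len n i).
Local Notation C := (pdf8_cst R).

Let C0 : 0 <= C. Proof. by rewrite /pdf8_cst; lra. Qed.

Let pt0 n i : (i <= 2 ^ n)%N -> 0 <= pt a len n i <= 1.
Proof.
move=> hi; have /andP[h1 h2] := pt_in a (ltW len0) hi.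
by rewrite (le_trans a0 h1) (le_trans h2 al1).
Qed.

(** The two children of a piece have averages <z, piece> + <z, incr> and <z, piece>
    - <z, incr>. *)
Definition incr n i : H := 2^-1 *: (J n.+1 i.*2 - J n.+1 i.*2.+1).

Let ltn_double n i : (i < 2 ^ n)%N -> (i.*2.+1 < 2 ^ n.+1)%N.
Proof. by move=> h; rewrite expnS mul2n -doubleS -leq_double in h *. Qed.

Let mid n i : pt a len n.+1 i.*2.+1 = (pt a len n i + pt a len n i.+1) / 2.
Proof.
rewrite -!(pt_double _ _ n) doubleS.
by rewrite /pt -[i.*2.+2%:R]natr1 -[i.*2.+1%:R]natr1; move: (_^-1) (_%:R) => u v; lra.
Qed.

Lemma piece_child z n i : (i < 2 ^ n)%N ->
  <<z, J n.+1 i.*2>> = <<z, J n i>> + <<z, incr n i>> /\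
  <<z, J n.+1 i.*2.+1>> = <<z, J n i>> - <<z, incr n i>>.
Proof.
move=> hi.
have /andP[p0 _] := pt0 (ltnW hi); have /andP[_ p1] := pt0 hi.
have := @avg_split R z _ _ _ p0 p1 (pt_lt a n i len0) (mid n i).
rewrite -/(J n i) -[in X in avg X _](pt_double a len n i) -/(J n.+1 i.*2).
rewrite -[in X in avg _ X](pt_double a len n i.+1) doubleS -/(J n.+1 i.*2.+1).
have -> : <<z, incr n i>> = 2^-1 * (<<z, J n.+1 i.*2>> - <<z, J n.+1 i.*2.+1>>).
  rewrite /incr (L2_dotZr 2^-1 (J n.+1 i.*2 - J n.+1 i.*2.+1) z).
  by rewrite (L2_dotBr (J n.+1 i.*2) (J n.+1 i.*2.+1) z).
exact: half_diff.
Qed.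

Lemma Qvar_incr n i : (i < 2 ^ n)%N -> Qvar (incr n i) <= len / 2 ^+ n / 4.
Proof.
move=> hi.
have /andP[p0 _] := pt0 (ltnW hi); have /andP[_ p1] := pt0 hi.
have := @Qvar_avg_diff R _ _ _ p0 p1 (pt_lt a n i len0) (mid n i).
rewrite pt_step.
have -> : avg (pt a len n i) (pt a len n.+1 i.*2.+1) = J n.+1 i.*2.
  by rewrite -[pt a len n i]pt_double.
have -> : avg (pt a len n.+1 i.*2.+1) (pt a len n i.+1) = J n.+1 i.*2.+1.
  by rewrite -[pt a len n i.+1]pt_double doubleS.
move=> h; rewrite /incr.
have -> : Qvar (2^-1 *: (J n.+1 i.*2 - J n.+1 i.*2.+1))
    = 4^-1 * Qvar (J n.+1 i.*2 - J n.+1 i.*2.+1).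
  rewrite /Qvar -!(cov_gauss gm) -RintZ; last exact: (integrable_gaussM gm).
  apply: eq_Rintegral => z _; rewrite (L2_dotZr 2^-1 (J n.+1 i.*2 - J n.+1 i.*2.+1) z).
  exact: sqr_half.
by rewrite mulrC ler_pM2r ?invr_gt0.
Qed.

Definition low n (thr : R) : set H :=
  [set z | exists2 i, (i < 2 ^ n)%N & <<z, J n i>> < - thr].

Lemma mlt_dot l (t : R) : measurable [set z : H | <<z, l>> < t].
Proof.
have := (measurable_L2_dotr l) measurableT _ (measurable_itv `]-oo, t[%R).
by rewrite setTI; congr (measurable _); apply/seteqP; split => z /=; rewrite in_itv.
Qed.

Lemma mgt_absdot l (t : R) : measurable [set z : H | t < `|<<z, l>>|].
Proof.
have mn : measurable_fun setT (fun z => `|<<z, l>>|).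
  by apply: measurableT_comp => //; exact: measurable_L2_dotr.
have := mn measurableT _ (measurable_itv `]t, +oo[%R); rewrite setTI.
by congr (measurable _); apply/seteqP; split => z /=; rewrite in_itv/= andbT.
Qed.

Lemma measurable_low n thr : measurable (low n thr).
Proof.
rewrite (_ : low n thr = \bigcup_(i in [set i | (i < 2 ^ n)%N]) [set z | <<z, J n i>> < - thr]).
  by apply: bigcup_measurable => i _; exact: mlt_dot.
by apply/seteqP; split => z [i hi hz]; exists i.
Qed.

Lemma low_le n thr thr' : thr <= thr' -> low n thr' `<=` low n thr.
Proof. by move=> h z [i hi hz]; exists i => //; apply: lt_le_trans hz _; rewrite lerN2. Qed.

(** If a piece of generation n + 1 is below - (thr + e) and its parent is not below
    - thr, the increment between them exceeds e. *)
Lemma low_step n (thr e : R) : 0 <= e ->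
  fine (mu (low n.+1 (thr + e))) <= fine (mu (low n thr))
    + \sum_(0 <= i < 2 ^ n) fine (mu [set z | e < `|<<z, incr n i>>|]).
Proof.
move=> e0.
pose B (o : option nat) := if o is Some i then [set z | e < `|<<z, incr n i>>|]
  else low n thr.
have -> : fine (mu (low n thr))
    + \sum_(0 <= i < 2 ^ n) fine (mu [set z | e < `|<<z, incr n i>>|])
    = \sum_(o <- None :: map Some (index_iota 0 (2 ^ n))) fine (mu (B o)).
  by rewrite big_cons big_map.
apply: union_bound; first exact: measurable_low.
  by case=> [i|]; [exact: mgt_absdot|exact: measurable_low].
move=> z [j hj hz]; rewrite big_cons big_map.
have S0 : 0 <= \sum_(i <- index_iota 0 (2 ^ n)) (\1_(B (Some i)) z : R).
  by apply: sumr_ge0 => i _; rewrite indicE.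
have [zl|zl] := pselect (low n thr z).
  by rewrite indicE mem_set//= lerDl.
have hi : (j./2 < 2 ^ n)%N by rewrite ltn_half_double -mul2n -expnS.
have zi : - thr <= <<z, J n j./2>>.
  by rewrite leNgt; apply/negP => h; apply: zl; exists j./2.
have [c1 c2] := piece_child z hi.
have zB : B (Some j./2) z.
  rewrite /B/=; move: hz; rewrite -{1}(odd_double_half j).
  case: (odd j) => /=; rewrite ?add0n ?add1n ?c1 ?c2 => hz.
    by apply: lt_le_trans (ler_norm _); exact: lt_incrr hz zi.
  by rewrite -normrN; apply: lt_le_trans (ler_norm _); exact: lt_incrl hz zi.
rewrite (bigD1_seq j./2)/= ?mem_index_iota ?hi ?iota_uniq//.
apply: (@le_trans _ _ (\1_(B (Some j./2)) z)); first by rewrite indicE mem_set.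
rewrite addrCA lerDl; apply: addr_ge0; first by rewrite indicE.
by apply: sumr_ge0 => i _; rewrite indicE.
Qed.

Section thresholds.
Variable al : R.
Hypothesis al0 : 0 < al.

(* The margins eps n are geometric with ratio q, start at al / 10, and sum to al /
   2. The 2^n increments of generation n have variance of order 2^-n, so their tails
   of order 8 sum to 2^n (2^-n)^4 / q^(8n) = (8 q^8)^-n up to constants: q must
   satisfy q < 1 and 8 q^8 > 1. *)
Let q : R := 4 / 5.
Let thr n : R := al * (1 - q ^+ n / 2).
Let eps n : R := al * q ^+ n / 10.

Let q0 : 0 < q. Proof. by rewrite /q; lra. Qed.

Let thrS n : thr n.+1 = thr n + eps n.
Proof. by rewrite /thr /eps exprS /q; move: (_ ^+ n) => x; lra. Qed.

Let thr_le n : thr n <= al.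
Proof.
have := exprn_gt0 n q0; rewrite /thr; move: (q ^+ n) => x x0.
by have := mulr_gt0 al0 x0; lra.
Qed.

Let eps_gt0 n : 0 < eps n.
Proof. by rewrite /eps divr_gt0// mulr_gt0// exprn_gt0. Qed.

Let theta : R := 1 / (8 * q ^+ 8).

Let theta0 : 0 <= theta. Proof. by rewrite /theta divr_ge0// mulr_ge0// exprn_ge0// ltW. Qed.

Let theta1 : theta < 1.
Proof.
rewrite /theta ltr_pdivrMr ?mul1r; last by rewrite mulr_gt0// exprn_gt0.
by rewrite /q expr_div_n; lra.
Qed.

Definition chain_cst : R := C * (2 / (al / 2) ^+ 2) ^+ 4
  + C * (25 / al ^+ 2) ^+ 4 / (1 - theta).

Let step_bound n i : (i < 2 ^ n)%N ->
  fine (mu [set z | eps n < `|<<z, incr n i>>|])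
  <= C * (25 / al ^+ 2) ^+ 4 * len ^+ 4 * (1 / 2 ^+ n * theta ^+ n).
Proof.
move=> hi; apply: le_trans (tail_gauss gm (incr n i) (eps_gt0 n)) _.
have v0 := Qvar_ge0 gm (incr n i); have v1 := Qvar_incr hi.
apply: le_trans (tail_mono C0 v0 v1 (eps_gt0 n)) _.
rewrite le_eqVlt; apply/orP; left; apply/eqP.
rewrite /eps /theta.
have al' : al != 0 by rewrite gt_eqF.
have -> : (al * q ^+ n / 10) ^+ 8 = (al ^+ 2) ^+ 4 * (q ^+ 8) ^+ n / 10 ^+ 8.
  by rewrite expr_div_n exprMn; congr (_ * _ / _); rewrite -!exprM// mulnC.
have -> : (1 / (8 * q ^+ 8)) ^+ n = 1 / (8 ^+ n * (q ^+ 8) ^+ n).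
  by rewrite -exprMn [LHS]expr_div_n expr1n.
apply: tail_algebra; rewrite -exprM mulnC exprM -exprMn.
by congr (_ ^+ n); exact: exp2_4.
Qed.

Lemma low_base : Qvar (avg a (a + len)) <= 2 * len ->
  fine (mu (low 0 (thr 0))) <= C * (2 * len) ^+ 4 / (al / 2) ^+ 8.
Proof.
move=> var0.
  apply: (@le_trans _ _ (fine (mu [set z | al / 2 < `|<<z, J 0 0>>|]))).
    rewrite -!Rint_indic; [|exact: mgt_absdot|exact: measurable_low].
    apply: Rint_le; [by apply: Ibl_indic; exact: measurable_low|
      by apply: Ibl_indic; exact: mgt_absdot|].
    move=> z; rewrite !indicE; case: (boolP (z \in low 0 (thr 0))) => // zl.
    rewrite mem_set//=; move: zl; rewrite inE => -[[|i]]//= _.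
    rewrite /thr expr0 => h; rewrite -normrN (lt_le_trans _ (ler_norm _))//.
    exact: (lt_half h).
  have a20 : 0 < al / 2 by rewrite divr_gt0.
  apply: le_trans (tail_gauss gm _ a20) _.
  have JE : J 0 0 = avg a (a + len).
    by rewrite /piece /pt expr0 invr1 !mulr1 mulr0 addr0.
  rewrite JE; exact: (tail_mono C0 (Qvar_ge0 gm _) var0 a20).
Qed.

(** Chaining over the generations. The bound is uniform in n, and the power len^4
    makes it summable over the blocks even after division by len^3. *)
Lemma low_bound n : Qvar (avg a (a + len)) <= 2 * len ->
  fine (mu (low n al)) <= chain_cst * len ^+ 4.
Proof.
move=> var0; have base := low_base var0; clear var0.
pose K := C * (25 / al ^+ 2) ^+ 4 * len ^+ 4.
have l4 : 0 <= len ^+ 4 by rewrite exprn_ge0// ltW.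
have K0 : 0 <= K.
  rewrite /K; apply: mulr_ge0 => //; apply: mulr_ge0 => //.
  by rewrite exprn_ge0// divr_ge0// sqr_ge0.
have main : fine (mu (low n (thr n)))
    <= C * (2 * len) ^+ 4 / (al / 2) ^+ 8 + K * \sum_(0 <= m < n) theta ^+ m.
  elim: n => [|m IH].
    by rewrite big_geq// mulr0 addr0.
  rewrite thrS; apply: le_trans (low_step m _ (ltW (eps_gt0 m))) _.
  rewrite big_nat_recr//= mulrDr addrA; apply: lerD => //.
  apply: (@le_trans _ _ (\sum_(0 <= i < 2 ^ m) K * (1 / 2 ^+ m * theta ^+ m))).
    rewrite big_nat [leRHS]big_nat; apply: ler_sum => i /andP[_ hi].
    exact: step_bound.
  rewrite sumr_const_nat subn0 -[_ *+ (2 ^ m)%N]mulr_natr natrX.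
  have n2 : 2 ^+ m * (2 ^+ m)^-1 = 1 :> R by rewrite divff// expf_neq0.
  move: (2 ^+ m) n2 => x; move: (x^-1) (theta ^+ m) => y w xy.
  by rewrite (_ : K * (1 * y * w) * x = (x * y) * (K * w)); [rewrite xy mul1r|lra].
apply: (@le_trans _ _ (fine (mu (low n (thr n))))).
  rewrite -!Rint_indic; [|exact: measurable_low|exact: measurable_low].
  apply: Rint_le; [by apply: Ibl_indic; exact: measurable_low|
    by apply: Ibl_indic; exact: measurable_low|].
  move=> z; rewrite !indicE; case: (boolP (z \in low n al)) => // zl.
  by rewrite mem_set//=; apply: low_le (thr_le n) _ _; exact: set_mem.
apply: le_trans main _; rewrite /chain_cst [leRHS]mulrDl; apply: lerD.
  by rewrite base_algebra.
rewrite -/K [leRHS](_ : _ = K / (1 - theta)); last by rewrite /K mulrAC.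
apply: ler_wpM2l => //.
have t1 : 0 < 1 - theta by rewrite subr_gt0.
rewrite -[_^-1]mul1r ler_pdivlMr//.
suff -> : (\sum_(0 <= m < n) theta ^+ m) * (1 - theta) = 1 - theta ^+ n.
  by rewrite gerBl exprn_ge0.
elim: (n) => [|m IH]; first by rewrite big_geq// mul0r expr0 subrr.
by rewrite big_nat_recr//= mulrDl IH exprSr; move: (theta ^+ m) theta => x y; lra.
Qed.

End thresholds.
End block.
End chaining.

(** * Differentiability of the smooth approximations *)

Section soft_Cb1.
Variable R : realType.
Local Notation H := (L2 (leb01 R)).
Local Notation "<< x , y >>" := (L2_dot x y).
Implicit Types (k z h : H) (s : seq H).

Lemma is_diff_comp1 (f df : H -> R) (g : R -> R) (g' : R) z :
  is_diff z f df -> is_derive (f z) 1 g g' ->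
  is_diff z (fun x => g (f x)) (fun h => g' * df h).
Proof.
move=> fd gd.
have dg : differentiable g (f z) by apply/derivable1_diffP; case: gd.
have gdiff : is_diff (f z) g (fun h : R => h * g').
  apply: DiffDef => //; rewrite diff1E//; apply/funext => h.
  by rewrite derive1E derive_val.
have := @is_diff_comp _ _ _ _ _ _ _ _ _ fd gdiff.
by move/is_diff_eq; apply; apply/funext => h /=; rewrite mulrC.
Qed.

Lemma is_diff_sum_seq s (F dF : H -> H -> R) z :
  (forall k, is_diff z (F k) (dF k)) ->
  is_diff z (fun x => \sum_(k <- s) F k x) (fun h => \sum_(k <- s) dF k h).
Proof.
move=> dd; elim: s => [|k s IH].
  under eq_fun do rewrite big_nil; under [X in is_diff _ _ X]eq_fun do rewrite big_nil.
  exact: (is_diff_cst 0 z).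
have -> : (fun x => \sum_(j <- k :: s) F j x) = F k + (fun x => \sum_(j <- s) F j x).
  by apply/funext => x; rewrite big_cons.
have -> : (fun x => \sum_(j <- k :: s) dF j x) = dF k + (fun x => \sum_(j <- s) dF j x).
  by apply/funext => x; rewrite big_cons.
exact: is_diffD.
Qed.

Lemma continuous_sum_seq s (F : H -> H -> H) : (forall k, continuous (F k)) ->
  continuous (fun z => \sum_(k <- s) F k z).
Proof.
move=> cF; elim: s => [|k s IH].
  have -> : (fun z => \sum_(k <- [::]) F k z) = cst 0.
    by apply/funext => z; rewrite big_nil.
  by move=> z; exact: cst_continuous.
have -> : (fun z => \sum_(j <- k :: s) F j z) = F k + (fun z => \sum_(j <- s) F j z).
  by apply/funext => z; rewrite big_cons.
by move=> z; apply: continuousD; [exact: cF|exact: IH].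
Qed.

Lemma gradient_eq (phi : H -> R) z g : is_diff z phi (L2_dot g) -> gradient phi z = g.
Proof.
move=> dg; rewrite /gradient; case: xgetP => [g' _ dg'|/(_ g)//].
apply: L2_dot_inj => y.
have e1 := @diff_val _ _ _ _ _ _ _ dg; have e2 := @diff_val _ _ _ _ _ _ _ dg'.
by rewrite -e1 -e2.
Qed.

Variables (kap beta : R).
Hypothesis kap0 : 0 <= kap.
Local Notation w := (wgt kap beta).
Local Notation phi := (soft kap beta).

Definition soft_grad s z : H := \sum_(k <- s) (phi s z * (w <<z, k>> * kap)) *: k.

Lemma dot_soft_grad s z y :
  <<soft_grad s z, y>> = phi s z * \sum_(k <- s) w <<z, k>> * (kap * <<k, y>>).
Proof.
rewrite /soft_grad L2_dot_suml mulr_sumr; apply: eq_bigr => k _.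
by rewrite (L2_dotZl _ k y) !mulrA.
Qed.

Let is_diff_dotr k z : is_diff z (fun x => <<x, k>>) (L2_dot k).
Proof.
have -> : (fun x => <<x, k>>) = L2_dot k by apply/funext => x; exact: L2_dotC.
exact: is_diff_L2_dot.
Qed.

Let is_diff_wgt k z :
  is_diff z (fun x => w <<x, k>>) (fun h => - (kap * w <<z, k>>) * <<k, h>>).
Proof.
apply: (is_diff_comp1 (is_diff_dotr k z)).
apply: is_derive_eq_val.
by rewrite /wgt /GRing.scale/= mulrDr; move: (expR _) => e; lra.
Qed.

Lemma is_diff_soft s z : is_diff z (phi s) (L2_dot (soft_grad s z)).
Proof.
have d1 k := is_diff_wgt k z.
have d2 := is_diff_sum_seq s d1.
have d3 : is_derive (\sum_(k <- s) w <<z, k>>) 1 (fun y => expR (- y)) (- phi s z).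
  by apply: is_derive_eq_val; rewrite /GRing.scale/= /soft; lra.
have := is_diff_comp1 d2 d3.
move/is_diff_eq; apply; apply/funext => h; rewrite dot_soft_grad mulNr -mulrN -sumrN.
by congr (_ * _); apply: eq_bigr => k _; rewrite mulNr opprK mulrAC mulrC mulrA.
Qed.

Let cw k : continuous (fun z => w <<z, k>>).
Proof.
by move=> z; apply: differentiable_continuous; case: (is_diff_wgt k z).
Qed.

Lemma soft_continuous s : continuous (phi s).
Proof.
by move=> z; apply: differentiable_continuous; case: (is_diff_soft s z).
Qed.

Lemma soft_meas s : measurable_fun setT (phi s).
Proof. by apply: continuous_L2_meas; exact: soft_continuous. Qed.

Lemma wgt_meas k : measurable_fun setT (fun z => w <<z, k>>).
Proof.
apply: continuous_L2_meas => z; apply: differentiable_continuous.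
by case: (is_diff_wgt k z).
Qed.

(** The gradient is bounded by expR_sumN_bound, with the norms of the vectors k as
    coefficients. *)
Lemma Cb1_soft s : Cb1 (phi s).
Proof.
have gE : gradient (phi s) = soft_grad s.
  by apply/funext => z; apply: gradient_eq; exact: is_diff_soft.
split.
- exists 1; split; first exact: num_real.
  move=> y y1 z _; apply: le_trans (ltW y1).
  by rewrite ger0_norm ?soft_ge0// soft_le1.
- by move=> z; rewrite gE; exact: is_diff_soft.
- rewrite gE; apply: continuous_sum_seq => k z.
  apply: (@continuousZr_tmp R H H (fun z => phi s z * (w <<z, k>> * kap)) k z).
  apply: continuousM; first exact: soft_continuous.
  by apply: continuousM; [exact: cw|exact: cst_continuous].
- rewrite gE; exists (\sum_(k <- s) kap * `|k|); split; first exact: num_real.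
  move=> y y1 z _; apply: le_trans (ltW y1).
  apply: le_trans (ler_norm_sum _ _ _) _.
  apply: le_trans (expR_sumN_bound s (fun k => wgt_ge0 kap beta <<z, k>>)
    (fun k => mulr_ge0 kap0 (normr_ge0 k))).
  rewrite mulr_sumr; apply: ler_sum => k _.
  rewrite normrZ ger0_norm; first by rewrite -/(phi s z) !mulrA.
  by apply: mulr_ge0; [exact: soft_ge0|apply: mulr_ge0; [exact: wgt_ge0|]].
Qed.

End soft_Cb1.

(** * Positivity almost everywhere from integrals over small intervals *)

Section local_positivity.
Variable R : realType.
Local Notation lam := (@lebesgue_measure R).
Local Notation nu := (leb01 R).
Local Notation TR := (measurableTypeR R).
Local Notation D := (`]0%R, 1%R[%classic : set R).
Implicit Types (w F : R -> R) (x p q : R).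

(** Lebesgue's differentiation theorem for the primitive. *)
Lemma prim_derive w : Ibl nu w ->
  {ae lam, forall x : TR, derivable (prim w) (x : R) 1 /\
    (prim w)^`()%classic (x : R) = w x * \1_D x}.
Proof.
move=> Iw; have mw := Ibl_meas Iw; have I1 := (Ibl01P mw).1 Iw.
have primE x : prim w x = \int[lam]_(t in `]-oo, x]) (w t * \1_D t).
  rewrite /prim Rint01.
    rewrite [RHS]Rintegral_mkcond; apply: eq_Rintegral => s _.
    rewrite patchE; case: (boolP (s \in `]-oo, x]%classic)) => h.
      by move: h; rewrite inE/= in_itv/= => ->; rewrite mulr1.
    have -> : (s <= x)%R = false.
      by apply/negbTE; apply: contraNN h => h; rewrite inE/= in_itv.
    by rewrite mulr0 mul0r.
  exact: Ibl_meas (Ibl_prim x Iw).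
have loc : locally_integrable [set: R] (fun t => w t * \1_D t).
  split; first exact: Ibl_meas I1.
  - exact: openT.
  - move=> K _ cK; move/integrableP : (integrable_norm I1) => [_].
    apply: le_lt_trans; rewrite [leRHS](_ : _ = \int[lam]_x `|(w x * \1_D x)%:E|)%E.
      apply: ge0_subset_integral => //; first exact: compact_measurable.
      exact: (measurable_int lam (integrable_norm I1)).
    by apply: eq_integral => s _ /=; rewrite normr_id.
have := @FTC1Ny R (fun t => w t * \1_D t) _ loc.
have -> : (fun x => \int[lam]_(t in `]-oo, x]) (w t * \1_D t)) = prim w.
  by apply/funext => x; rewrite primE.
apply=> y; apply: (integrableS measurableT) => //; exact: measurable_itv.
Qed.

(** The derivative at a single point says nothing on monotonicity nearby, but it
    controls the increments over the intervals that contain the point. *)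
Lemma straddle F x : derivable F x 1 -> F^`()%classic x < 0 ->
  exists2 e, 0 < e & forall p q, p <= x -> x <= q -> p < q -> q - p < e -> F q < F p.
Proof.
move=> dF Fx.
have cF : h^-1 *: (F (h + x) - F x) @[h --> 0^'] --> F^`()%classic x.
  have := dF; rewrite /derivable => /cvg_ex[l hl].
  have -> : F^`()%classic x = l.
    rewrite derive1E; apply/cvg_lim => //; exact: hl.
  by apply: cvg_trans hl; apply: near_eq_cvg; apply: nearW => h /=; rewrite scaler1.
have : \forall h \near 0^', h^-1 *: (F (h + x) - F x) < 0.
  exact: (cvgr_lt _ cF _ Fx).
rewrite /dnbhs /within/= => -[e /= e0 He]; exists e => // p q px xq pq qpe.
have sgn h : `|h| < e -> h != 0 -> h^-1 * (F (h + x) - F x) < 0.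
  by move=> he h0; apply: He => //=; rewrite sub0r normrN.
have hq : F q <= F x /\ (x < q -> F q < F x).
  have [->|xq'] := eqVneq x q; first by rewrite lexx ltxx.
  have xltq : x < q by rewrite lt_neqAle xq'.
  have qx0 : 0 < q - x by rewrite subr_gt0.
  have := @sgn (q - x); rewrite gtr0_norm// subrK => /(_ _ _) h.
  have : (q - x)^-1 * (F q - F x) < 0.
    by apply: h; [apply: le_lt_trans qpe; rewrite lerD2l lerN2|rewrite gt_eqF].
  rewrite pmulr_rlt0 ?invr_gt0// subr_lt0 => hh.
  by split => //; exact: ltW.
have hp : F x <= F p /\ (p < x -> F x < F p).
  have [->|px'] := eqVneq p x; first by rewrite lexx ltxx.
  have pltx : p < x by rewrite lt_neqAle px'.
  have px0 : p - x < 0 by rewrite subr_lt0.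
  have := @sgn (p - x); rewrite ltr0_norm// subrK opprB => /(_ _ _) h.
  have : (p - x)^-1 * (F p - F x) < 0.
    by apply: h; [apply: le_lt_trans qpe; rewrite lerD2r|rewrite lt_eqF].
  rewrite nmulr_rlt0 ?invr_lt0// subr_gt0 => hh.
  by split => //; exact: ltW.
have [pltx|] := boolP (p < x).
  exact: le_lt_trans hq.1 (hp.2 pltx).
rewrite -leNgt => xp; apply: lt_le_trans hp.1; apply: hq.2.
exact: le_lt_trans xp pq.
Qed.

(** At a Lebesgue point where w is negative, the primitive would strictly decrease
    over all small intervals around the point. *)
Lemma ae_ge0_prim w : Ibl nu w ->
  (forall x e, 0 < x < 1 -> 0 < e -> exists p q,
    [/\ p <= x, x <= q, p < q, q - p < e & prim w p <= prim w q]) ->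
  {ae nu, forall x : TR, 0 <= w x}.
Proof.
move=> Iw hw; have [N [mN N0 sub]] := prim_derive Iw.
exists (N `|` ~` D); split.
- by apply: measurableU => //; apply: measurableC; exact: measurable_itv.
- have mD : measurable (~` D) by apply: measurableC; exact: measurable_itv.
  have n1 : nu N = 0%E.
    apply: (@subset_measure0 _ _ _ lam (N `&` D) N) => //.
    by apply: measurableI => //; exact: measurable_itv.
  have n2 : nu (~` D) = 0%E.
    by change (lam (~` D `&` D) = 0%E); rewrite setICl measure0.
  exact: null_set_setU.
- move=> x /= wx; apply: contrapT => /not_orP[xN /contrapT xD]; apply: wx.
  have [dF FE] : derivable (prim w) x 1 /\ (prim w)^`()%classic x = w x * \1_D x.
    by apply: contrapT => h; apply: xN; apply: sub.
  rewrite leNgt; apply/negP => w0.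
  have F0 : (prim w)^`()%classic x < 0.
    by rewrite FE indicE mem_set// mulr1.
  have [e e0 He] := straddle dF F0.
  have x01 : 0 < x < 1 by move: xD; rewrite /= in_itv.
  have [p [q [px xq pq qpe h]]] := hw x e x01 e0.
  by have := He p q px xq pq qpe; rewrite ltNge h.
Qed.

End local_positivity.

(** * The sine basis and the space H_1 *)

Section sine_basis.
Variable R : realType.
Local Notation lam := (@lebesgue_measure R).
Local Notation nu := (leb01 R).
Local Notation H := (L2 (leb01 R)).
Local Notation TR := (measurableTypeR R).
Local Notation "<< x , y >>" := (L2_dot x y).
Implicit Types (x y z : H) (f : R -> R) (j n : nat).

Definition sn j (r : R) : R := sin (j%:R * pi * r).

Lemma sn_meas j : measurable_fun setT (sn j).
Proof.
apply: measurableT_comp; first exact: continuous_measurable_fun (@continuous_sin _).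
exact: measurable_funM.
Qed.

Lemma cs_meas (c : R) : measurable_fun setT (fun r : R => cos (c * r)).
Proof.
apply: measurableT_comp; first exact: continuous_measurable_fun (@continuous_cos _).
exact: measurable_funM.
Qed.

Lemma norm_sin_le1 (t : R) : `|sin t| <= 1.
Proof. by rewrite ler_norml sin_geN1 sin_le1. Qed.

Lemma norm_cos_le1 (t : R) : `|cos t| <= 1.
Proof. by rewrite ler_norml cos_geN1 cos_le1. Qed.

Lemma dot_e y j : <<y, e_ R j>> = Num.sqrt 2 * \int[nu]_r (sn j r * y r).
Proof.
rewrite L2_dotC (L2_dot_ae y _ (L2_mkE (Lfun_Sub (lee1n 2) (sine_Lfun R j)))).
  rewrite /sine/= -RintZ.
    by apply: eq_Rintegral => r _; rewrite mulrA.
  apply: (Ibl_le _ (Ibl_L2 y)).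
    by apply: measurable_funM; [exact: sn_meas|exact: L2_meas].
  by move=> r; rewrite normrM ler_piMl// norm_sin_le1.
exact: Lfun2_meas (sine_Lfun R j).
Qed.

Section completeness.
Variable y : H.
Hypothesis y0 : forall j, (1 <= j)%N -> <<y, e_ R j>> = 0.

Let sny0 j : \int[nu]_r (sn j r * y r) = 0.
Proof.
have [->|j0] := posnP j.
  transitivity (\int[nu]_r (0 : R)); last exact: Rint0.
  by apply: eq_Rintegral => r _; rewrite /sn !mul0r sin0 mul0r.
have := y0 j0; rewrite dot_e => /eqP; rewrite mulf_eq0 => /orP[|/eqP//].
by rewrite sqrtr_eq0 => h; exfalso; move: h; lra.
Qed.

(** A class of multipliers stable under products with cos(pi r), because such a
    product only shifts the index of a sine. *)
Let Z f := [/\ measurable_fun setT f, exists M : R, forall r, `|f r| <= M &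
  forall j, \int[nu]_r (sn j r * (f r * y r)) = 0].

Let IZ f (g : R -> R) : Z f -> measurable_fun setT g -> (forall r, `|g r| <= 1) ->
  Ibl nu (fun r => g r * (f r * y r)).
Proof.
move=> [mf [M fM] _] mg g1.
apply: (Ibl_le _ (IblZ M (Ibl_L2 y))).
  by apply: measurable_funM => //; apply: measurable_funM => //; exact: L2_meas.
move=> r; rewrite !normrM; apply: le_trans (ler_piMl _ (g1 r)) _.
  by rewrite mulr_ge0.
by rewrite ler_wpM2r// (le_trans (fM r))// ler_norm.
Qed.

Let Z1 : Z (cst 1).
Proof.
split; first exact: measurable_cst.
- by exists 1 => r; rewrite normr1.
- by move=> j; under eq_Rintegral do rewrite mul1r; exact: sny0.
Qed.

Variables (A B : R).
Let u (r : R) := A + B * cos (pi * r).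

Let u_meas : measurable_fun setT u.
Proof. by apply: measurable_funD => //; apply: measurable_funM => //; exact: cs_meas. Qed.

Let u_bound r : `|u r| <= `|A| + `|B|.
Proof.
rewrite /u (le_trans (ler_normD _ _))// lerD2l normrM ler_piMr//.
exact: norm_cos_le1.
Qed.

Let trig_step j r : sn j.+1 r * u r
  = A * sn j.+1 r + (B / 2 * sn j.+2 r + B / 2 * sn j r).
Proof.
have -> : sn j.+2 r = sin ((j.+1)%:R * pi * r + pi * r).
  by rewrite /sn -[j.+2%:R]natr1; congr sin; lra.
have -> : sn j r = sin ((j.+1)%:R * pi * r - pi * r).
  by rewrite /sn -[j.+1%:R]natr1; congr sin; lra.
rewrite sinD sinB /sn /u.
by move: (sin _) (cos _) (cos (pi * r)) (sin (pi * r)) => a b c d; lra.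
Qed.

Let Zu f : Z f -> Z (fun r => u r * f r).
Proof.
move=> Zf; have [mf [M fM] f0] := Zf.
split; first exact: measurable_funM.
  exists ((`|A| + `|B|) * M) => r; rewrite normrM.
  by apply: ler_pM => //; exact: u_bound.
move=> [|j].
  transitivity (\int[nu]_r (0 : R)); last exact: Rint0.
  by apply: eq_Rintegral => r _; rewrite /sn !mul0r sin0 mul0r.
have I k := IZ Zf (sn_meas k) (fun r => norm_sin_le1 _).
have E r : sn j.+1 r * (u r * f r * y r) = A * (sn j.+1 r * (f r * y r))
    + (B / 2 * (sn j.+2 r * (f r * y r)) + B / 2 * (sn j r * (f r * y r))).
  rewrite (_ : _ * (_ * _) = sn j.+1 r * u r * (f r * y r)); last by rewrite !mulrA.
  by rewrite trig_step; move: (sn _ r) (sn _ r) (sn _ r) (f r * _) => a b c d; lra.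
under eq_Rintegral do rewrite E.
have J k c := IblZ c (I k).
rewrite (RintD (J j.+1 A) (IblD (J j.+2 (B / 2)) (J j (B / 2)))).
rewrite (RintD (J j.+2 (B / 2)) (J j (B / 2))) !RintZ//.
by rewrite !f0 !mulr0 !addr0.
Qed.

Let ZB f g : Z f -> Z g -> Z (fun r => f r - g r).
Proof.
move=> Zf Zg; have [mf [M fM] f0] := Zf; have [mg [N gN] g0] := Zg.
split; first exact: measurable_funB.
  by exists (M + N) => r; rewrite (le_trans (ler_normB _ _))// lerD.
move=> j.
have If := IZ Zf (sn_meas j) (fun r => norm_sin_le1 _).
have Ig := IZ Zg (sn_meas j) (fun r => norm_sin_le1 _).
transitivity (\int[nu]_r (sn j r * (f r * y r) - sn j r * (g r * y r))).
  by apply: eq_Rintegral => r _; rewrite mulrBl mulrBr.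
by rewrite RintB// f0 g0 subrr.
Qed.

Let Zpow f n : Z f -> Z (fun r => u r ^+ n * f r).
Proof.
move=> Zf; elim: n => [|n IH].
  by rewrite (_ : (fun r => _) = f)//; apply/funext => r; rewrite expr0 mul1r.
rewrite (_ : (fun r => _) = (fun r => u r * (u r ^+ n * f r))); first exact: Zu.
by apply/funext => r; rewrite exprS mulrA.
Qed.

Let Zbump n N : Z (fun r => (1 - u r ^+ n) ^+ N).
Proof.
elim: N => [|N IH].
  by rewrite (_ : (fun r => _) = cst 1)//; apply/funext => r; rewrite expr0.
rewrite (_ : (fun r => _) = (fun r => (1 - u r ^+ n) ^+ N
    - u r ^+ n * (1 - u r ^+ n) ^+ N)).
  by apply: ZB => //; exact: Zpow.
by apply/funext => r; rewrite exprS mulrBl mul1r.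
Qed.

(** Every polynomial in cos(pi r) is such a multiplier; this one becomes a step
    function in the limit. *)
Lemma bump_orth n N : \int[nu]_r ((1 - (A + B * cos (pi * r)) ^+ n) ^+ N
   * (sn 1 r * y r)) = 0.
Proof.
have [_ _ /(_ 1%N)] := Zbump n N; rewrite /u => h; rewrite -[RHS]h.
by apply: eq_Rintegral => r _; rewrite mulrCA.
Qed.

End completeness.

(** With its companion below, the sharp threshold at 1 / 2 used in proofs of the
    Stone-Weierstrass theorem; both sides follow from Bernoulli's inequality. *)
Lemma threshold_lt (x : R) : 0 <= x -> x < 1 / 2 ->
  (1 - x ^+ n) ^+ (2 ^ n) @[n --> \oo] --> (1 : R).
Proof.
move=> x0 x1.
have h n : 1 - (2 * x) ^+ n <= (1 - x ^+ n) ^+ (2 ^ n) <= 1.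
  have xn : 0 <= x ^+ n <= 1 by rewrite exprn_ge0//= exprn_ile1//; lra.
  move: xn; rewrite exprMn -natrX; move: (x ^+ n) => v /andP[v0 v1].
  apply/andP; split; last by apply: exprn_ile1; lra.
  elim: (2 ^ n)%N => [|N IH]; first by rewrite mul0r subr0 expr0.
  rewrite exprS -natr1; have w0 : 0 <= 1 - v by lra.
  have := ler_wpM2l w0 IH.
  by have : 0 <= N%:R :> R by []; move: (N%:R) ((1 - v) ^+ N) => k w k0; nra.
apply: (@squeeze_cvgr _ _ _ _ (fun n => 1 - (2 * x) ^+ n) (cst 1)).
- by apply: nearW => n; exact: h.
- have : 1 - (2 * x) ^+ n @[n --> \oo] --> 1 - (0 : R).
    apply: cvgB; first exact: cvg_cst.
    by apply: cvg_expr; rewrite ger0_norm ?mulr_ge0//; lra.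
  by rewrite subr0.
- exact: cvg_cst.
Qed.

Lemma threshold_gt (x : R) : 1 / 2 < x -> x <= 1 ->
  (1 - x ^+ n) ^+ (2 ^ n) @[n --> \oo] --> (0 : R).
Proof.
move=> x0 x1.
have x2 : 0 < 2 * x by lra.
have h n : 0 <= (1 - x ^+ n) ^+ (2 ^ n) <= ((2 * x)^-1) ^+ n.
  have xn : 0 < x ^+ n <= 1 by rewrite exprn_gt0 ?exprn_ile1//; lra.
  rewrite exprVn exprMn -natrX; move: xn; move: (x ^+ n) => v /andP[v0 v1].
  have w0 : 0 <= 1 - v by lra.
  rewrite exprn_ge0//= -[leRHS]mul1r ler_pdivlMr; last first.
    by rewrite mulr_gt0// ltr0n expn_gt0.
  have b N : (1 - v) ^+ N * (1 + N%:R * v) <= 1.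
    elim: N => [|N IH]; first by rewrite mul0r addr0 expr0 mulr1.
    apply: le_trans IH; rewrite exprSr -mulrA ler_wpM2l ?exprn_ge0//.
    rewrite -natr1; have : 0 <= N%:R :> R by [].
    by move: (N%:R) => k k0; nra.
  apply: le_trans (b (2 ^ n)%N); rewrite ler_wpM2l ?exprn_ge0//.
  by rewrite lerDr.
apply: (@squeeze_cvgr _ _ _ _ (cst 0) (fun n => ((2 * x)^-1) ^+ n)).
- by apply: nearW => n; exact: h.
- exact: cvg_cst.
- apply: cvg_expr; rewrite ger0_norm ?invr_ge0 ?(ltW x2)//.
  by rewrite invf_lt1//; lra.
Qed.

Lemma cos_pi_lt (r t : R) : 0 <= r -> r < t -> t <= 1 ->
  cos (pi * t) < cos (pi * r).
Proof.
move=> r0 rt t1; have p0 := pi_gt0 R.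
have t0 : 0 < t by exact: le_lt_trans r0 rt.
have r1 : r <= 1 by exact: le_trans (ltW rt) t1.
have h (x : R) : 0 <= x -> x <= 1 -> pi * x \in `[0, (pi : R)].
  by move=> x0 x1; rewrite in_itv/= mulr_ge0 ?(ltW p0)//= ler_piMr ?(ltW p0).
by rewrite ltr_cos ?ltr_pM2l// h// ltW.
Qed.

Let RA (f g : R -> R) : measurable_fun setT f -> measurable_fun setT g ->
  f = g %[ae nu] -> \int[nu]_x f x = \int[nu]_x g x.
Proof. by move=> mf mg fg; apply: Rint_ae. Qed.

(** If y is orthogonal to the sines, so is its product with every polynomial in
    cos(pi r). Polynomials with a sharp threshold at cos(pi t) converge to the
    indicator of [0, t], as the cosine is decreasing there; hence the primitive of
    sin(pi r) y vanishes identically, and so does y. *)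
Lemma sine_complete y : (forall j, (1 <= j)%N -> <<y, e_ R j>> = 0) -> y = 0.
Proof.
move=> y0.
pose w r := sn 1 r * y r.
have Iw : Ibl nu w.
  apply: (Ibl_le _ (Ibl_L2 y)); first by apply: measurable_funM; [exact: sn_meas|exact: L2_meas].
  by move=> r; rewrite normrM ler_piMl// norm_sin_le1.
have mw := Ibl_meas Iw.
have wt t : 0 < t < 1 -> prim w t = 0.
  move=> /andP[t0 t1].
  (* The affine function A + B cos(pi r) takes values in [0, 1], increases with r
     and equals 1 / 2 at r = t; chi removes this point, where the threshold fails. *)
  pose A := 1 / 2 + cos (pi * t) / 4; pose B : R := - 1 / 4.
  pose chi : R -> R := \1_(~` [set t]).
  have mchi : measurable_fun setT chi.
    by apply: measurable_indic; apply: measurableC; exact: measurable_set1.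
  have chi1 r : `|chi r| <= 1.
    by rewrite /chi indicE; case: (_ \in _); rewrite ?normr1 ?normr0.
  have chi_ae (f : R -> R) : (fun r => f r * chi r) = f %[ae nu].
    exists [set t]; split; first exact: measurable_set1.
      apply: (@subset_measure0 _ _ _ lam _ [set t]).
      - by apply: measurableI; [exact: measurable_set1|exact: measurable_itv].
      - exact: measurable_set1.
      - by move=> x [].
      - exact: lebesgue_measure_set1.
    move=> r /= h; apply: contrapT => rt; apply: h => _.
    by rewrite /chi indicE mem_set ?mulr1.
  pose bump n r := (1 - (A + B * cos (pi * r)) ^+ n) ^+ (2 ^ n).
  have u01 (r : R) : 0 <= A + B * cos (pi * r) <= 1.
    rewrite /A /B; have := cos_le1 (pi * r); have := cos_geN1 (pi * r).
    have := cos_le1 (pi * t); have := cos_geN1 (pi * t).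
    by move: (cos _) (cos _) => c d *; apply/andP; split; lra.
  have bump1 n r : `|bump n r| <= 1.
    have /andP[h0 h1] := u01 r; rewrite /bump.
    have h2 : 0 <= 1 - (A + B * cos (pi * r)) ^+ n <= 1.
      by rewrite subr_ge0 exprn_ile1//= gerBl exprn_ge0.
    by have /andP[h3 h4] := h2; rewrite ger0_norm ?exprn_ge0// exprn_ile1.
  have mbump n : measurable_fun setT (bump n).
    apply: measurable_funX; apply: measurable_funB => //.
    apply: measurable_funX; apply: measurable_funD => //.
    by apply: measurable_funM => //; exact: cs_meas.
  have mle := Ibl_meas (Ibl_prim t Iw).
  (* the limit is only wanted on the open unit interval *)
  pose one r : R := \1_(`]0%R, 1%R[%classic : set R) r.
  have mone : measurable_fun setT one by apply: measurable_indic; exact: measurable_itv.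
  have one_ae (f : R -> R) : (fun r => f r * one r) = f %[ae nu].
    apply: (@ae01_imp R (fun r => one r) (cst 1)).
      by move=> r ->; rewrite mulr1.
    exists (~` `]0%R, 1%R[%classic); split.
    - by apply: measurableC; exact: measurable_itv.
    - by change (lam (~` `]0%R, 1%R[%classic `&` `]0%R, 1%R[%classic) = 0%E);
        rewrite setICl measure0.
    - move=> x /= h; apply: contra_not h => xD _; rewrite /one indicE mem_set//.
  have one1 r : `|one r| <= 1.
    by rewrite /one indicE; case: (_ \in _); rewrite ?normr1 ?normr0.
  have [_ L] : Ibl nu (fun r => w r * (r <= t)%R%:R * chi r * one r) /\
      \int[nu]_r (bump n r * w r * chi r * one r) @[n --> \oo]
      --> \int[nu]_r (w r * (r <= t)%R%:R * chi r * one r).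
    apply: (@Rint_dct _ _ _ nu _ _ (fun r => `|w r|)).
    - by move=> n; exact: (measurable_funM (measurable_funM (measurable_funM (mbump n) mw) mchi) mone).
    - exact: (measurable_funM (measurable_funM mle mchi) mone).
    - move=> r; rewrite /one indicE; case: (boolP (r \in _)) => rD; last first.
        by rewrite mulr0; under eq_fun do rewrite mulr0; exact: cvg_cst.
      rewrite mulr1; under eq_fun do rewrite mulr1.
      rewrite /chi indicE; case: (boolP (r \in _)) => rt; last first.
        by rewrite mulr0; under eq_fun do rewrite mulr0; exact: cvg_cst.
      rewrite mulr1; under eq_fun do rewrite mulr1.
      move: rD rt; rewrite !inE/= in_itv/= => /andP[r0 r1] /eqP rt.
      have /andP[h0 h1] := u01 r.
      case: (ltgtP r t) rt => // rt _.
        have hb : bump n r @[n --> \oo] --> (1 : R).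
          apply: threshold_lt => //; have := cos_pi_lt (ltW r0) rt (ltW t1).
          by rewrite /A /B; move: (cos _) (cos _) => c d; lra.
        have : bump n r * w r @[n --> \oo] --> 1 * w r by apply: cvgMl.
        by rewrite mul1r mulr1.
      have hb : bump n r @[n --> \oo] --> (0 : R).
        apply: threshold_gt => //; have := cos_pi_lt (ltW t0) rt (ltW r1).
        by rewrite /A /B; move: (cos _) (cos _) => c d; lra.
      have : bump n r * w r @[n --> \oo] --> 0 * w r by apply: cvgMl.
      by rewrite mul0r mulr0.
    - exact: integrable_norm.
    - move=> n r; move: (w r) (bump1 n r) (chi1 r) (one1 r) => v h1 h2 h3.
      rewrite (normrM (bump n r * v * chi r)) (normrM (bump n r * v)) normrM.
      apply: le_trans (ler_piMr _ h3) _; first by rewrite !mulr_ge0.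
      apply: le_trans (ler_piMr _ h2) _; first by rewrite mulr_ge0.
      by rewrite ler_piMl.
  have E0 n : \int[nu]_r (bump n r * w r * chi r * one r) = 0.
    rewrite -[RHS](bump_orth y0 A B n (2 ^ n)).
    have m1 : measurable_fun setT (fun r => bump n r * w r) by exact: (measurable_funM (mbump n) mw).
    have m2 : measurable_fun setT (fun r => bump n r * w r * chi r) by exact: (measurable_funM m1 mchi).
    transitivity (\int[nu]_r (bump n r * w r * chi r)).
      exact: (RA (measurable_funM m2 mone) m2 (one_ae (fun r => bump n r * w r * chi r))).
    exact: (RA m2 m1 (chi_ae (fun r => bump n r * w r))).
  have m2 : measurable_fun setT (fun r => w r * (r <= t)%R%:R * chi r) by exact: (measurable_funM mle mchi).
  have -> : prim w t = \int[nu]_r (w r * (r <= t)%R%:R * chi r * one r).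
    transitivity (\int[nu]_r (w r * (r <= t)%R%:R * chi r)); apply/esym.
      exact: (RA m2 mle (chi_ae (fun r => w r * (r <= t)%R%:R))).
    exact: (RA (measurable_funM m2 mone) m2 (one_ae (fun r => w r * (r <= t)%R%:R * chi r))).
  have L0 : \int[nu]_r (bump n r * w r * chi r * one r) @[n --> \oo] --> (0 : R).
    by under eq_fun do rewrite E0; exact: cvg_cst.
  exact: cvg_unique L L0.
have wpos (v : R -> R) : Ibl nu v -> (forall t, 0 < t < 1 -> prim v t = 0) ->
    {ae nu, forall x : TR, 0 <= v x}.
  move=> Iv v0; apply: ae_ge0_prim => // x e /andP[x0 x1] e0.
  pose d := Num.min (e / 4) (Num.min (x / 2) ((1 - x) / 2)).
  have d0 : 0 < d by rewrite !lt_min; apply/and3P; split; lra.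
  have d1 : d <= e / 4 by rewrite /d ge_min lexx.
  have d2 : d <= x / 2 by rewrite /d !ge_min lexx orbT.
  have d3 : d <= (1 - x) / 2 by rewrite /d !ge_min lexx !orbT.
  exists (x - d), (x + d); split; try lra.
  by rewrite !v0//; apply/andP; split; lra.
have Iwn := IblN Iw.
have wt' t : 0 < t < 1 -> prim (fun r => - w r) t = 0.
  move=> t01; rewrite -oppr0 -(wt t t01) /prim -RintN; last exact: Ibl_prim.
  by apply: eq_Rintegral => r _; rewrite mulNr.
have [N1 [mN1 N10 s1]] := wpos _ Iw wt.
have [N2 [mN2 N20 s2]] := wpos _ Iwn wt'.
apply: L2_eq.
have [N3 [mN3 N30 s3]] := @L2_zeroE _ _ _ nu.
have z0 : {ae nu, forall r : TR, `]0%R, 1%R[%classic (r : R)}.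
  exists (~` `]0%R, 1%R[%classic); split => //.
  - by apply: measurableC; exact: measurable_itv.
  - by change (lam (~` `]0%R, 1%R[%classic `&` `]0%R, 1%R[%classic) = 0%E);
      rewrite setICl measure0.
have [N4 [mN4 N40 s4]] := z0.
exists ((N1 `|` N2) `|` (N3 `|` N4)); split.
- by apply: measurableU; exact: measurableU.
- have h1 : nu (N1 `|` N2) = 0%E by exact: null_set_setU.
  have h2 : nu (N3 `|` N4) = 0%E by exact: null_set_setU.
  by apply: null_set_setU => //; exact: measurableU.
- move=> r /= h; apply: contrapT => hN; apply: h => _.
  have r1 : 0 <= w r by apply: contrapT => h; apply: hN; left; left; exact: s1.
  have r2 : 0 <= - w r by apply: contrapT => h; apply: hN; left; right; exact: s2.
  have r3 : (0 : H) r = 0.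
    by apply: contrapT => h; apply: hN; right; left; apply: s3 => /= /(_ Logic.I).
  have r4 : `]0%R, 1%R[%classic r by apply: contrapT => h; apply: hN; right; right; exact: s4.
  rewrite r3; have w0 : w r = 0 by apply/eqP; rewrite eq_le r1 andbT -oppr_ge0.
  move/eqP: w0; rewrite /w mulf_eq0 => /orP[|/eqP//].
  move: r4; rewrite /= in_itv/= => /andP[r0 r1'].
  have p0 := pi_gt0 R.
  rewrite /sn mul1r gt_eqF// sin_gt0_pi// mulr_gt0//=.
  by rewrite -[ltRHS]mulr1 ltr_pM2l.
Qed.

End sine_basis.

Section sine_orthogonality.
Variable R : realType.
Local Notation nu := (leb01 R).
Implicit Types (i j k n : nat).
Local Notation sn := (@sn R).

Lemma sin_natpi k : sin (k%:R * pi) = 0 :> R.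
Proof.
elim: k => [|k IH]; first by rewrite mul0r sin0.
by rewrite -natr1 mulrDl mul1r sinD IH sinpi mul0r mulr0 addr0.
Qed.

Lemma Rint01_cos k : (0 < k)%N -> \int[nu]_r cos (k%:R * pi * r) = 0.
Proof.
move=> k0; pose c : R := k%:R * pi.
have c0 : c != 0 by rewrite mulf_neq0 ?pnatr_eq0 ?gt_eqF ?pi_gt0// -lt0n.
rewrite -Rint01_closed; last exact: cs_meas.
have dF (x : R) : is_derive x 1 (fun r => c^-1 * sin (c * r)) (cos (c * x)).
  apply: is_derive_eq_val; rewrite /GRing.scale/=.
  have h : c^-1 * c = 1 by rewrite mulVf.
  move: (c^-1) (cos _) h => d e h.
  transitivity (d * c * e); last by rewrite h mul1r.
  by clear -d e; clearbody c; lra.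
have cF (x : R) : {for x, continuous (fun r => c^-1 * sin (c * r))}.
  by apply/differentiable_continuous/derivable1_diffP; have [] := dF x.
rewrite /Rintegral (@continuous_FTC2 R _ (fun r => c^-1 * sin (c * r)))//.
- by rewrite /= mulr1 mulr0 sin0 /c sin_natpi !mulr0 subrr.
- apply: continuous_subspaceT => x.
  apply: (cvg_comp (fun r : R => c * r) cos); last exact: continuous_cos.
  by apply: cvgMr; exact: cvg_id.
- split; [|exact/cvg_at_right_filter/cF|exact/cvg_at_left_filter/cF].
  by move=> x _; have [] := dF x.
- by move=> x _; rewrite derive1E; exact: (@derive_val _ _ _ _ _ _ _ (dF x)).
Qed.

Let Ics (c : R) : Ibl nu (fun r => cos (c * r)).
Proof. by apply: (@Ibl01_bounded _ 1); [exact: cs_meas|move=> r; exact: norm_cos_le1]. Qed.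

Lemma sn_orth i j : (0 < i)%N -> (0 < j)%N ->
  \int[nu]_r (sn i r * sn j r) = (i == j)%:R / 2.
Proof.
wlog ij : i j / (j <= i)%N.
  move=> h i0 j0; case: (leqP j i) => [/h|/ltnW/h]; first exact.
  by rewrite eq_sym => <- //; apply: eq_Rintegral => r _; rewrite mulrC.
move=> i0 j0.
have E r : sn i r * sn j r
    = 2^-1 * cos ((i - j)%:R * pi * r) - 2^-1 * cos ((i + j)%:R * pi * r).
  rewrite natrB// natrD.
  have -> : (i%:R - j%:R) * pi * r = i%:R * pi * r - j%:R * pi * r :> R by lra.
  have -> : (i%:R + j%:R) * pi * r = i%:R * pi * r + j%:R * pi * r :> R by lra.
  rewrite cosB cosD /sn.
  by move: (sin _) (sin _) (cos _) (cos _) => a b c d; lra.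
under eq_Rintegral do rewrite E.
rewrite RintB; [|by apply: IblZ; exact: Ics|by apply: IblZ; exact: Ics].
rewrite !RintZ; [|exact: Ics|exact: Ics].
rewrite (@Rint01_cos (i + j)) ?addn_gt0 ?i0// mulr0 subr0.
case: eqVneq => [->|nij].
  rewrite subnn; under eq_Rintegral do rewrite !mul0r cos0.
  by rewrite Rint01_cst mulrC.
rewrite Rint01_cos ?mulr0 ?mul0r// subn_gt0 ltn_neqAle ij andbT eq_sym//.
Qed.

End sine_orthogonality.

Section H1_theory.
Variables (R : realType) (eps : R).
Hypothesis eps0 : 0 < eps.
Local Notation nu := (leb01 R).
Local Notation H := (L2 (leb01 R)).
Local Notation "<< x , y >>" := (L2_dot x y).
Implicit Types (x y z : H) (i j k n : nat).
Local Notation sn := (@sn R).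
Local Notation e := (e_ R).
Local Notation c := (weight eps).

Lemma weight_gt0 j : (0 < j)%N -> 0 < c j.
Proof. by move=> j0; rewrite powR_gt0// mulr_gt0 ?pi_gt0// ltr0n. Qed.

(** By comparison with a telescoping series: the term of index j is of order
    j^(-1-s), with s = 2 eps, which the difference of j^(-s) dominates up to 1 / s. *)
Lemma weight_sum : exists Z : R, forall n, \sum_(1 <= j < n) (c j ^+ 2)^-1 <= Z.
Proof.
pose s := 2 * eps; have s0 : 0 < s by rewrite mulr_gt0.
pose g j : R := expR (- (s * ln j%:R)).
have gs j : (1 < j)%N -> (c j ^+ 2)^-1 <= s^-1 * (g j.-1 - g j) .
  case: j => [|[|j]]// _; rewrite [_.-1]/=.
  set m : R := j.+2%:R; have m2 : 2 <= m by rewrite /m ler_nat.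
  have m0 : 0 < m by lra.
  have mp : m <= m * pi by rewrite ler_peMr ?(ltW m0)//; have := pi_ge2 R; lra.
  have cE : (c j.+2 ^+ 2)^-1 = expR (- ((1 + s) * ln (m * pi))).
    rewrite /weight /powR ifF; last by rewrite gt_eqF// mulr_gt0// pi_gt0.
    rewrite -expRM_natl -expRN; congr expR; rewrite /s -/m.
    by move: (ln _) => l; lra.
  have h1 : (c j.+2 ^+ 2)^-1 <= m^-1 * g j.+2.
    rewrite cE /g -/m -[m^-1](lnK (_ : m^-1 \is Num.pos)) ?posrE ?invr_gt0//.
    rewrite -expRD ler_expR lnV ?posrE//.
    have : ln m <= ln (m * pi) by rewrite ler_ln ?posrE// (lt_le_trans m0).
    by move: (ln m) (ln (m * pi)) => a b; nra.
  apply: le_trans h1 _.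
  have h2 : g j.+2 * (1 + s / m) <= g j.+1.
    have m1 : j.+1%:R = m * (1 + - m^-1) :> R.
      rewrite mulrDr mulrN divff ?gt_eqF// mulr1 /m -[j.+2%:R]natr1; lra.
    have mi : 0 < m^-1 <= 1 / 2.
      by rewrite invr_gt0 m0/= -[leLHS]mul1r ler_pdivrMr//; lra.
    have mq : 0 < 1 + - m^-1 by clear -mi; case/andP: mi; move: (m^-1) => q ? ?; lra.
    rewrite /g m1 lnM ?posrE//.
    rewrite [s * (_ + _)]mulrDr opprD expRD -/m ler_pM2l ?expR_gt0//.
    apply: le_trans (expR_ge1Dx _) _; rewrite ler_expR.
    have : ln (1 + - m^-1) <= - m^-1 by apply: le_ln1Dx; clear -mq; move: (m^-1) mq => q ?; lra.
    clear -s0; move: (m^-1) => q; move: (ln _) => l h.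
    have : 0 <= s * (- q - l) by apply: mulr_ge0; lra.
    by lra.
  rewrite -(ler_pM2l s0) [leRHS]mulrA divff ?gt_eqF// mul1r; clear -h2.
  by move: (m^-1) h2 => q; move: (g j.+2) (g j.+1) => a b h2; lra.
exists ((c 1 ^+ 2)^-1 + s^-1) => n.
case: n => [|[|n]].
- by rewrite big_geq// addr_ge0 ?invr_ge0 ?sqr_ge0// ltW.
- by rewrite big_geq// addr_ge0 ?invr_ge0 ?sqr_ge0// ltW.
rewrite big_ltn//= lerD2l.
have h k : \sum_(2 <= j < k.+2) (c j ^+ 2)^-1 <= s^-1 * (1 - g k.+1).
  elim: k => [|k IH].
    by rewrite big_geq// /g ln1 mulr0 oppr0 expR0 subrr mulr0.
  rewrite big_nat_recr//=; apply: le_trans (lerD IH (gs k.+2 _)) _ => //=.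
  by move: (g k.+1) (g k.+2) (s^-1) => a b d; lra.
apply: le_trans (h n) _; rewrite ler_piMr ?invr_ge0 ?(ltW s0)//.
by rewrite gerBl expR_ge0.
Qed.

Lemma H1_spaceP x : H1_space eps x <->
  exists M : R, forall n, \sum_(1 <= j < n) <<x, e j>> ^+ 2 * c j ^+ 2 <= M.
Proof.
have t0 j : (0 <= (<<x, e j>> ^+ 2 * c j ^+ 2)%:E)%E.
  by rewrite lee_fin mulr_ge0// sqr_ge0.
split.
  rewrite /H1_space/=; set S := (X in (X < _)%E) => hS.
  have S0 : (0 <= S)%E by apply: nneseries_ge0 => j _ _; exact: t0.
  exists (fine S) => n; rewrite -lee_fin fineK; last by rewrite ge0_fin_numE.
  by rewrite -sumEFin; apply: nneseries_lim_ge => j _ _; exact: t0.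
move=> [M hM]; rewrite /H1_space/=.
apply: (@le_lt_trans _ _ M%:E); last by rewrite ltry.
apply: lime_le; first by apply: is_cvg_nneseries => j _ _; exact: t0.
by apply: nearW => n; rewrite sumEFin lee_fin.
Qed.

Lemma H1_space_lin (a : R) x y : H1_space eps x -> H1_space eps y ->
  H1_space eps (a *: x + y).
Proof.
move=> /H1_spaceP[M hM] /H1_spaceP[N hN]; apply/H1_spaceP.
exists (2 * a ^+ 2 * M + 2 * N) => n.
apply: (@le_trans _ _ (\sum_(1 <= j < n) (2 * a ^+ 2 * (<<x, e j>> ^+ 2 * c j ^+ 2)
   + 2 * (<<y, e j>> ^+ 2 * c j ^+ 2)))).
  apply: ler_sum => j _; rewrite (L2_dotDl (a *: x) y) (L2_dotZl a x).
  move: (<<x, e j>>) (<<y, e j>>) (c j) => u v w.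
  rewrite (_ : 2 * _ * _ + _ = (2 * a ^+ 2 * u ^+ 2 + 2 * v ^+ 2) * w ^+ 2); last lra.
  by apply: ler_wpM2r; rewrite ?sqr_ge0//; have := sqr_ge0 (a * u - v); lra.
rewrite big_split/= -!mulr_sumr; apply: lerD.
  by apply: ler_wpM2l => //; rewrite mulr_ge0 ?sqr_ge0.
exact: ler_wpM2l.
Qed.

Lemma H1_space0 : H1_space eps 0.
Proof.
apply/H1_spaceP; exists 0 => n; rewrite big1// => j _.
by rewrite L2_dot0l expr0n/= mul0r.
Qed.

Lemma H1_dot_partial x n : H1_space eps x ->
  \sum_(1 <= j < n) <<x, e j>> ^+ 2 * c j ^+ 2 <= H1_dot eps x x.
Proof.
move=> /H1_spaceP[M hM]; rewrite /H1_dot.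
pose u n := \sum_(1 <= j < n) c j ^+ 2 * <<x, e j>> * <<x, e j>>.
have uE m : \sum_(1 <= j < m) <<x, e j>> ^+ 2 * c j ^+ 2 = u m.
  by apply: eq_bigr => j _; rewrite mulrC expr2 mulrA.
have ndu : {homo u : m p / (m <= p)%N >-> m <= p}.
  apply/nondecreasing_seqP => -[|m]; first by rewrite /u !big_geq.
  rewrite /u [leRHS]big_nat_recr//= lerDl -mulrA -expr2.
  by rewrite mulr_ge0// sqr_ge0.
rewrite uE; apply: nondecreasing_cvgn_le => //.
apply: nondecreasing_is_cvgn => //; exists M => _ [m _ <-].
by rewrite -uE.
Qed.

(** By the inequality 2 |x_j| <= x_j^2 c_j^2 + c_j^(-2). *)
Lemma coef_sum x n Z : H1_space eps x -> H1_norm eps x <= 1 ->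
  (forall n, \sum_(1 <= j < n) (c j ^+ 2)^-1 <= Z) ->
  \sum_(1 <= j < n) `|<<x, e j>>| <= (1 + Z) / 2.
Proof.
move=> Hx nx hZ.
have d1 : H1_dot eps x x <= 1.
  have h := H1_dot_partial 0 Hx; rewrite big_geq// in h.
  by rewrite -(sqr_sqrtr h) exprn_ile1// sqrtr_ge0.
apply: (@le_trans _ _ (\sum_(1 <= j < n)
   (2^-1 * (<<x, e j>> ^+ 2 * c j ^+ 2) + 2^-1 * (c j ^+ 2)^-1))).
  rewrite big_nat [leRHS]big_nat; apply: ler_sum => j /andP[j1 _].
  have cj := weight_gt0 j1; have h1 : c j * (c j)^-1 = 1 by rewrite divff// gt_eqF.
  rewrite -exprVn -[<<x, e j>> ^+ 2](real_normK (num_real _)).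
  move: (`|<<x, e j>>|) (c j) (c j)^-1 h1 => a d b h.
  have := sqr_ge0 (a * d - b).
  have -> : (a * d - b) ^+ 2 = a ^+ 2 * d ^+ 2 - 2 * a * (d * b) + b ^+ 2 by lra.
  by rewrite h; lra.
rewrite big_split/= -!mulr_sumr.
have h1 := le_trans (H1_dot_partial n Hx) d1; have h2 := hZ n.
by move: (\sum_(_ <= _ < _) _) (\sum_(_ <= _ < _) _) h1 h2 => a b; lra.
Qed.

(** The sine series of an element of H_1 converges absolutely; by completeness its
    sum represents the element, which is therefore bounded. *)
Lemma H1_sup : exists C0 : R, 0 <= C0 /\ forall x a b, H1_space eps x ->
  H1_norm eps x <= 1 -> 0 <= a -> a < b -> b <= 1 -> `|<<x, avg a b>>| <= C0.
Proof.
have [Z hZ] := weight_sum; pose C := Num.sqrt 2 * ((1 + Z) / 2).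
exists `|C|; split => // x a b Hx nx a0 ab b1.
pose xe j := <<x, e j>>.
pose t r j : R := Num.sqrt 2 * xe j * sn j r.
pose Y_ n r := \sum_(0 <= j < n) t r j.
have t0 r : t r 0%N = 0 by rewrite /t /sn !mul0r sin0 mulr0.
have s2 : 0 <= Num.sqrt 2 :> R by [].
have tb r n : \sum_(0 <= j < n) `|t r j| <= C.
  have h : \sum_(1 <= j < n) `|t r j| <= C.
    apply: (@le_trans _ _ (\sum_(1 <= j < n) Num.sqrt 2 * `|xe j|)).
      apply: ler_sum => j _; rewrite /t normrM normrM (ger0_norm s2).
      by rewrite ler_piMr ?mulr_ge0// norm_sin_le1.
    by rewrite -mulr_sumr ler_wpM2l// coef_sum.
  case: n h => [|n] h; first by rewrite big_geq in h; rewrite ?big_geq.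
  by rewrite big_ltn// t0 normr0 add0r.
have Yb n r : `|Y_ n r| <= C.
  by apply: le_trans (tb r n); exact: ler_norm_sum.
have Ycv r : cvgn (fun n => Y_ n r).
  apply: (@normed_cvg R R^o (t r)).
  have cv : cvgn (series (fun j => `|t r j| : R)).
    apply: nondecreasing_is_cvgn.
      by apply/nondecreasing_seqP => n; rewrite seriesSr lerDl.
    by exists C => _ [n _ <-]; exact: tb.
  exact: cv.
pose Y r := limn (fun n => Y_ n r).
have YY r : Y_ n r @[n --> \oo] --> Y r by exact: Ycv.
have mY_ n : measurable_fun setT (Y_ n).
  rewrite /Y_; elim: n => [|n IH].
    by under eq_fun do rewrite big_geq//; exact: measurable_cst.
  under eq_fun do rewrite big_nat_recr//=.
  by apply: measurable_funD => //; apply: measurable_funM => //; exact: sn_meas.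
have mY : measurable_fun setT Y.
  by apply: (measurable_fun_cvg (h := Y_)) => // r _; exact: YY.
have Yb' r : `|Y r| <= C.
  have cn : `|Y_ n r| @[n --> \oo] --> `|Y r| by apply: cvg_norm; exact: YY.
  rewrite -(cvg_lim _ cn)//; apply: limr_le; first by apply: cvgP cn.
  by apply: nearW => n; exact: Yb.
have LY : Y \in Lfun nu 2%:E.
  by apply: (@Lfun2_bounded _ _ _ _ C) => //; rewrite leb01_setT ltry.
have It n i : Ibl nu (fun r => sn i r * Y_ n r).
  apply: (@Ibl01_bounded _ C); first by apply: measurable_funM => //; exact: sn_meas.
  by move=> r; rewrite normrM; apply: le_trans (Yb n r); rewrite ler_piMl// norm_sin_le1.
have Isn i j : Ibl nu (fun r => sn i r * sn j r).
  apply: (@Ibl01_bounded _ 1); first by apply: measurable_funM; exact: sn_meas.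
  by move=> r; rewrite normrM mulr_ile1// norm_sin_le1.
have coefn i n : (0 < i)%N -> (i < n)%N ->
    \int[nu]_r (sn i r * Y_ n r) = Num.sqrt 2 * xe i / 2.
  move=> i0 ni.
  have E r : sn i r * Y_ n r = \sum_(0 <= j < n) Num.sqrt 2 * xe j * (sn i r * sn j r).
    by rewrite /Y_ mulr_sumr; apply: eq_bigr => j _; rewrite /t mulrCA mulrA.
  under eq_Rintegral do rewrite E.
  rewrite Rint_sum; last by move=> j; exact: IblZ.
  rewrite (bigD1_seq i)/= ?mem_index_iota ?iota_uniq//.
  rewrite RintZ// sn_orth// eqxx mul1r big1_seq ?addr0// => j /andP[ji jn].
  rewrite RintZ//; have [->|j0] := posnP j.
    rewrite (_ : \int[nu]_x _ = 0) ?mulr0// -[RHS](@Rint0 _ _ _ nu).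
    by apply: eq_Rintegral => r _; rewrite /sn !mul0r sin0 mulr0.
  by rewrite sn_orth// eq_sym (negbTE ji) mul0r mulr0.
have xY : x = mkL2 nu Y.
  apply/eqP; rewrite -subr_eq0; apply/eqP; apply: sine_complete => i i0.
  rewrite (L2_dotBl x (mkL2 nu Y)); apply/eqP; rewrite subr_eq0; apply/eqP.
  have -> : <<mkL2 nu Y, e i>> = Num.sqrt 2 * \int[nu]_r (sn i r * Y r).
    by rewrite dot_e Rint_mkL2M//; exact: sn_meas.
  have [_ L] : Ibl nu (fun r => sn i r * Y r) /\
      \int[nu]_r (sn i r * Y_ n r) @[n --> \oo] --> \int[nu]_r (sn i r * Y r).
    apply: (@Rint_dct _ _ _ nu _ _ (cst C)).
    - by move=> n; exact: Ibl_meas (It n i).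
    - by apply: measurable_funM => //; exact: sn_meas.
    - by move=> r; apply: cvgMr; exact: YY.
    - exact: Ibl01_cst.
    - move=> n r; rewrite normrM; apply: le_trans (Yb n r).
      by rewrite ler_piMl// norm_sin_le1.
  have L2 : \int[nu]_r (sn i r * Y_ n r) @[n --> \oo] --> Num.sqrt 2 * xe i / 2.
    apply: cvg_near_cst; near=> n; apply: coefn => //.
    by near: n; exact: nbhs_infty_gt.
  rewrite (cvg_unique _ L L2)//= mulrA mulrA -expr2 sqr_sqrtr//.
  by rewrite -/(xe i); lra.
rewrite xY dot_avg Rint_mkL2M//; last exact: itv_ind_meas.
have C0 : 0 <= C by exact: le_trans (Yb' 0).
have ba : 0 < b - a by rewrite subr_gt0.
have II : Ibl nu (itv_ind a b).
  by apply: (@Ibl01_bounded _ 1); [exact: itv_ind_meas|exact: itv_ind_le1].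
have IY : Ibl nu (fun r => itv_ind a b r * Y r).
  apply: (Ibl_le _ (IblZ C II)).
    by apply: measurable_funM => //; exact: itv_ind_meas.
  move=> r; rewrite [leLHS]normrM [leRHS]normrM [leLHS]mulrC; apply: ler_wpM2r => //.
  exact: le_trans (Yb' r) (ler_norm _).
rewrite normrM (ger0_norm (_ : 0 <= (b - a)^-1)) ?invr_ge0 ?(ltW ba)//.
rewrite mulrC ler_pdivrMr// (ger0_norm C0).
apply: le_trans (le_normr_Rintegral measurableT IY) _.
rewrite -(Rint_itv_len a0 b1 (ltW ab)) -RintZ//; apply: Rint_le.
- exact: (integrable_norm IY).
- exact: IblZ.
- move=> r; rewrite normrM (ger0_norm (itv_ind_ge0 a b r)) mulrC.
  by rewrite ler_wpM2r// itv_ind_ge0.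
Unshelve. all: by end_near. Qed.

End H1_theory.

(** * The constraint set through dyadic averages *)

Section constraint_set.
Variable R : realType.
Local Notation lam := (@lebesgue_measure R).
Local Notation nu := (leb01 R).
Local Notation H := (L2 (leb01 R)).
Local Notation TR := (measurableTypeR R).
Local Notation "<< x , y >>" := (L2_dot x y).
Implicit Types (z : H) (a b p q x e : R).

Let ae_neq p : {ae nu, forall s : TR, (s : R) != p}.
Proof.
exists ([set p] : set R); split; first exact: measurable_set1.
  apply: (@subset_measure0 _ _ _ lam _ [set p]); first exact: measurableI.
    exact: measurable_set1.
    by move=> x [].
  exact: lebesgue_measure_set1.
by move=> x /= h; apply: contrapT => xp; apply: h; apply/eqP.
Qed.

Lemma ae_ge_avg z t a b : {ae nu, forall r : TR, t <= z r} ->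
  0 <= a -> a < b -> b <= 1 -> t <= <<z, avg a b>>.
Proof.
move=> hz a0 ab b1; have ba : 0 < b - a by rewrite subr_gt0.
have mI := itv_ind_meas a b; have mz := L2_meas z.
have mm : measurable_fun setT (fun r => itv_ind a b r * Num.max (z r) t).
  by apply: measurable_funM => //; exact: measurable_maxr.
have E : (fun r => itv_ind a b r * z r)
    = (fun r => itv_ind a b r * Num.max (z r) t) %[ae nu].
  have [N [mN N0 sub]] := hz; exists N; split => // r hr; apply: sub => h.
  by apply: hr => _; rewrite (_ : Num.max (z r) t = z r)//; exact/max_idPl.
rewrite dot_avg.
have -> : \int[nu]_r (itv_ind a b r * z r)
    = \int[nu]_r (itv_ind a b r * Num.max (z r) t).
  by apply: Rint_ae => //; exact: Ibl_meas (Ibl_itv z a b).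
rewrite mulrC ler_pdivlMr// -(Rint_itv_len a0 b1 (ltW ab)) -RintZ; last first.
  by apply: (@Ibl01_bounded _ 1); [exact: itv_ind_meas|exact: itv_ind_le1].
apply: Rint_le.
- by apply: IblZ; apply: (@Ibl01_bounded _ 1); [exact: itv_ind_meas|exact: itv_ind_le1].
- by apply: Ibl_ae (Ibl_itv z a b).
- by move=> r; rewrite mulrC ler_wpM2l ?itv_ind_ge0// le_max lexx orbT.
Qed.

Lemma prim_shift z t p q : 0 <= p -> p < q -> q <= 1 ->
  prim (fun s => z s + t) q - prim (fun s => z s + t) p
  = (q - p) * (<<z, avg p q>> + t).
Proof.
move=> p0 pq q1; have qp : 0 < q - p by rewrite subr_gt0.
have Iz := Ibl_L2 z; have It := Ibl01_cst t.
rewrite !(primD _ Iz It) !(prim_cst t) ?p0 ?q1 ?(ltW (lt_le_trans pq q1)) ?(le_trans p0 (ltW pq))//.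
have -> : (q - p) * (<<z, avg p q>> + t)
    = (q - p) * <<z, avg p q>> + (t * q - t * p) by move: (<<z, _>>) => u; lra.
rewrite dot_avg mulrA divff ?gt_eqF// mul1r.
have -> : \int[nu]_r (itv_ind p q r * z r) = prim z q - prim z p.
  rewrite /prim -RintB; [|exact: Ibl_prim|exact: Ibl_prim].
  apply: Rint_ae.
  - exact: Ibl_meas (Ibl_itv z p q).
  - exact: Ibl_meas (IblB (Ibl_prim q Iz) (Ibl_prim p Iz)).
  - have [N [mN N0 sub]] := ae_neq p; exists N; split => // r hr; apply: sub => /= h.
    apply: hr => _; rewrite itv_indE mulrC -mulrBr; congr (_ * _).
    move: h; rewrite neq_lt => /orP[rp|pr].
      by rewrite (ltW rp) (le_trans (ltW rp) (ltW pq)) leNgt rp/= subrr.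
    by rewrite (ltW pr) [(r <= p)%R]leNgt pr/= subr0.
by move: (prim z q) (prim z p) => u v; lra.
Qed.

(** The blocks [2^-(k+2), 2^-(k+1)] and their mirror images cover the open unit
    interval; their lengths are comparable to their distance to the boundary. *)
Definition blk_len (k : nat) : R := (2^-1) ^+ k.+2.

Definition blk_pos (o : bool) (k : nat) : R :=
  if o then blk_len k else 1 - 2 * blk_len k.

Lemma blk_len_gt0 k : 0 < blk_len k.
Proof. by rewrite exprn_gt0// invr_gt0. Qed.

Lemma blk_len_le k : blk_len k <= 4^-1.
Proof.
have -> : 4^-1 = 2^-1 ^+ 2 :> R by rewrite exprVn; congr (_^-1); lra.
by rewrite ler_wiXn2l ?invr_ge0 ?invf_le1 ?ler1n.
Qed.

Lemma blk_lenS k : 2 * blk_len k.+1 = blk_len k.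
Proof. by rewrite /blk_len [in LHS]exprS mulrA divff// mul1r. Qed.

Lemma blk_pos_itv o k : [/\ 0 <= blk_pos o k, blk_pos o k + blk_len k <= 1 &
  forall r, blk_pos o k <= r <= blk_pos o k + blk_len k ->
    blk_len k / 2 <= parab r].
Proof.
have l0 := blk_len_gt0 k; have l1 := blk_len_le k; rewrite /blk_pos /parab.
move: (blk_len k) l0 l1 => l l0 l1.
have l4 : 4 * l <= 1 by move: l1; rewrite -[4^-1]mul1r ler_pdivlMr// mulrC.
case: o; split; try lra.
  move=> r /andP[r1 r2]; rewrite ifT; last by apply/andP; split; lra.
  have : 0 <= (r - l) * (1 / 2 - r) by apply: mulr_ge0; lra.
  have : 0 <= r * (1 / 2 - l) by apply: mulr_ge0; lra.
  by lra.
move=> r /andP[r1 r2]; rewrite ifT; last by apply/andP; split; lra.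
have : 0 <= (1 - r - l) * (r - 1 / 2) by apply: mulr_ge0; lra.
have : 0 <= (1 - r) * (1 / 2 - l) by apply: mulr_ge0; lra.
by lra.
Qed.

Lemma Qvar_blk o k :
  Qvar (avg (blk_pos o k) (blk_pos o k + blk_len k)) <= 2 * blk_len k.
Proof.
have [p0 p1 _] := blk_pos_itv o k.
have pl : blk_pos o k < blk_pos o k + blk_len k by rewrite ltrDl blk_len_gt0.
case: o p0 p1 pl => p0 p1 pl.
  by apply: le_trans (Qvar_avg_left p0 pl p1) _; rewrite /blk_pos; lra.
by apply: le_trans (Qvar_avg_right p0 pl p1) _; rewrite /blk_pos; lra.
Qed.

Lemma exp_half_lt e : 0 < e -> exists n, (2^-1) ^+ n < e.
Proof.
move=> e0; exists (Num.truncn e^-1).+1.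
rewrite exprVn -[ltRHS]invrK ltf_pV2 ?posrE ?invr_gt0 ?exprn_gt0//.
apply: lt_trans (truncnS_gt _) _.
by rewrite -natrX ltr_nat ltn_expl.
Qed.

Lemma blk_cover x : 0 < x < 1 ->
  exists o k, blk_pos o k <= x <= blk_pos o k + blk_len k.
Proof.
have half y : 0 < y -> y <= 1 / 2 -> exists k, blk_len k <= y <= 2 * blk_len k.
  move=> y0 y2; have [n hn] := exp_half_lt y0.
  have ex : exists k, blk_len k <= y.
    exists n; apply: le_trans (ltW hn).
    by rewrite /blk_len ler_wiXn2l ?invr_ge0 ?invf_le1 ?ler1n// leqW.
  case: (ex_minnP ex) => k hk mink; exists k; rewrite hk/=.
  case: k hk mink => [_ _|k hk mink].
    by apply: le_trans y2 _; rewrite /blk_len exprVn -[leLHS]/(1 / 2); lra.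
  rewrite blk_lenS leNgt; apply/negP => h.
  by have := mink k (ltW h); rewrite ltnn.
move=> /andP[x0 x1]; have [x2|x2] := leP x (1 / 2).
  have [k /andP[h1 h2]] := half x x0 x2; exists true, k.
  by rewrite /blk_pos h1/= -mulr2n -mulr_natl.
have [| |k /andP[h1 h2]] := half (1 - x); [by lra|by lra|].
by exists false, k; rewrite /blk_pos; move: (blk_len k) h1 h2 => l h1 h2; apply/andP; split; lra.
Qed.

Lemma pt_cover a len n x : a <= x <= a + len -> exists2 i, (i < 2 ^ n)%N &
  pt a len n i <= x <= pt a len n i.+1.
Proof.
move=> ax; elim: n => [|n [i hi /andP[h1 h2]]].
  exists 0%N; rewrite // /pt expr0 mul0r mulr0 addr0 divff// mulr1.
  exact: ax.
have hi2 : (i.*2.+1 < 2 ^ n.+1)%N.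
  by rewrite expnS mul2n -doubleS leq_double.
have [h|h] := leP x (pt a len n.+1 i.*2.+1).
  by exists i.*2; [exact: ltnW|rewrite pt_double h1 h].
by exists i.*2.+1 => //; rewrite (ltW h)/= -doubleS pt_double.
Qed.

Variable al : R.

(** At stage n only the first n blocks on each side are constrained, through
    their averages of generation n. *)
Definition K_at (n : nat) : set H :=
  [set z | forall o k, (k < n)%N -> ~ low (blk_pos o k) (blk_len k) n al z].

Lemma K_atP n z : K_at n z <-> forall o k i, (k < n)%N -> (i < 2 ^ n)%N ->
  - al <= <<z, piece (blk_pos o k) (blk_len k) n i>>.
Proof.
split=> [h o k i hk hi|h o k hk [i hi]].
  by rewrite leNgt; apply/negP => h'; apply: (h o k hk); exists i.
by rewrite ltNge h.
Qed.

Lemma measurable_K_at n : measurable (K_at n).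
Proof.
have -> : K_at n = \bigcap_(k in [set k | (k < n)%N])
    (~` low (blk_pos true k) (blk_len k) n al `&`
     ~` low (blk_pos false k) (blk_len k) n al).
  apply/seteqP; split=> [z h k hk|z h o k hk]; first by split; exact: h.
  by case: o; [exact: (h k hk).1|exact: (h k hk).2].
apply: bigcap_measurableType.
by move=> k _; apply: measurableI; apply: measurableC; exact: measurable_low.
Qed.

Lemma K_at_decr n : K_at n.+1 `<=` K_at n.
Proof.
move=> z /K_atP h; apply/K_atP => o k i hk hi.
have [p0 p1 _] := blk_pos_itv o k.
have [c1 c2] := piece_child p0 (blk_len_gt0 k) p1 z hi.
have hi2 : (i.*2.+1 < 2 ^ n.+1)%N.
  by rewrite expnS mul2n -doubleS leq_double.
have := h o k i.*2.+1 (ltnW hk) hi2; have := h o k i.*2 (ltnW hk) (ltnW hi2).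
by rewrite c1 c2; move: (<<z, _>>) (<<z, _>>) => u v; clear; lra.
Qed.

(** The averages recover the function by Lebesgue differentiation. *)
Lemma K_E : K_ al = \bigcap_n K_at n.
Proof.
apply/seteqP; split=> z hz.
  move=> n _; apply/K_atP => o k i hk hi.
  have [p0 p1 _] := blk_pos_itv o k; have l0 := blk_len_gt0 k.
  have /andP[q0 _] := pt_in (blk_pos o k) (ltW l0) (ltnW hi).
  have /andP[_ q1] := pt_in (blk_pos o k) (ltW l0) hi.
  apply: ae_ge_avg; [exact: hz|exact: le_trans q0|exact: pt_lt|exact: le_trans p1].
have Iw : Ibl nu (fun s => z s + al) by apply: IblD; [exact: Ibl_L2|exact: Ibl01_cst].
suff [N [mN N0 sub]] : {ae nu, forall s : TR, 0 <= z s + al}.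
  exists N; split => // s hs; apply: sub => h; apply: hs; move: h.
  by move: (L2_fun z s) => u /=; clear; lra.
apply: ae_ge0_prim => // x e x01 e0.
have [b [k hx]] := blk_cover x01.
have [m hm] := exp_half_lt e0.
pose n := maxn k.+1 m.
have [i hi /andP[h1 h2]] := pt_cover n hx.
have [p0 p1 _] := blk_pos_itv b k; have l0 := blk_len_gt0 k.
have /andP[q0 _] := pt_in (blk_pos b k) (ltW l0) (ltnW hi).
have /andP[_ q1] := pt_in (blk_pos b k) (ltW l0) hi.
exists (pt (blk_pos b k) (blk_len k) n i), (pt (blk_pos b k) (blk_len k) n i.+1).
have pq := pt_lt (blk_pos b k) n i l0.
split => //.
  rewrite pt_step; apply: le_lt_trans hm; rewrite -exprVn.
  apply: (@le_trans _ _ (2^-1 ^+ n)).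
    rewrite ler_piMl ?exprn_ge0 ?invr_ge0//.
    by apply: le_trans (blk_len_le k) _; rewrite invf_le1 ?ler1n.
  by rewrite ler_wiXn2l ?invr_ge0 ?invf_le1 ?ler1n// leq_maxr.
rewrite -subr_ge0 prim_shift//; [|exact: le_trans q0|exact: le_trans p1].
apply: mulr_ge0; first by rewrite subr_ge0 ltW.
have /K_atP/(_ b k i) := hz n I.
by rewrite leq_maxl => /(_ isT hi); rewrite /piece; move: (<<z, _>>) => u; clear; lra.
Qed.

Lemma measurable_K : measurable (K_ al).
Proof. by rewrite K_E; apply: bigcap_measurableType => n _; exact: measurable_K_at. Qed.

End constraint_set.

(** * Integrability and the Ray Hamza property of the constraint set *)

Section ray.
Variables (R : realType) (mu : probability (L2 (leb01 R)) R) (al : R).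
Local Notation lam := (@lebesgue_measure R).
Local Notation H := (L2 (leb01 R)).
Local Notation TR := (measurableTypeR R).
Local Notation "<< x , y >>" := (L2_dot x y).
Implicit Types (z l : H) (a b s : R).

Lemma LlogL_half_indic (A : set H) : measurable A -> LlogL_half mu (\1_A : H -> R).
Proof.
move=> mA; split; first exact: measurable_indic.
have E z : A_half (`|\1_A z : R|) = A_half (0 : R)
    + (A_half (1 : R) - A_half 0) * \1_A z.
  by rewrite indicE; case: (z \in A); rewrite ?normr1 ?normr0 ?mulr1 ?mulr0 ?addr0// addrC subrK.
suff : Ibl mu (fun z => A_half (`|\1_A z : R|)) by [].
apply: (Ibl_eq (fun z => esym (E z))).
by apply: IblD; [exact: Ibl_cst|apply: IblZ; exact: Ibl_indic].
Qed.

Let affine_ge (u v t a b s : R) : - t <= u + a * v -> - t <= u + b * v ->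
  a <= s <= b -> - t <= u + s * v.
Proof.
move=> ha hb /andP[as_ sb]; have [v0|v0] := leP 0 v.
  by apply: le_trans ha _; rewrite lerD2l ler_wpM2r.
by apply: le_trans hb _; rewrite lerD2l ler_wnM2r// ltW.
Qed.

(** Along a line, each constraint on an average is an affine inequality. *)
Lemma ray_interval z l : is_interval [set s : R | K_ al (z + s *: l)].
Proof.
move=> a b /= Ka Kb s asb; move: Ka Kb; rewrite !K_E => Ka Kb n _.
apply/K_atP => o k i hk hi.
have /K_atP/(_ o k i hk hi) := Ka n I; have /K_atP/(_ o k i hk hi) := Kb n I.
move: (piece _ _ _ _) => y.
rewrite !(L2_dotDl z) !(L2_dotZl _ l) => hb ha.
exact: affine_ge ha hb asb.
Qed.

Lemma negligible_subsingleton (A : set R) : (forall s t, A s -> A t -> s = t) ->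
  lam.-negligible A.
Proof.
move=> hA; have [->|/set0P[s As]] := eqVneq A set0; first exact: negligible_set0.
exists [set s]; split; [exact: measurable_set1|exact: lebesgue_measure_set1|].
by move=> t At; exact: hA.
Qed.

(** Inside an interval the indicator equals 1 on a neighbourhood; an interval has at
    most two other points. *)
Lemma hamza_interval (S : set R) : is_interval S -> hamza (\1_S : R -> R).
Proof.
move=> iS; split; first by move=> s; rewrite indicE.
  by apply: measurable_indic; exact: is_interval_measurable.
pose L := [set s | S s /\ forall t, S t -> s <= t].
pose U := [set s | S s /\ forall t, S t -> t <= s].
have nLU : lam.-negligible (L `|` U).
  apply: negligibleU; apply: negligible_subsingleton => s t [Ss hs] [St ht];
    by apply/le_anti; rewrite hs ?ht.
apply: negligibleS nLU => s /= hs.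
have [Ss|nS] := pselect (S s); last first.
  by exfalso; apply: hs => _; rewrite indicE memNset.
apply: contrapT => /not_orP[nL nU]; apply: hs => nreg; exfalso; apply: nreg.
have [a Sa as_] : exists2 a, S a & a < s.
  apply: contrapT => h; apply: nL; split => // t St.
  by rewrite leNgt; apply/negP => ts; apply: h; exists t.
have [b Sb sb] : exists2 b, S b & s < b.
  apply: contrapT => h; apply: nU; split => // t St.
  by rewrite leNgt; apply/negP => ts; apply: h; exists t.
pose d := Num.min (s - a) (b - s).
exists d; first by rewrite lt_min !subr_gt0 as_.
have -> : (\int[lam]_(r in `[(s - d)%R, (s + d)%R]) (((\1_S : R -> R) r)%:E)^-1
    = \int[lam]_(r in `[(s - d)%R, (s + d)%R]) 1)%E.
  apply: eq_integral => r; rewrite inE/= in_itv/= => /andP[r1 r2].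
  have da : d <= s - a by rewrite ge_min lexx.
  have db : d <= b - s by rewrite ge_min lexx orbT.
  rewrite indicE mem_set/=; last by apply: (iS a b) => //; apply/andP; split; lra.
  by rewrite inver oner_eq0 invr1.
rewrite integral_cst; last exact: measurable_itv.
rewrite mul1e.
have e : (lebesgue_measure (`[(s - d)%R, (s + d)%R]%classic : set R) < +oo)%E.
  by rewrite lebesgue_measure_itv/=; case: ifP => _; rewrite -?EFinB ltry.
exact: e.
Qed.

Lemma ray_hamza_K l : ray_hamza mu l (\1_(K_ al) : H -> R).
Proof.
have mK := measurable_K al.
split; [exact: Ibl_indic|by move=> z; rewrite indicE|].
exists (\1_(K_ al)); split; [by move=> z; rewrite indicE|by apply: nearW|].
move=> z; have := hamza_interval (@ray_interval z l).
by congr (hamza _); apply/funext => s; rewrite !indicE; congr ((nat_of_bool _)%:R);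
  apply/idP/idP; rewrite !inE.
Qed.

End ray.

(** * The limit of the soft indicators *)

Section soft_limit.
Variable R : realType.
Local Notation H := (L2 (leb01 R)).
Local Notation "<< x , y >>" := (L2_dot x y).
Implicit Types (z k : H) (s : seq H).
Variable al : R.

Let kap (N : nat) : R := N.+1%:R ^+ 2.
Let beta (N : nat) : R := al + N.+1%:R^-1.

(** Here kap (x + beta) = M^2 (x + al) + M with M = N + 1. The second term decides the
    boundary case x = - al: the limit is the indicator of the closed half-spaces. *)
Definition soft_at N s : H -> R := soft (kap N) (beta N) s.

Let wgtE N x : wgt (kap N) (beta N) x = expR (- (N.+1%:R ^+ 2 * (x + al) + N.+1%:R)).
Proof.
rewrite /wgt /kap /beta addrA [in LHS]mulrDr; congr (expR (- (_ + _))).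
by rewrite expr2 -mulrA divff// mulr1.
Qed.

Let cvg_expN : expR (- N.+1%:R) @[N --> \oo] --> (0 : R).
Proof.
by have := @cvgn_expR R; rewrite -(cvg_shiftS (fun n : nat => expR (1 *- n) : R)).
Qed.

Lemma cvg_wgt x :
  expR (- wgt (kap N) (beta N) x) @[N --> \oo] --> ((- al <= x)%R%:R : R).
Proof.
have [xa|xa] := leP (- al) x.
  have w0 : wgt (kap N) (beta N) x @[N --> \oo] --> (0 : R).
    apply: (@squeeze_cvgr _ _ _ _ (fun=> 0) (fun N : nat => expR (- N.+1%:R))) => //.
    - apply: nearW => N; rewrite wgt_ge0/= wgtE ler_expR lerN2 lerDr.
      by rewrite mulr_ge0 ?sqr_ge0// -lerBlDr sub0r.
    - exact: cvg_cst.
  have h : - wgt (kap N) (beta N) x @[N --> \oo] --> - (0 : R) by exact: cvgN.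
  have := cvg_comp _ _ h (@continuous_expR R (- 0)).
  by rewrite oppr0 expR0.
apply: (@squeeze_cvgr _ _ _ _ (fun=> 0) (fun N : nat => expR (- N.+1%:R))) => //.
- near=> N; rewrite expR_ge0/= ler_expR lerN2 wgtE.
  apply: le_trans (expR_ge1Dx _).
  pose t := - (x + al); have t0 : 0 < t by rewrite /t; lra.
  have : 2 / t <= N.+1%:R.
    apply: (@le_trans _ _ N%:R); last by rewrite ler_nat.
    by near: N; exact: nbhs_infty_ger.
  rewrite ler_pdivrMr// => h2.
  have := ler_wpM2l (ler0n R N.+1) h2.
  by rewrite /t; move: (N.+1%:R : R) => M; lra.
- exact: cvg_cst.
Unshelve. all: by end_near. Qed.

Lemma cvg_soft s z :
  soft_at N s z @[N --> \oo] --> ((all (fun k => - al <= <<z, k>>) s)%:R : R).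
Proof.
elim: s => [|k s IH].
  rewrite (_ : (fun N => soft_at N [::] z) = cst 1); first exact: cvg_cst.
  by apply/funext => N; rewrite /soft_at /soft big_nil oppr0 expR0.
rewrite (_ : (fun N => soft_at N (k :: s) z)
    = (fun N => expR (- wgt (kap N) (beta N) <<z, k>>) * soft_at N s z)); last first.
  by apply/funext => N; rewrite /soft_at /soft big_cons opprD expRD.
by rewrite /= -mulnb natrM; apply: cvgM => //; exact: cvg_wgt.
Qed.

Lemma soft_at_meas N s : measurable_fun setT (soft_at N s).
Proof. exact: soft_meas. Qed.

Lemma Rint_soft (mu : probability H R) s (A : set H) (g : H -> R) :
  measurable A -> (forall z, A z <-> all (fun k => - al <= <<z, k>>) s) ->
  Ibl mu g -> \int[mu]_z (soft_at N s z * g z) @[N --> \oo] -->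
    \int[mu]_z (\1_A z * g z).
Proof.
move=> mA As Ig.
have [] // : Ibl mu (fun z => \1_A z * g z) /\
   \int[mu]_z (soft_at N s z * g z) @[N --> \oo] --> \int[mu]_z (\1_A z * g z).
apply: (@Rint_dct _ _ _ mu _ _ (fun z => `|g z|)).
- by move=> N; apply: measurable_funM; [exact: soft_at_meas|exact: Ibl_meas Ig].
- by apply: measurable_funM; [exact: measurable_indic|exact: Ibl_meas Ig].
- move=> z; apply: cvgMl; rewrite indicE.
  rewrite (_ : (z \in A) = all (fun k => - al <= <<z, k>>) s); first exact: cvg_soft.
  by apply/idP/idP; rewrite inE => /As.
- exact: integrable_norm.
- by move=> N z; rewrite normrM ler_piMl// ger0_norm ?soft_ge0// soft_le1.
Qed.

End soft_limit.

(** * The flux through a block *)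

Section flux.
Variables (R : realType) (mu : probability (L2 (leb01 R)) R).
Hypothesis gm : gaussian_measure mu 0 (@covQ R).
Local Notation H := (L2 (leb01 R)).
Local Notation "<< x , y >>" := (L2_dot x y).
Implicit Types (z k : H) (s : seq H).
Variables (kap beta : R).
Hypothesis kap0 : 0 <= kap.
Local Notation w k z := (wgt kap beta <<z, k>>).
Local Notation phi := (soft kap beta).
Local Notation V := (Qvar (oneH R)).

Let Iphi s : Ibl mu (phi s).
Proof.
apply: (@Ibl_bounded _ _ _ mu 1) => [|z]; first exact: soft_meas.
by rewrite ger0_norm ?soft_ge0// soft_le1.
Qed.

Lemma flux_le_size s z : phi s z * \sum_(k <- s) w k z * kap <= \sum_(k <- s) kap.
Proof.
apply: (@expR_sumN_bound _ _ s (fun k => w k z) (fun=> kap)) => // k.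
exact: wgt_ge0.
Qed.

Lemma flux_ge0 s z : 0 <= \sum_(k <- s) w k z * kap.
Proof. by apply: sumr_ge0 => k _; rewrite mulr_ge0// wgt_ge0. Qed.

Lemma flux_Ibl (psi : H -> R) s : measurable_fun setT psi ->
  (forall z, 0 <= psi z <= phi s z) ->
  Ibl mu (fun z => psi z * \sum_(k <- s) w k z * kap).
Proof.
move=> mpsi hpsi; apply: (@Ibl_bounded _ _ _ mu (\sum_(k <- s) kap)).
  apply: measurable_funM => //; apply: measurable_sum => k.
  by apply: measurable_funM => //; exact: wgt_meas.
move=> z; have /andP[p0 p1] := hpsi z.
rewrite ger0_norm ?mulr_ge0 ?flux_ge0//.
by apply: le_trans (flux_le_size s z); rewrite ler_wpM2r ?flux_ge0.
Qed.

Let young (la p y : R) : 0 < la -> 0 <= p <= 1 ->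
  p * y <= y + 2^-1 * (la * (1 - p) + la^-1 * (y * y)).
Proof.
move=> la0 p01; pose t := 1 - p.
have tt : t ^+ 2 <= t by rewrite /t; nra.
have h : la * la^-1 = 1 by rewrite divff// gt_eqF.
have li : 0 < la^-1 by rewrite invr_gt0.
have h1 := ler_wpM2l (ltW la0) tt.
have h2 : 0 <= la^-1 * (la * t + y) ^+ 2 by rewrite mulr_ge0 ?sqr_ge0// ltW.
have h3 : la^-1 * (la * t + y) ^+ 2
    = (la * la^-1) * (la * t ^+ 2) + 2 * (la * la^-1) * (t * y) + la^-1 * (y * y).
  by move: la^-1 => u; lra.
rewrite h3 h in h2; move: h1 h2; rewrite /t.
by move: la^-1 => u; lra.
Qed.

(** Gaussian integration by parts against the constant direction turns the flux into
    the expectation of (phi - 1) <z, 1>, which is small when phi is mostly 1. *)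
Lemma flux_bound (psi : H -> R) s (c la : R) : 0 < c -> 0 < la ->
  (forall k, k \in s -> c <= <<covQ (oneH R), k>>) -> measurable_fun setT psi ->
  (forall z, 0 <= psi z <= phi s z) ->
  \int[mu]_z (psi z * \sum_(k <- s) w k z * kap)
  <= c^-1 * (2^-1 * (la * \int[mu]_z (1 - phi s z) + la^-1 * V)).
Proof.
move=> c0 la0 cs mpsi hpsi.
pose f2 z := phi s z * \sum_(k <- s) w k z * (kap * <<covQ (oneH R), k>>).
(* Replace kap by kap <Q 1, k> / c, so that the sum becomes the derivative of phi in
   the direction Q 1. *)
have [M [_ M2]] := trigC_bdd (trigC_soft beta kap0 (oneH R) s).
have [_ mf2] := trigC_meas (trigC_soft beta kap0 (oneH R) s).
have If2 : Ibl mu f2 by apply: (@Ibl_bounded _ _ _ mu M).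
apply: (@le_trans _ _ (\int[mu]_z (c^-1 * f2 z))).
  apply: Rint_le; [exact: flux_Ibl|exact: IblZ|].
  move=> z; have /andP[p0 p1] := hpsi z.
  rewrite ler_pdivlMl// mulrCA.
  apply: (@le_trans _ _ (phi s z * (c * \sum_(k <- s) w k z * kap))).
    by rewrite ler_wpM2r// mulr_ge0 ?flux_ge0// ltW.
  rewrite ler_wpM2l ?soft_ge0// mulr_sumr big_seq [leRHS]big_seq.
  apply: ler_sum => k ks; rewrite mulrCA ler_wpM2l ?wgt_ge0//.
  by rewrite [leLHS]mulrC ler_wpM2l// cs.
rewrite RintZ//; apply: ler_wpM2l; first by rewrite invr_ge0 ltW.
rewrite soft_ibp//.
have IY := integrable_gauss gm (oneH R).
have IYY := integrable_gaussM gm (oneH R) (oneH R).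
have I1 : Ibl mu (fun z => 1 - phi s z) by apply: IblB => //; exact: Ibl_cst.
have I2 : Ibl mu (fun z => la * (1 - phi s z) + la^-1 * (<<z, oneH R>> * <<z, oneH R>>)).
  by apply: IblD; exact: IblZ.
apply: (@le_trans _ _ (\int[mu]_z (<<z, oneH R>>
   + 2^-1 * (la * (1 - phi s z) + la^-1 * (<<z, oneH R>> * <<z, oneH R>>))))).
  apply: Rint_le.
  - apply: (Ibl_le _ IY).
      by apply: measurable_funM; [exact: soft_meas|exact: Ibl_meas IY].
    by move=> z; rewrite normrM ler_piMl// ger0_norm ?soft_ge0// soft_le1.
  - by apply: IblD => //; exact: IblZ.
  - by move=> z; apply: young => //; rewrite soft_ge0 soft_le1.
rewrite RintD//; last exact: IblZ.
rewrite (mean_gauss gm) add0r RintZ// RintD; [|exact: IblZ|exact: IblZ].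
by rewrite !RintZ// (cov_gauss gm).
Qed.

End flux.

(** * Bounded variation of the constraint set *)

Lemma bnd_algebra (R : realFieldType) (y x c l v : R) : y * x <= c * l ->
  2 * y * x + 2 * l * v <= 2 * (c + v) * l.
Proof. lra. Qed.

Section bounded_variation.
Variables (R : realType) (mu : probability (L2 (leb01 R)) R) (eps al : R).
Hypotheses (gm : gaussian_measure mu 0 (@covQ R)) (al0 : 0 < al).
Local Notation H := (L2 (leb01 R)).
Local Notation "<< x , y >>" := (L2_dot x y).
Local Notation V := (Qvar (oneH R)).
Implicit Types (z k : H) (n i : nat) (p : bool * nat).

Definition blocks n : seq (bool * nat) :=
  [seq (o, j) | o <- [:: true; false], j <- iota 0 n].

Definition blk_pieces n p : seq H :=
  [seq piece (blk_pos R p.1 p.2) (blk_len R p.2) n i | i <- iota 0 (2 ^ n)].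

Definition all_pieces n : seq H := flatten [seq blk_pieces n p | p <- blocks n].

Lemma mem_blocks n p : (p \in blocks n) = (p.2 < n)%N.
Proof.
apply/allpairsP/idP => [[[b j]/= [_ hk ->]]|hp].
  by move: hk; rewrite mem_iota.
by exists p; case: p hp => -[] k hk; rewrite !inE mem_iota.
Qed.

Lemma blk_piecesP n p z : all (fun k => - al <= <<z, k>>) (blk_pieces n p) <->
  ~ low (blk_pos R p.1 p.2) (blk_len R p.2) n al z.
Proof.
split=> [/allP h [i hi]|h].
  by rewrite ltNge h// map_f// mem_iota.
apply/allP => y /mapP[i]; rewrite mem_iota => /= hi ->.
by rewrite leNgt; apply/negP => hl; apply: h; exists i.
Qed.

Lemma all_piecesP n z : all (fun k => - al <= <<z, k>>) (all_pieces n) <->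
  K_at al n z.
Proof.
split=> [/allP h o j hj|h].
  apply/(blk_piecesP n (o, j)); apply/allP => y hy; apply: h.
  apply/flattenP; exists (blk_pieces n (o, j)) => //.
  by apply: map_f; rewrite mem_blocks.
apply/allP => y /flattenP[t /mapP[p]]; rewrite mem_blocks => hp ->; move: y {t}.
by apply/allP/blk_piecesP; exact: h.
Qed.

Lemma covQ_blk_pieces n p k : k \in blk_pieces n p ->
  blk_len R p.2 / 4 <= <<covQ (oneH R), k>>.
Proof.
move=> /mapP[i]; rewrite mem_iota => /= hi ->.
have [p0 p1 hl] := blk_pos_itv R p.1 p.2; have l0 := blk_len_gt0 R p.2.
have /andP[q0 _] := pt_in (blk_pos R p.1 p.2) (ltW l0) (ltnW hi).
have /andP[_ q1] := pt_in (blk_pos R p.1 p.2) (ltW l0) hi.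
have -> : blk_len R p.2 / 4 = blk_len R p.2 / 2 / 2 by move: (blk_len _ _) => l; lra.
apply: covQ_one_avg; [exact: le_trans q0|exact: le_trans p1|exact: pt_lt|].
by move=> r /andP[r1 r2]; apply: hl; rewrite (le_trans q0 r1) (le_trans r2 q1).
Qed.

Lemma pieces_avg n k : k \in all_pieces n ->
  exists a b, [/\ 0 <= a, a < b, b <= 1 & k = avg a b].
Proof.
move=> /flattenP[_ /mapP[p _ ->] /mapP[i]]; rewrite mem_iota => /= hi ->.
have [p0 p1 hl] := blk_pos_itv R p.1 p.2; have l0 := blk_len_gt0 R p.2.
have /andP[q0 _] := pt_in (blk_pos R p.1 p.2) (ltW l0) (ltnW hi).
have /andP[_ q1] := pt_in (blk_pos R p.1 p.2) (ltW l0) hi.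
exists (pt (blk_pos R p.1 p.2) (blk_len R p.2) n i),
  (pt (blk_pos R p.1 p.2) (blk_len R p.2) n i.+1).
by split; [exact: le_trans q0|exact: pt_lt|exact: le_trans p1|].
Qed.

Lemma sum_blk_len n : \sum_(p <- blocks n) blk_len R p.2 <= 1.
Proof.
have h : \sum_(j <- iota 0 n) blk_len R j = 2^-1 - 2^-1 ^+ n.+1.
  elim: n => [|n IH]; first by rewrite big_nil expr1 subrr.
  rewrite -addn1 iotaD big_cat/= IH add0n big_seq1 addn1 /blk_len.
  by rewrite [in LHS](exprS _ n.+1) [in RHS](exprS _ n.+1); move: (_ ^+ _) => x; lra.
have -> : \sum_(p <- blocks n) blk_len R p.2
    = \sum_(b <- [:: true; false]) \sum_(j <- iota 0 n) blk_len R j.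
  exact: big_allpairs.
rewrite !big_cons big_nil h addr0.
have : 0 <= 2^-1 ^+ n.+1 :> R by rewrite exprn_ge0// invr_ge0.
by move: (_ ^+ _) => x; lra.
Qed.

(** This localizes the estimate: in the flux through one block the soft indicator of
    all the constraints is replaced by that of the block alone. *)
Lemma soft_sub kap beta n p z : p \in blocks n ->
  soft kap beta (all_pieces n) z <= soft kap beta (blk_pieces n p) z.
Proof.
move=> pn; rewrite /soft ler_expR lerN2 /all_pieces big_flatten big_map.
rewrite (big_rem p)//= lerDl; apply: sumr_ge0 => q _; apply: sumr_ge0 => k _.
exact: wgt_ge0.
Qed.

Section test_field.
Variables (G : H -> H) (g : H -> R) (C0 : R).
Hypotheses (Gg : Dstar_graph mu G g) (C00 : 0 <= C0)
  (GC : forall z (a b : R), 0 <= a -> a < b -> b <= 1 -> `|<<G z, avg a b>>| <= C0).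

Let Ig : Ibl mu g.
Proof.
have [_ _ Lg _] := Gg.
apply/Lfun1_integrable; apply: Lfun_subset12 Lg.
exact: fin_num_measure.
Qed.

Let mG k : measurable_fun setT (fun z => <<k, G z>>).
Proof.
have [mG _ _ _] := Gg.
by apply: (measurableT_comp (f := L2_dot k)) => //; exact: measurable_L2_dot.
Qed.

Let bnd (F : bool * nat -> R) p : R :=
  2 * (blk_len R p.2)^-1 ^+ 3 * F p + 2 * blk_len R p.2 * V.

(** By definition of the adjoint, the left-hand side is the expectation of <D phi,
    G>, in which every vector k of the gradient contributes at most C0 times its
    weight. Then flux_bound applies to each block, with c = len / 4 and the Young
    parameter len^-2. *)
Lemma stage_bound kap beta n : 0 <= kap ->
  \int[mu]_z (soft kap beta (all_pieces n) z * g z)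
  <= C0 * \sum_(p <- blocks n)
       bnd (fun p => \int[mu]_z (1 - soft kap beta (blk_pieces n p) z)) p.
Proof.
move=> kap0; have [_ _ _ /(_ _ (Cb1_soft beta kap0 (all_pieces n))) <-] := Gg.
pose S := all_pieces n.
pose f z := soft kap beta S z * \sum_(k <- S) wgt kap beta <<z, k>> * kap.
have mS := soft_meas kap beta S.
have If : Ibl mu f.
  by apply: flux_Ibl => // z; rewrite soft_ge0 lexx.
have E z : <<gradient (soft kap beta S) z, G z>>
    = soft kap beta S z * \sum_(k <- S) wgt kap beta <<z, k>> * (kap * <<k, G z>>).
  by rewrite (gradient_eq (is_diff_soft kap beta S z)) dot_soft_grad.
have le_f z : `|<<gradient (soft kap beta S) z, G z>>| <= C0 * f z.
  rewrite E normrM ger0_norm ?soft_ge0// mulrCA ler_wpM2l ?soft_ge0//.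
  apply: le_trans (ler_norm_sum _ _ _) _; rewrite mulr_sumr big_seq [leRHS]big_seq.
  apply: ler_sum => k /pieces_avg[a [b [a0 ab b1 ->]]].
  rewrite normrM ger0_norm ?wgt_ge0// mulrCA ler_wpM2l ?wgt_ge0//.
  by rewrite normrM ger0_norm// mulrC ler_wpM2r// L2_dotC GC.
have mE : measurable_fun setT (fun z => <<gradient (soft kap beta S) z, G z>>).
  under eq_fun do rewrite E.
  apply: measurable_funM => //; apply: measurable_sum => k.
  by apply: measurable_funM; [exact: wgt_meas|exact: measurable_funM].
have f0 z : 0 <= f z by rewrite mulr_ge0 ?soft_ge0// flux_ge0.
apply: (@le_trans _ _ (\int[mu]_z (C0 * f z))).
  apply: Rint_le; [|exact: IblZ|by move=> z; exact: le_trans (ler_norm _) (le_f z)].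
  apply: (Ibl_le mE (IblZ C0 If)) => z; apply: le_trans (le_f z) (ler_norm _).
rewrite RintZ// ler_wpM2l//.
pose F p z := if p \in blocks n then
  soft kap beta S z * \sum_(k <- blk_pieces n p) wgt kap beta <<z, k>> * kap else 0.
have S01 p z : p \in blocks n ->
    0 <= soft kap beta S z <= soft kap beta (blk_pieces n p) z.
  by move=> pn; rewrite soft_ge0 soft_sub.
have -> : \int[mu]_z f z = \int[mu]_z (\sum_(p <- blocks n) F p z).
  apply: eq_Rintegral => z _; rewrite /f {2}/S /all_pieces big_flatten big_map mulr_sumr.
  by rewrite big_seq [RHS]big_seq; apply: eq_bigr => p pn; rewrite /F pn.
rewrite Rint_sum; last first.
  move=> p; rewrite /F; case: (boolP (p \in _)) => pn; last exact: Ibl_cst.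
  by apply: flux_Ibl => // z; exact: S01.
rewrite big_seq [leRHS]big_seq; apply: ler_sum => p pn.
rewrite (_ : F p = fun z => soft kap beta S z *
  \sum_(k <- blk_pieces n p) wgt kap beta <<z, k>> * kap); last first.
  by apply/funext => z; rewrite /F pn.
have l0 := blk_len_gt0 R p.2; set l := blk_len R p.2 in l0 *.
have li : l * l^-1 = 1 by rewrite divff// gt_eqF.
have h := @flux_bound _ _ gm kap beta kap0 (soft kap beta S) (blk_pieces n p)
  (l / 4) (l^-1 ^+ 2) _ _ (@covQ_blk_pieces n p) mS (fun z => S01 p z pn).
apply: le_trans (h _ _) _; first by rewrite divr_gt0.
  by rewrite exprn_gt0// invr_gt0.
rewrite /bnd -/l invf_div exprVn invrK.
move: (\int[mu]_z _) => X; rewrite le_eqVlt; apply/orP; left; apply/eqP.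
have -> : l ^- 2 = l^-1 ^+ 2 by rewrite exprVn.
move: (l^-1) li => y ly.
have -> : 2 * l * V = 2 * (l * y) * l * V by rewrite ly mulr1.
lra.
Qed.

(** Letting the soft indicators sharpen, the flux through a block of length len is
    at most a constant times len^-3 len^4 + len, and the lengths are summable. *)
Lemma stage_limit n :
  \int[mu]_z (\1_(K_at al n) z * g z) <= C0 * (2 * (chain_cst al + V)).
Proof.
pose q p := fine (mu (low (blk_pos R p.1 p.2) (blk_len R p.2) n al)).
have qle p : q p <= chain_cst al * blk_len R p.2 ^+ 4.
  have [p0 p1 _] := blk_pos_itv R p.1 p.2.
  have := low_bound gm p0 (blk_len_gt0 R p.2) p1 al0 n (Qvar_blk R p.1 p.2).
  exact.
have cC : 0 <= chain_cst al.
  have := le_trans (fine_ge0 (measure_ge0 mu _)) (qle (true, 0%N)).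
  by rewrite pmulr_lge0// exprn_gt0// blk_len_gt0.
have V0 : 0 <= V := Qvar_ge0 gm _.
apply: (@le_trans _ _ (C0 * \sum_(p <- blocks n) bnd q p)); last first.
  rewrite ler_wpM2l//; apply: (@le_trans _ _ (\sum_(p <- blocks n)
      2 * (chain_cst al + V) * blk_len R p.2)).
    apply: ler_sum => p _; rewrite /bnd.
    have := qle p; have l0 := blk_len_gt0 R p.2; move: (q p) (blk_len R p.2) l0 => x l l0 hx.
    have li : l * l^-1 = 1 by rewrite divff// gt_eqF.
    have l3 : 0 <= l^-1 ^+ 3 by rewrite exprn_ge0// invr_ge0 ltW.
    have := ler_wpM2l l3 hx.
    have -> : l^-1 ^+ 3 * (chain_cst al * l ^+ 4)
        = (l * l^-1) ^+ 3 * (chain_cst al * l) by move: l^-1 (chain_cst al) => y c; lra.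
    rewrite li expr1n mul1r; exact: bnd_algebra.
  rewrite -mulr_sumr ler_piMr ?sum_blk_len//.
  by rewrite mulr_ge0// addr_ge0.
have Ic := Ibl_cst mu 1.
have L p : \int[mu]_z (1 - soft_at al N (blk_pieces n p) z) @[N --> \oo] --> q p.
  have mlow : measurable (low (blk_pos R p.1 p.2) (blk_len R p.2) n al).
    exact: measurable_low.
  have := Rint_soft (measurableC mlow) (fun z => iff_sym (blk_piecesP n p z)) Ic.
  have -> : \int[mu]_z (\1_(~` low (blk_pos R p.1 p.2) (blk_len R p.2) n al) z * cst 1 z)
      = 1 - q p.
    rewrite /q -(Rint_indic mu mlow) -[X in X - _](Rint_cst mu 1) -RintB//; last exact: Ibl_indic.
    apply: eq_Rintegral => z _; rewrite mulr1 !indicE in_setC.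
    by case: (_ \in _); rewrite ?subrr ?subr0.
  have Is N : Ibl mu (soft_at al N (blk_pieces n p)).
    apply: (@Ibl_bounded _ _ _ mu 1); first exact: soft_at_meas.
    by move=> z; rewrite ger0_norm ?soft_ge0// soft_le1.
  move=> h; rewrite -(subKr 1 (q p)).
  rewrite (_ : (fun N : nat => _) = (fun N =>
    1 - \int[mu]_z (soft_at al N (blk_pieces n p) z * cst 1 z))).
    by apply: cvgB => //; exact: cvg_cst.
  apply/funext => N.
  rewrite RintB// Rint_cst; congr (1 - _).
  by apply: eq_Rintegral => z _; rewrite mulr1.
have mK := measurable_K_at al n.
have L1 := Rint_soft mK (fun z => iff_sym (all_piecesP n z)) Ig.
have L2 : C0 * \sum_(p <- blocks n)
    bnd (fun p => \int[mu]_z (1 - soft_at al N (blk_pieces n p) z)) p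
    @[N --> \oo] --> C0 * \sum_(p <- blocks n) bnd q p.
  apply: cvgMr; apply: cvg_sum_seq => p; rewrite /bnd.
  by apply: cvgD; [apply: cvgMr; exact: L|exact: cvg_cst].
apply: ler_cvg_to L1 L2 _; apply: nearW => N.
exact: stage_bound (sqr_ge0 _).
Qed.

(** The sets K_at n decrease to K_ al, while the bound does not depend on n. *)
Lemma Dstar_K_bound :
  \int[mu]_z (g z * \1_(K_ al) z) <= C0 * (2 * (chain_cst al + V)).
Proof.
have L : \int[mu]_z (\1_(K_at al n) z * g z) @[n --> \oo] -->
    \int[mu]_z (g z * \1_(K_ al) z).
  suff [_] : Ibl mu (fun z => g z * \1_(K_ al) z) /\
    \int[mu]_z (\1_(K_at al n) z * g z) @[n --> \oo] -->
      \int[mu]_z (g z * \1_(K_ al) z) by [].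
  apply: (@Rint_dct _ _ _ mu _ _ (fun z => `|g z|)).
  - move=> n; apply: measurable_funM; last exact: Ibl_meas Ig.
    by apply: measurable_indic; exact: measurable_K_at.
  - apply: measurable_funM; first exact: Ibl_meas Ig.
    by apply: measurable_indic; exact: measurable_K.
  - move=> z; rewrite [g z * _]mulrC; apply: cvgMl; apply: cvg_near_cst.
    have [zK|zK] := pselect (K_ al z).
      apply: nearW => n; rewrite !indicE mem_set ?mem_set//.
      by move: zK; rewrite K_E; exact.
    have [n0 hn0] : exists n0, ~ K_at al n0 z.
      by apply/existsNP => h; apply: zK; rewrite K_E => n _; exact: h.
    near=> n; rewrite !indicE [X in _ = (nat_of_bool X)%:R]memNset// memNset//.
    have : (n0 <= n)%N by near: n; exact: nbhs_infty_ge.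
    elim: (n) => [|m IH]; first by rewrite leqn0 => /eqP <-.
    rewrite leq_eqVlt => /predU1P[<-//|]; rewrite ltnS => /IH h hK.
    exact: h (K_at_decr hK).
  - exact: integrable_norm.
  - move=> n z; rewrite normrM ler_piMl// indicE.
    by case: (_ \in _); rewrite ?normr1 ?normr0.
apply: ler_cvg_to L (cvg_cst _) _; apply: nearW => n; exact: stage_limit.
Unshelve. all: by end_near. Qed.

End test_field.

Lemma BV_K : 0 < eps -> BV eps mu (\1_(K_ al) : H -> R).
Proof.
move=> eps0; have mK := measurable_K al.
split; first exact: LlogL_half_indic.
have [C0 [C00 hC0]] := H1_sup eps0.
pose B := C0 * (2 * (`|chain_cst al| + V)).
have V0 : 0 <= V := Qvar_ge0 gm _.
have B0 : 0 <= B by rewrite !mulr_ge0// addr_ge0.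
apply: (@le_lt_trans _ _ B%:E); last by rewrite ltry.
apply: ge_ereal_sup => _ [G [[m [g [l [_ hl GE]]]] nG] <-].
have HG z : H1_space eps (G z).
  rewrite GE; apply: (big_ind (H1_space eps)).
  - exact: H1_space0.
  - by move=> x y hx hy; rewrite -[x]scale1r; exact: H1_space_lin.
  - move=> j _; rewrite -[_ *: _]addr0; apply: H1_space_lin; last exact: H1_space0.
    by have [] := hl j.
rewrite /Dstar; case: xgetP => [f _ fG|_]; last first.
  rewrite (_ : (fun z => _) = fun=> 0%E) ?integral0 ?lee_fin//.
  by apply/funext => z; rewrite /= mul0r.
have GC z (a b : R) : 0 <= a -> a < b -> b <= 1 -> `|<<G z, avg a b>>| <= C0.
  exact: hC0.
have [_ _ Lf _] := fG.
have If : Ibl mu f.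
  apply/Lfun1_integrable; apply: Lfun_subset12 Lf; exact: fin_num_measure.
rewrite Rint_ext; last first.
  apply: (Ibl_le _ If).
    by apply: measurable_funM; [exact: Ibl_meas If|exact: measurable_indic].
  move=> z; rewrite normrM ler_piMr// indicE.
  by case: (_ \in _); rewrite ?normr1 ?normr0.
rewrite lee_fin; apply: le_trans (Dstar_K_bound fG C00 GC) _.
by rewrite ler_wpM2l// ler_wpM2l// lerD2r ler_norm.
Qed.

End bounded_variation.

Theorem theorem6p2 (R : realType) (mu : probability (L2 (leb01 R)) R)
    (eps alpha : R) :
  gaussian_measure mu 0 (@covQ R) ->
  0 < eps <= 3 / 2 ->
  0 < alpha ->
  (BV eps mu `&` ray_hamza_basis mu) \1_(K_ alpha).
Proof.
move=> gm /andP[eps0 _] al0; split; first exact: BV_K.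
by move=> k _; exact: ray_hamza_K.
Qed.
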